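(* Let $r=8$. For every $\Omega\in\mathcal S^r$ there exists $q_0=q_0(\Omega)$ such that the operator $\tilde{\mathcal T}_{q_0}:C^r_{q_0,\mathrm{sym}}\to\ell^\infty$, $\tilde{\mathcal T}_{q_0}(u)=(\tilde\ell_{q_0}(u),\tilde\ell_{q_0+1}(u),\dots,\tilde\ell_q(u),\dots)$, is injective.
   Context: $\mathcal S^r$: strictly convex bounded open planar domains with $C^{r+1}$ boundary (counterclockwise), invariant under a reflection. For $\Omega\in\mathcal S^r$ of perimeter $1$: arc length $s$ with $s=0$ at the marked point (an intersection of a fixed symmetry axis with $\partial\Omega$), radius of curvature $\rho$, Lazutkin parameter $x(s)=C_\Omega\int_0^s\rho^{-2/3}$ with $C_\Omega=[\int_{\partial\Omega}\rho^{-2/3}ds]^{-1}$, Lazutkin weight $\mu(x)=1/(2C_\Omega\rho(x)^{1/3})$. For $q\ge2$, $\ell_q(\nu)=\sum_{k=0}^{q-1}\nu(x_q^k)\sin\varphi_q^k$, where $x_q^k$ ($x_q^0=0$) are the Lazutkin coordinates of the collision points and $\varphi_q^k$ the reflection angles (outgoing chord vs positive tangent) of a marked symmetric maximal periodic orbit of rotation number $1/q$ (the billiard orbit through the marked point maximizing perimeter among axially symmetric inscribed $q$-gons containing the marked point, vertices in counterclockwise order winding once; for even $q$ also containing the other axis point); $\tilde\ell_q(u)=\ell_q(\mu^{-1}u)$. $C^r_{q_0,\mathrm{sym}}$ is the space of even $C^r$ functions $\nu(x)=\sum_{k\ge0}\hat\nu_k\cos(2\pi kx)$ of $\mathbb T^1$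 with $\hat\nu_0=\dots=\hat\nu_{q_0-1}=0$. *)

(* Defs.v *)
From Stdlib Require Import Reals Lra List.
Import ListNotations.
Open Scope R_scope.

Fixpoint Ck (k : nat) (f : R -> R) : Prop :=
  match k with
  | O => continuity f
  | S k' => exists f' : R -> R,
      (forall x, derivable_pt_lim f x (f' x)) /\ Ck k' f'
  end.

Definition is_RInt (f : R -> R) (a b v : R) : Prop :=
  exists pr : Riemann_integrable f a b, RiemannInt pr = v.

Definition sumR (n : nat) (f : nat -> R) : R :=
  fold_right Rplus 0 (map f (seq 0 n)).

Definition period1 (f : R -> R) : Prop := forall x, f (x + 1) = f x.

(** Reflection of the plane across the line through (a1,a2) with unit
    direction (u1,u2). *)
Definition reflect (a1 a2 u1 u2 : R) (p : R * R) : R * R :=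
  let w1 := fst p - a1 in let w2 := snd p - a2 in
  let d := w1 * u1 + w2 * u2 in
  (a1 + 2 * d * u1 - w1, a2 + 2 * d * u2 - w2).

(** The boundary of Omega in S^r, normalized to perimeter 1:
    gamma = (g1,g2) is the counterclockwise arc-length parametrization
    (1-periodic, unit speed, simple on [0,1)), of class C^{r+1}, with
    positive curvature (strict convexity, radius of curvature defined);
    (d1,d2) = gamma', (e1,e2) = gamma''.  Invariance under a reflection
    whose axis passes through the marked point gamma(0):
    gamma(-s) = R(gamma(s)). *)
Definition sym_domain (r : nat) (g1 g2 d1 d2 e1 e2 : R -> R) : Prop :=
  Ck (S r) g1 /\ Ck (S r) g2 /\
  (forall s, derivable_pt_lim g1 s (d1 s)) /\
  (forall s, derivable_pt_lim g2 s (d2 s)) /\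
  (forall s, derivable_pt_lim d1 s (e1 s)) /\
  (forall s, derivable_pt_lim d2 s (e2 s)) /\
  period1 g1 /\ period1 g2 /\
  (forall s, d1 s ^ 2 + d2 s ^ 2 = 1) /\
  (forall s t, 0 <= s < 1 -> 0 <= t < 1 -> g1 s = g1 t -> g2 s = g2 t -> s = t) /\
  (forall s, 0 < d1 s * e2 s - d2 s * e1 s) /\
  (exists a1 a2 u1 u2, u1 ^ 2 + u2 ^ 2 = 1 /\
     forall s, (g1 (- s), g2 (- s)) = reflect a1 a2 u1 u2 (g1 s, g2 s)).

Definition rho (d1 d2 e1 e2 : R -> R) (s : R) : R :=
  / (d1 s * e2 s - d2 s * e1 s).

Definition lazutkin (d1 d2 e1 e2 : R -> R) (C : R) (x : R -> R) : Prop :=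
  let f := fun s => Rpower (rho d1 d2 e1 e2 s) (-(2/3)) in
  (exists I, is_RInt f 0 1 I /\ C = / I) /\
  (forall s, 0 <= s <= 1 -> exists J, is_RInt f 0 s J /\ x s = C * J).

Definition dist2 (p1 p2 q1 q2 : R) : R := sqrt ((q1 - p1) ^ 2 + (q2 - p2) ^ 2).

(** Axially symmetric inscribed q-gon through the marked point, vertices
    gamma(s_0), ..., gamma(s_{q-1}) in counterclockwise order winding once
    (0 = s_0 < s_1 < ... < s_{q-1} < 1); symmetric under s -> -s (mod 1);
    for even q it contains the other axis point gamma(1/2). *)
Definition sym_polygon (q : nat) (s : nat -> R) : Prop :=
  s 0%nat = 0 /\
  (forall k, (S k < q)%nat -> s k < s (S k)) /\
  s (pred q) < 1 /\
  (forall k, (1 <= k < q)%nat -> s (q - k)%nat = 1 - s k) /\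
  (Nat.Even q -> s (Nat.div2 q) = 1/2).

Definition perimeter (g1 g2 : R -> R) (q : nat) (s : nat -> R) : R :=
  sumR q (fun k => dist2 (g1 (s k)) (g2 (s k))
                         (g1 (s ((S k) mod q)%nat)) (g2 (s ((S k) mod q)%nat))).

Definition max_sym_orbit (g1 g2 : R -> R) (q : nat) (s : nat -> R) : Prop :=
  sym_polygon q s /\
  forall t, sym_polygon q t -> perimeter g1 g2 q t <= perimeter g1 g2 q s.

Definition sin_refl (g1 g2 d1 d2 : R -> R) (q : nat) (s : nat -> R) (k : nat) : R :=
  let a := s k in let b := s ((S k) mod q)%nat in
  let w1 := g1 b - g1 a in let w2 := g2 b - g2 a in
  sin (acos ((d1 a * w1 + d2 a * w2) / sqrt (w1 ^ 2 + w2 ^ 2))).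

(** tilde ell_q(u) = ell_q(mu^{-1} u), with mu = 1/(2 C rho^{1/3}), so
    mu^{-1}(x_q^k) = 2 C rho(s_q^k)^{1/3}. *)
Definition ell_tilde (g1 g2 d1 d2 e1 e2 : R -> R) (C : R) (x : R -> R)
    (q : nat) (s : nat -> R) (u : R -> R) : R :=
  sumR q (fun k =>
    2 * C * Rpower (rho d1 d2 e1 e2 (s k)) (1/3) * u (x (s k))
      * sin_refl g1 g2 d1 d2 q s k).

Definition Cr_sym (r q0 : nat) (u : R -> R) : Prop :=
  Ck r u /\ period1 u /\ (forall y, u (- y) = u y) /\
  (forall k, (k < q0)%nat ->
     is_RInt (fun y => u y * cos (2 * PI * INR k * y)) 0 1 0).

(* Main.v *)
(** A maximal symmetric polygon with many sides has small gaps, because a gap bounded below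
    costs a fixed amount of perimeter while the polygon with equal gaps loses only O(q^-2).
    It obeys the reflection law, and in the Lazutkin coordinate this law makes consecutive
    gaps equal up to a term a(x) q^-4 + O(q^-5); summing twice gives
    x_q^k = k/q + alpha(k/q)/q^2 + O(q^-3), and similarly
    sin(phi_q^k)/mu = (1 + b(k/q)/q^2)/q + O(q^-4), with alpha and b Lipschitz.

    Hence, for u = sum_j a_j cos(2 pi j x), row q of the operator is
    sum_(q | j) a_j + q^-2 sum_j sigma_j a_j + (remainder), where sigma does not depend on q.
    If all rows vanish, letting q tend to infinity kills sum_j sigma_j a_j.  For the norm
    sup_j j^(7/3) |a_j| the remainder is then small when q >= q_0 is large, and the proper
    multiples of q contribute at most (zeta(2) - 1) times the norm to row q, so the norm
    is bounded by a proper fraction of itself. *)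

From Coquelicot Require Import Coquelicot.
Require Import Defs.
From Stdlib Require Import Reals Lra Lia List Arith.
Open Scope R_scope.

(** The term [q^-2] times a fixed functional is larger than the weight [q^(-7/3)], so the
    contraction cannot absorb it: it has to vanish exactly. This is forced by rows [q'] far beyond
    the row under study, where [q'^2 |a_q'|] is only [O(q'^(-1/3))]. Two effects threaten the
    remainder. A frequency [j] may be far larger than [q^2], where a Taylor expansion in the
    displacement [alpha / q^2] of the points says nothing; the quadratic and the linear bound of its
    error are therefore interpolated to [(j/q^2)^(5/4)]. And a frequency beyond [q/2] is aliased on
    the grid [k/q]: a discrete sine coefficient of [alpha] then stands in the place of the integral
    one. Bounding it by a constant would give a total of order [q^(-7/3)], no better than the
    weight; only its decay within a period modulo [q] wins a power. On the geometric side the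
    constants must not depend on the orbit, so the expansions are inequalities over all triples of
    [q], a maximal polygon and a vertex. *)

Ltac inv_pos := apply Rinv_0_lt_compat; try apply pow_lt; lra.
Ltac inv_nonneg := left; inv_pos.
Ltac derive_const := apply is_derive_Reals, derivable_pt_lim_const.

(** * Finite sums *)

Lemma sumR_S (n : nat) (f : nat -> R) : sumR (S n) f = sumR n f + f n.
Proof.
unfold sumR; rewrite seq_S, map_app, fold_right_app; simpl.
generalize (map f (seq 0 n)); intro l.
replace (f n + 0) with (0 + f n) by ring; generalize 0.
induction l as [|x l IH]; intro a; simpl; [ring|rewrite IH; ring].
Qed.

Lemma sumR_ext (n : nat) (f g : nat -> R) :
  (forall i, (i < n)%nat -> f i = g i) -> sumR n f = sumR n g.
Proof.
induction n as [|n IH]; intro H; [reflexivity|].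
rewrite !sumR_S, IH, H; auto.
Qed.

Lemma sumR_plus (n : nat) (f g : nat -> R) :
  sumR n (fun i => f i + g i) = sumR n f + sumR n g.
Proof.
induction n as [|n IH]; [unfold sumR; simpl; ring|].
rewrite !sumR_S, IH; ring.
Qed.

Lemma sumR_minus (n : nat) (f g : nat -> R) :
  sumR n (fun i => f i - g i) = sumR n f - sumR n g.
Proof.
induction n as [|n IH]; [unfold sumR; simpl; ring|].
rewrite !sumR_S, IH; ring.
Qed.

Lemma sumR_scal (n : nat) (c : R) (f : nat -> R) :
  sumR n (fun i => c * f i) = c * sumR n f.
Proof.
induction n as [|n IH]; [unfold sumR; simpl; ring|].
rewrite !sumR_S, IH; ring.
Qed.

Lemma sumR_const (n : nat) (c : R) : sumR n (fun _ => c) = INR n * c.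
Proof.
induction n as [|n IH]; [unfold sumR; simpl; ring|].
rewrite sumR_S, IH, S_INR; ring.
Qed.

Lemma sumR_le (n : nat) (f g : nat -> R) :
  (forall i, (i < n)%nat -> f i <= g i) -> sumR n f <= sumR n g.
Proof.
induction n as [|n IH]; intro H; [unfold sumR; simpl; lra|].
rewrite !sumR_S; apply Rplus_le_compat; auto.
Qed.

Lemma sumR_nonneg (n : nat) (f : nat -> R) :
  (forall i, (i < n)%nat -> 0 <= f i) -> 0 <= sumR n f.
Proof.
intro H; apply Rle_trans with (sumR n (fun _ => 0)).
- rewrite sumR_const; lra.
- now apply sumR_le.
Qed.

Lemma sumR_abs_le (n : nat) (f g : nat -> R) :
  (forall i, (i < n)%nat -> Rabs (f i) <= g i) -> Rabs (sumR n f) <= sumR n g.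
Proof.
induction n as [|n IH]; intro H.
- unfold sumR; simpl; rewrite Rabs_R0; lra.
- rewrite !sumR_S; eapply Rle_trans; [apply Rabs_triang|].
  apply Rplus_le_compat; auto.
Qed.

Lemma sumR_abs_le_const (n : nat) (f : nat -> R) (c : R) :
  (forall i, (i < n)%nat -> Rabs (f i) <= c) -> Rabs (sumR n f) <= INR n * c.
Proof. intro H; rewrite <- sumR_const; now apply sumR_abs_le. Qed.

Lemma sumR_add (n m : nat) (f : nat -> R) :
  sumR (n + m) f = sumR n f + sumR m (fun i => f (n + i)%nat).
Proof.
induction m as [|m IH].
- rewrite Nat.add_0_r; change (sumR 0 (fun i => f (n + i)%nat)) with 0; ring.
- rewrite Nat.add_succ_r, !sumR_S, IH; ring.
Qed.

Lemma sumR_head (n : nat) (f : nat -> R) :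
  sumR (S n) f = f 0%nat + sumR n (fun i => f (S i)).
Proof.
change (S n) with (1 + n)%nat; rewrite sumR_add, sumR_S.
change (sumR 0 f) with 0; simpl; ring.
Qed.

Lemma sumR_telescope (n : nat) (f : nat -> R) :
  sumR n (fun i => f (S i) - f i) = f n - f 0%nat.
Proof.
induction n as [|n IH]; [unfold sumR; simpl; ring|].
rewrite sumR_S, IH; ring.
Qed.

Lemma sumR_swap (n m : nat) (f : nat -> nat -> R) :
  sumR n (fun i => sumR m (f i)) = sumR m (fun j => sumR n (fun i => f i j)).
Proof.
induction n as [|n IH].
- symmetry; change (sumR m (fun _ => 0) = 0); rewrite sumR_const; ring.
- rewrite sumR_S, IH, <- sumR_plus.
  apply sumR_ext; intros j _; now rewrite sumR_S.
Qed.

(** Writing an index as [k * m + i] sorts frequencies by their residue modulo [m]; aliasing and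
    divisibility by [q] both depend on the residue alone. *)
Lemma sumR_mul (n m : nat) (f : nat -> R) :
  sumR (n * m) f = sumR n (fun k => sumR m (fun i => f (k * m + i)%nat)).
Proof.
induction n as [|n IH]; [reflexivity|].
rewrite sumR_S, <- IH, <- sumR_add; f_equal; lia.
Qed.

Lemma sumR_single (n k : nat) (c : R) :
  (k < n)%nat -> sumR n (fun i => if Nat.eq_dec i k then c else 0) = c.
Proof.
induction n as [|n IH]; intro H; [lia|].
rewrite sumR_S; destruct (Nat.eq_dec n k) as [->|Hn].
- rewrite (sumR_ext _ _ (fun _ => 0)), sumR_const; [ring|].
  intros i Hi; destruct (Nat.eq_dec i k); [lia|reflexivity].
- rewrite IH; [ring|lia].
Qed.

Lemma sumR_rev (n : nat) (f : nat -> R) :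
  sumR n (fun i => f (n - 1 - i)%nat) = sumR n f.
Proof.
induction n as [|n IH]; [reflexivity|].
rewrite sumR_head, sumR_S, <- IH.
replace (S n - 1 - 0)%nat with n by lia.
rewrite Rplus_comm; f_equal; apply sumR_ext; intros i Hi; f_equal; lia.
Qed.

(** * Integrals of continuous functions *)

(* [RInt] at result type [R], so that [ring] and [field] recognise the carrier. *)
Definition integ (f : R -> R) (a b : R) : R := RInt f a b.

Lemma integ_ext (f g : R -> R) (a b : R) :
  (forall x, Rmin a b < x < Rmax a b -> f x = g x) -> integ f a b = integ g a b.
Proof. apply (RInt_ext f g). Qed.

Lemma cont_ex_RInt (f : R -> R) (a b : R) : continuity f -> ex_RInt f a b.
Proof.
intro H; apply (ex_RInt_continuous (V := R_CompleteNormedModule)); intros z _.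
apply continuity_pt_filterlim, H.
Qed.

Lemma derive_continuity (f f' : R -> R) :
  (forall x, is_derive f x (f' x)) -> continuity f.
Proof.
intros H x; apply derivable_continuous_pt; exists (f' x).
now apply is_derive_Reals.
Qed.

Lemma integ_add (f g : R -> R) (a b : R) : continuity f -> continuity g ->
  integ (fun t => f t + g t) a b = integ f a b + integ g a b.
Proof. intros Hf Hg; apply (RInt_plus f g); now apply cont_ex_RInt. Qed.

Lemma integ_sub (f g : R -> R) (a b : R) : continuity f -> continuity g ->
  integ (fun t => f t - g t) a b = integ f a b - integ g a b.
Proof. intros Hf Hg; apply (RInt_minus f g); now apply cont_ex_RInt. Qed.

Lemma integ_mul (c : R) (f : R -> R) (a b : R) : continuity f ->
  integ (fun t => c * f t) a b = c * integ f a b.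
Proof. intro Hf; apply (RInt_scal f); now apply cont_ex_RInt. Qed.

Lemma integ_split (f : R -> R) (a b c : R) : continuity f ->
  integ f a c = integ f a b + integ f b c.
Proof. intro Hf; symmetry; apply (RInt_Chasles f); now apply cont_ex_RInt. Qed.

Lemma integ_cst (a b c : R) : integ (fun _ => c) a b = (b - a) * c.
Proof. apply (RInt_const a b c). Qed.

Lemma integ_nil (f : R -> R) (a : R) : integ f a a = 0.
Proof. apply (RInt_point a f). Qed.

Lemma integ_comp_lin (f : R -> R) (u v a b : R) : continuity f ->
  u * integ (fun y => f (u * y + v)) a b = integ f (u * a + v) (u * b + v).
Proof.
intro Hf; unfold integ.
rewrite <- (RInt_comp_lin f u v a b) by now apply cont_ex_RInt.
symmetry; apply (RInt_scal (fun y => f (u * y + v))), cont_ex_RInt.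
intro x; apply (continuity_pt_comp (fun y => u * y + v) f); [|apply Hf].
apply (derive_continuity _ (fun _ => u)); intro; auto_derive; auto; ring.
Qed.

Lemma integ_shift (f : R -> R) (v a b : R) : continuity f ->
  integ (fun y => f (y + v)) a b = integ f (a + v) (b + v).
Proof.
intro Hf; pose proof (integ_comp_lin f 1 v a b Hf) as H.
rewrite !Rmult_1_l in H; rewrite <- H.
apply integ_ext; intros; now rewrite Rmult_1_l.
Qed.

Lemma integ_swap (f : R -> R) (a b : R) : continuity f ->
  integ f a b = - integ f b a.
Proof.
intro Hf; pose proof (integ_split f a b a Hf); rewrite integ_nil in H; lra.
Qed.

Lemma integ_reflect (f : R -> R) (v a b : R) : continuity f ->
  integ (fun y => f (v - y)) a b = integ f (v - b) (v - a).
Proof.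
intro Hf; pose proof (integ_comp_lin f (-1) v a b Hf) as H.
rewrite (integ_swap f (v - b)) by auto.
replace (v - a) with (-1 * a + v) by ring; replace (v - b) with (-1 * b + v) by ring.
rewrite <- H, (integ_ext _ (fun y => f (-1 * y + v))); [ring|].
intros x _; f_equal; ring.
Qed.

Lemma integ_FTC (f f' : R -> R) (a b : R) :
  (forall x, is_derive f x (f' x)) -> continuity f' ->
  integ f' a b = f b - f a.
Proof.
intros H H'; apply is_RInt_unique, (is_RInt_derive f f'); intros x _; auto.
apply continuity_pt_filterlim, H'.
Qed.

Lemma is_derive_integ (f : R -> R) (a x : R) : continuity f ->
  is_derive (fun y => integ f a y) x (f x).
Proof.
intro Hf; apply is_derive_RInt with a.
- exists (mkposreal 1 Rlt_0_1); intros y _.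
  apply (RInt_correct (V := R_CompleteNormedModule)); now apply cont_ex_RInt.
- apply continuity_pt_filterlim, Hf.
Qed.

Lemma integ_abs_le_const (f : R -> R) (a b M : R) : a <= b -> continuity f ->
  (forall t, a <= t <= b -> Rabs (f t) <= M) -> Rabs (integ f a b) <= (b - a) * M.
Proof. intros; apply abs_RInt_le_const; auto; now apply cont_ex_RInt. Qed.

Lemma is_RInt_integ (f : R -> R) (a b v : R) : Defs.is_RInt f a b v -> integ f a b = v.
Proof. intros [pr <-]; apply RInt_Reals. Qed.

Lemma continuity_bounded (f : R -> R) (a b : R) : continuity f ->
  exists M, 0 <= M /\ forall t, a <= t <= b -> Rabs (f t) <= M.
Proof.
intro Hf.
destruct (bounded_continuity f a b) as [M HM].
- intros x _; apply continuity_pt_filterlim, Hf.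
- exists (Rabs M); split; [apply Rabs_pos|intros t Ht].
  left; eapply Rlt_le_trans; [apply (HM t Ht)|apply Rle_abs].
Qed.

Lemma MVT_bound (f f' : R -> R) (a b M : R) :
  (forall x, Rmin a b <= x <= Rmax a b -> is_derive f x (f' x)) ->
  (forall x, Rmin a b <= x <= Rmax a b -> Rabs (f' x) <= M) ->
  Rabs (f b - f a) <= M * Rabs (b - a).
Proof.
intros Hd HM.
destruct (MVT_gen f a b f') as [c [Hc E]].
- intros x Hx; apply Hd; lra.
- intros x Hx; apply derivable_continuous_pt; exists (f' x).
  now apply is_derive_Reals, Hd.
- rewrite E, Rabs_mult; apply Rmult_le_compat_r; [apply Rabs_pos|auto].
Qed.

(** * Cosine series *)

(** No factor 2 is included, so this is exactly the integral that [Cr_sym] sets to zero; the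
    amplitude of [cos (2 PI j t)] in the series for [j >= 1] is [2 * cosc f j]. *)
Definition cosc (f : R -> R) (j : nat) : R :=
  integ (fun t => f t * cos (2 * PI * INR j * t)) 0 1.

Lemma cos_2PI_INR (n : nat) (x : R) : cos (x + 2 * PI * INR n) = cos x.
Proof. rewrite <- (cos_period x n); f_equal; ring. Qed.

Lemma sin_2PI_INR (n : nat) (x : R) : sin (x + 2 * PI * INR n) = sin x.
Proof. rewrite <- (sin_period x n); f_equal; ring. Qed.

Lemma continuity_cos_lin (w : R) : continuity (fun t => cos (w * t)).
Proof. apply (derive_continuity _ (fun t => - sin (w * t) * w)); intro x; auto_derive; auto; ring. Qed.

Lemma continuity_times (f g : R -> R) :
  continuity f -> continuity g -> continuity (fun t => f t * g t).
Proof. intros; now apply (continuity_mult f g). Qed.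

Lemma is_derive_eq (f : R -> R) (x l l' : R) : is_derive f x l -> l = l' -> is_derive f x l'.
Proof. now intros H <-. Qed.

Lemma is_derive_mul (f g : R -> R) (x lf lg : R) :
  is_derive f x lf -> is_derive g x lg ->
  is_derive (fun t => f t * g t) x (lf * g x + f x * lg).
Proof.
intros Hf Hg; apply is_derive_Reals.
apply (derivable_pt_lim_mult f g); now apply is_derive_Reals.
Qed.

Lemma is_derive_add (f g : R -> R) (x lf lg : R) :
  is_derive f x lf -> is_derive g x lg ->
  is_derive (fun t => f t + g t) x (lf + lg).
Proof. intros; now apply (is_derive_plus f g). Qed.

Lemma is_derive_sub (f g : R -> R) (x lf lg : R) :
  is_derive f x lf -> is_derive g x lg ->
  is_derive (fun t => f t - g t) x (lf - lg).
Proof. intros; now apply (is_derive_minus f g). Qed.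

(** Both integrations by parts are done at once: the derivative of [f sin(wt)/w + f' cos(wt)/w^2] is
    [f cos(wt) + f'' cos(wt)/w^2]. The sine vanishes at both ends, and the periodicity of [f']
    cancels the cosine terms. *)
Lemma cosc_parts (f f' f'' : R -> R) (j : nat) :
  (forall x, is_derive f x (f' x)) -> (forall x, is_derive f' x (f'' x)) ->
  continuity f'' -> period1 f' -> (1 <= j)%nat ->
  cosc f j = - cosc f'' j / (2 * PI * INR j) ^ 2.
Proof.
intros Hf Hf' Hc Hp Hj; unfold cosc.
set (w := 2 * PI * INR j).
assert (Hw : 0 < w).
{ apply Rmult_lt_0_compat; [pose proof PI_RGT_0; lra|apply lt_0_INR; lia]. }
assert (Hcf := derive_continuity f f' Hf).
assert (Hcf' := derive_continuity f' f'' Hf').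
assert (E : integ (fun t => f t * cos (w * t) + / w ^ 2 * (f'' t * cos (w * t))) 0 1 = 0).
{ rewrite (integ_FTC (fun t => f t * (sin (w * t) / w) + f' t * (cos (w * t) / w ^ 2))).
  - replace (w * 1) with (0 + 2 * PI * INR j) by (unfold w; ring).
    rewrite sin_2PI_INR, cos_2PI_INR, Rmult_0_r, sin_0, cos_0.
    replace (f' 1) with (f' 0) by (rewrite <- (Hp 0); f_equal; ring).
    field; lra.
  - intro x.
    assert (A : is_derive (fun t => sin (w * t) / w) x (cos (w * x))).
    { auto_derive; auto; field; lra. }
    assert (B : is_derive (fun t => cos (w * t) / w ^ 2) x (- sin (w * x) / w)).
    { auto_derive; auto; simpl; field; lra. }
    eapply is_derive_eq.
    + exact (is_derive_add _ _ _ _ _ (is_derive_mul _ _ _ _ _ (Hf x) A)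
        (is_derive_mul _ _ _ _ _ (Hf' x) B)).
    + cbv beta; field; lra.
  - apply continuity_plus.
    + apply continuity_times; [exact Hcf|apply continuity_cos_lin].
    + apply (continuity_scal (fun t => f'' t * cos (w * t))).
      apply continuity_times; [exact Hc|apply continuity_cos_lin]. }
rewrite integ_add in E.
2: apply continuity_times; [exact Hcf|apply continuity_cos_lin].
2: apply (continuity_scal (fun t => f'' t * cos (w * t)));
   apply continuity_times; [exact Hc|apply continuity_cos_lin].
rewrite integ_mul in E by (apply continuity_times; [exact Hc|apply continuity_cos_lin]).
set (r := integ (fun t => f t * cos (w * t)) 0 1) in *.
set (r' := integ (fun t => f'' t * cos (w * t)) 0 1) in *.
replace r with (- (/ w ^ 2 * r')) by lra; field; lra.
Qed.

Lemma period1_derive (f f' : R -> R) :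
  (forall x, is_derive f x (f' x)) -> period1 f -> period1 f'.
Proof.
intros H Hp x.
assert (A : is_derive (fun t => f (t + 1)) x (f' (x + 1))).
{ eapply is_derive_eq; [apply (is_derive_comp f (fun t => t + 1))|].
  - apply H.
  - auto_derive; auto.
  - unfold scal; simpl; unfold mult; simpl; ring. }
rewrite <- (is_derive_unique _ _ _ A), <- (is_derive_unique _ _ _ (H x)).
apply Derive_ext; intro t; apply Hp.
Qed.

Lemma even_derive_0 (f f' : R -> R) :
  (forall x, is_derive f x (f' x)) -> (forall x, f (- x) = f x) -> f' 0 = 0.
Proof.
intros H He.
assert (A : is_derive (fun t => f (- t)) 0 (- f' 0)).
{ eapply is_derive_eq; [apply (is_derive_comp f (fun t => - t))|].
  - apply H.
  - auto_derive; auto.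
  - unfold scal; simpl; unfold mult; simpl; rewrite Ropp_0; ring. }
assert (B : f' 0 = - f' 0); [|lra].
rewrite <- (is_derive_unique _ _ _ A) at 1.
rewrite <- (is_derive_unique _ _ _ (H 0)) at 1.
apply Derive_ext; intro t; now rewrite He.
Qed.

Definition dirichlet (N : nat) (t : R) : R :=
  1 + 2 * sumR N (fun i => cos (2 * PI * INR (S i) * t)).

(** Telescopes through [2 cos A sin B = sin(A+B) - sin(A-B)]. The product form stays valid at the
    zeros of [sin (PI t)]. *)
Lemma dirichlet_sin (N : nat) (t : R) :
  dirichlet N t * sin (PI * t) = sin ((2 * INR N + 1) * PI * t).
Proof.
unfold dirichlet; induction N as [|N IH].
- change (sumR 0 ?f) with 0; replace (1 + 2 * 0) with 1 by ring.
  rewrite Rmult_1_l; f_equal; simpl; ring.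
- rewrite sumR_S, Rmult_plus_distr_l, <- Rplus_assoc, Rmult_plus_distr_r, IH, S_INR.
  set (A := 2 * PI * (INR N + 1) * t); set (B := PI * t).
  replace ((2 * INR N + 1) * PI * t) with (A - B) by (unfold A, B; ring).
  replace ((2 * (INR N + 1) + 1) * PI * t) with (A + B) by (unfold A, B; ring).
  rewrite sin_plus, sin_minus; ring.
Qed.

Lemma continuity_sumR (n : nat) (f : nat -> R -> R) :
  (forall i, continuity (f i)) -> continuity (fun t => sumR n (fun i => f i t)).
Proof.
intro H; induction n as [|n IH].
- apply continuity_const; now intros ? ?.
- intro x; apply continuity_pt_ext with (fun t => sumR n (fun i => f i t) + f n t).
  + intro t; now rewrite sumR_S.
  + apply (continuity_pt_plus (fun t => sumR n (fun i => f i t)) (f n)); [apply IH|apply H].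
Qed.

Lemma dirichlet_continuity (N : nat) : continuity (dirichlet N).
Proof.
apply (continuity_plus (fun _ => 1)).
- apply continuity_const; now intros ? ?.
- apply (continuity_scal (fun t => sumR N (fun i => cos (2 * PI * INR (S i) * t)))).
  apply (continuity_sumR N (fun i t => cos (2 * PI * INR (S i) * t))).
  intro i; apply continuity_cos_lin.
Qed.

Lemma integ_dirichlet (f : R -> R) (N : nat) : continuity f ->
  integ (fun t => f t * dirichlet N t) 0 1
  = cosc f 0 + 2 * sumR N (fun i => cosc f (S i)).
Proof.
intro Hf; induction N as [|N IH].
- change (sumR 0 (fun i => cosc f (S i))) with 0.
  replace (cosc f 0 + 2 * 0) with (cosc f 0) by ring.
  apply integ_ext; intros t _; unfold dirichlet.
  change (sumR 0 ?g) with 0; simpl INR.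
  replace (2 * PI * 0 * t) with 0 by ring; rewrite cos_0; ring.
- rewrite sumR_S, Rmult_plus_distr_l, <- Rplus_assoc, <- IH; unfold cosc.
  rewrite <- integ_mul by (apply continuity_times; [exact Hf|apply continuity_cos_lin]).
  rewrite <- integ_add.
  + apply integ_ext; intros t _; unfold dirichlet; rewrite sumR_S.
    ring.
  + apply continuity_times; [exact Hf|apply dirichlet_continuity].
  + apply (continuity_scal (fun t => f t * cos (2 * PI * INR (S N) * t))).
    apply continuity_times; [exact Hf|apply continuity_cos_lin].
Qed.

Lemma cosc_1 (j : nat) : (1 <= j)%nat -> cosc (fun _ => 1) j = 0.
Proof.
intro Hj; rewrite (cosc_parts _ (fun _ => 0) (fun _ => 0)).
- unfold cosc; rewrite (integ_ext _ (fun _ => 0)).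
  + rewrite integ_cst; unfold Rdiv; ring.
  + intros; apply Rmult_0_l.
- intro x; auto_derive; auto.
- intro x; auto_derive; auto.
- apply continuity_const; now intros ? ?.
- now intro.
- exact Hj.
Qed.

Lemma integ_dirichlet_1 (N : nat) : integ (dirichlet N) 0 1 = 1.
Proof.
rewrite (integ_ext _ (fun t => 1 * dirichlet N t)) by (intros; now rewrite Rmult_1_l).
rewrite (integ_dirichlet (fun _ => 1)) by (apply continuity_const; now intros ? ?).
rewrite (sumR_ext _ _ (fun _ => 0)), sumR_const.
- unfold cosc; rewrite (integ_ext _ (fun _ => 1)), integ_cst; [ring|].
  intros t _; simpl INR; replace (2 * PI * 0 * t) with 0 by ring; rewrite cos_0; ring.
- intros i _; apply cosc_1; lia.
Qed.

(** Up to [PI/3] the cosine is at least [1/2], so [sin t - t/3] increases; from there on [sin] stays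
    above [sqrt 3 / 2], while [x/3] is at most [PI/6]. *)
Lemma sin_lower (x : R) : 0 <= x <= PI / 2 -> x / 3 <= sin x.
Proof.
intros Hx; pose proof PI_4; pose proof PI2_3_2.
destruct (Rle_dec x (PI / 3)) as [H1|H1].
- set (f := fun t => sin t - t / 3).
  destruct (MVT_gen f 0 x (fun t => cos t - 1 / 3)) as [c [Hc E]].
  + intros t _; unfold f; auto_derive; auto; field.
  + intros t _; apply derivable_continuous_pt; exists (cos t - 1 / 3).
    apply is_derive_Reals; unfold f; auto_derive; auto; field.
  + rewrite Rmin_left, Rmax_right in Hc by lra.
    assert (1 / 2 <= cos c).
    { rewrite <- cos_PI3; apply cos_decr_1; lra. }
    assert (P0 : 0 <= f x - f 0).
    { rewrite E; apply Rmult_le_pos; lra. }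
    revert P0; unfold f; rewrite sin_0; lra.
- apply Rle_trans with (sin (PI / 3)).
  + rewrite sin_PI3.
    assert (1.7 <= sqrt 3); [|lra].
    rewrite <- (sqrt_Rsqr 1.7) by lra; apply sqrt_le_1; unfold Rsqr; lra.
  + apply sin_incr_1; lra.
Qed.

Lemma sin_PI_lower (t : R) : 0 <= t <= 1 / 2 -> t <= sin (PI * t).
Proof.
intro H; pose proof PI2_3_2; apply Rle_trans with (PI * t / 3); [nra|].
apply sin_lower; split; [apply Rmult_le_pos; lra|nra].
Qed.

Lemma cos_PI_sub (n : nat) (t : R) :
  cos (2 * PI * INR n * (1 - t)) = cos (2 * PI * INR n * t).
Proof.
rewrite <- (cos_neg (2 * PI * INR n * t)), <- (cos_2PI_INR n (- _)).
f_equal; ring.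
Qed.

Lemma dirichlet_sub (N : nat) (t : R) : dirichlet N (1 - t) = dirichlet N t.
Proof.
unfold dirichlet; do 2 f_equal; apply sumR_ext; intros i _; apply cos_PI_sub.
Qed.

(* On [0,1/2], [f - f 0] times the Dirichlet kernel is [k(t) sin((2N+1) pi t)] with
   [k = (f - f 0) / sin(pi t)]; as [f' 0 = 0], both [k] and [k'] are bounded and one
   integration by parts away from [0] gives the decay. *)
Lemma dirichlet_half_bound (f f' f'' : R -> R) :
  (forall x, is_derive f x (f' x)) -> (forall x, is_derive f' x (f'' x)) ->
  continuity f'' -> f' 0 = 0 ->
  exists K, forall N, (1 <= N)%nat ->
    Rabs (integ (fun t => (f t - f 0) * dirichlet N t) 0 (1 / 2)) <= K / INR N.
Proof.
intros Hf Hf' Hc H0.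
destruct (continuity_bounded f'' 0 (1 / 2) Hc) as [B [B0 HB]].
assert (Cf := derive_continuity f f' Hf).
assert (Bf' : forall t, 0 <= t <= 1 / 2 -> Rabs (f' t) <= B * t).
{ intros t Ht; pose proof (MVT_bound f' f'' 0 t B) as M.
  rewrite H0, !Rminus_0_r, (Rabs_pos_eq t) in M by lra.
  rewrite Rmin_left, Rmax_right in M by lra.
  apply M; intros; [apply Hf'|apply HB; lra]. }
assert (Bf : forall t, 0 <= t <= 1 / 2 -> Rabs (f t - f 0) <= B * t * t).
{ intros t Ht; pose proof (MVT_bound f f' 0 t (B * t)) as M.
  rewrite !Rminus_0_r, (Rabs_pos_eq t) in M by lra.
  rewrite Rmin_left, Rmax_right in M by lra.
  apply M; intros; [apply Hf|].
  eapply Rle_trans; [apply Bf'; lra|apply Rmult_le_compat_l; lra]. }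
exists (10 * B); intros N HN.
assert (HN1 : 1 <= INR N) by (apply (le_INR 1); auto).
set (la := (2 * INR N + 1) * PI).
pose proof PI2_3_2 as HPI; pose proof PI_4 as HPI4.
assert (Hla : INR N <= la) by (unfold la; nra).
set (g := fun t => (f t - f 0) * dirichlet N t).
assert (Cg : continuity g).
{ apply continuity_times; [|apply dirichlet_continuity].
  apply (continuity_minus f (fun _ => f 0)); [exact Cf|].
  apply continuity_const; now intros ? ?. }
(* On [[0, eta]] the bound [B] of the integrand and the shortness of the interval give [B / N]; the
   integration by parts is reserved for [[eta, 1/2]], where [sin (PI t)] cannot vanish. *)
set (eta := / (2 * INR N)).
assert (Heta : 0 < eta <= 1 / 2).
{ unfold eta; split; [inv_pos|].
  replace (1 / 2) with (/ 2) by field; apply Rinv_le_contravar; lra. }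
assert (Bg : forall t, 0 <= t <= 1 / 2 -> Rabs (g t) <= B).
{ intros t Ht; destruct (Req_dec t 0) as [->|Ht0].
  - unfold g; rewrite Rminus_diag, Rmult_0_l, Rabs_R0; exact B0.
  - assert (St := sin_PI_lower t Ht).
    apply Rmult_le_reg_r with (sin (PI * t)); [lra|].
    rewrite <- (Rabs_pos_eq (sin (PI * t))) at 1 by lra.
    rewrite <- Rabs_mult; unfold g; rewrite Rmult_assoc, dirichlet_sin, Rabs_mult.
    apply Rle_trans with (B * t * t * 1).
    + apply Rmult_le_compat; try apply Rabs_pos; [now apply Bf|].
      apply Rabs_le; pose proof (SIN_bound ((2 * INR N + 1) * PI * t)); lra.
    + rewrite Rmult_1_r, Rmult_assoc; apply Rmult_le_compat_l; [exact B0|nra]. }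
rewrite (integ_split g 0 eta (1 / 2) Cg).
set (k := fun t => (f t - f 0) / sin (PI * t)).
set (k' := fun t => f' t / sin (PI * t)
                    - (f t - f 0) * (PI * cos (PI * t)) / (sin (PI * t) * sin (PI * t))).
(* Since the integrand is [k(t) sin(la t)], the derivative of [Phi] is [k' cos(la t) / la]: the
   integration by parts becomes a mean value estimate, with no integral of [k']. *)
set (Phi := fun t => integ g eta t + k t * (cos (la * t) / la)).
assert (Bk : forall t, eta <= t <= 1 / 2 -> Rabs (k t) <= B).
{ intros t Ht; assert (St := sin_PI_lower t ltac:(lra)).
  unfold k, Rdiv; rewrite Rabs_mult, Rabs_inv, (Rabs_pos_eq (sin _)) by lra.
  apply Rmult_le_reg_r with (sin (PI * t)); [lra|].
  rewrite Rmult_assoc, Rinv_l, Rmult_1_r by lra.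
  eapply Rle_trans; [apply Bf; lra|].
  rewrite Rmult_assoc; apply Rmult_le_compat_l; [exact B0|nra]. }
assert (Bk' : forall t, eta <= t <= 1 / 2 -> Rabs (k' t) <= 5 * B).
{ intros t Ht; assert (St := sin_PI_lower t ltac:(lra)).
  set (s := sin (PI * t)) in *.
  replace (5 * B) with (B + 4 * B) by ring.
  unfold k'; eapply Rle_trans; [apply Rabs_triang|rewrite Rabs_Ropp].
  apply Rplus_le_compat.
  - unfold Rdiv; rewrite Rabs_mult, Rabs_inv; fold s; rewrite (Rabs_pos_eq s) by lra.
    apply Rmult_le_reg_r with s; [lra|].
    rewrite Rmult_assoc, Rinv_l, Rmult_1_r by lra.
    eapply Rle_trans; [apply Bf'; lra|apply Rmult_le_compat_l; lra].
  - fold s; unfold Rdiv; rewrite Rabs_mult, Rabs_inv, (Rabs_pos_eq (s * s)) by nra.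
    apply Rmult_le_reg_r with (s * s); [nra|].
    rewrite Rmult_assoc, Rinv_l, Rmult_1_r by nra.
    rewrite !Rabs_mult, (Rabs_pos_eq PI) by lra.
    replace (4 * B * (s * s)) with ((B * (s * s)) * (4 * 1)) by ring.
    apply Rmult_le_compat; try apply Rabs_pos.
    + apply Rmult_le_pos; [lra|apply Rabs_pos].
    + eapply Rle_trans; [apply Bf; lra|].
      rewrite Rmult_assoc; apply Rmult_le_compat_l; [exact B0|nra].
    + apply Rmult_le_compat; [lra|apply Rabs_pos|lra|].
      apply Rabs_le; pose proof (COS_bound (PI * t)); lra. }
assert (M : Rabs (Phi (1 / 2) - Phi eta) <= 5 * B / la * Rabs (1 / 2 - eta)).
{ apply (MVT_bound Phi (fun t => k' t * (cos (la * t) / la))).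
  - rewrite Rmin_left, Rmax_right by lra; intros t Ht.
    assert (St := sin_PI_lower t ltac:(lra)).
    assert (Dk : is_derive k t (k' t)).
    { eapply is_derive_eq; [apply (is_derive_mul (fun t => f t - f 0) (fun t => / sin (PI * t)))|].
      - apply is_derive_sub; [apply Hf|derive_const].
      - auto_derive; [lra|reflexivity].
      - unfold k'; field; lra. }
    assert (Dc : is_derive (fun t => cos (la * t) / la) t (- sin (la * t))).
    { auto_derive; auto; field; lra. }
    eapply is_derive_eq.
    + apply (is_derive_add (fun t => integ g eta t)); [apply is_derive_integ, Cg|].
      exact (is_derive_mul _ _ _ _ _ Dk Dc).
    + assert (Es := dirichlet_sin N t); fold la in Es.
      cbv beta; rewrite <- Es; unfold g, k; field; lra.
  - rewrite Rmin_left, Rmax_right by lra; intros t Ht.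
    unfold Rdiv; rewrite <- Rmult_assoc, Rabs_mult, Rabs_inv, (Rabs_pos_eq la) by lra.
    apply Rmult_le_compat_r; [inv_nonneg|].
    rewrite Rabs_mult, <- (Rmult_1_r (5 * B)).
    apply Rmult_le_compat; try apply Rabs_pos; [apply Bk'; lra|].
    apply Rabs_le; pose proof (COS_bound (la * t)); lra. }
assert (E : integ g eta (1 / 2) = (Phi (1 / 2) - Phi eta)
   + k eta * (cos (la * eta) / la) - k (1 / 2) * (cos (la * (1 / 2)) / la)).
{ unfold Phi; rewrite integ_nil; ring. }
assert (Bb : forall t, eta <= t <= 1 / 2 -> Rabs (k t * (cos (la * t) / la)) <= B / INR N).
{ intros t Ht; unfold Rdiv; rewrite <- Rmult_assoc, Rabs_mult, Rabs_inv, (Rabs_pos_eq la) by lra.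
  apply Rmult_le_compat; try apply Rabs_pos.
  - inv_nonneg.
  - rewrite Rabs_mult, <- (Rmult_1_r B).
    apply Rmult_le_compat; try apply Rabs_pos; [apply Bk; lra|].
    apply Rabs_le; pose proof (COS_bound (la * t)); lra.
  - apply Rinv_le_contravar; lra. }
assert (I0 : Rabs (integ g 0 eta) <= B / INR N).
{ eapply Rle_trans; [apply integ_abs_le_const with (M := B); [lra|exact Cg|]|].
  - intros t Ht; apply Bg; lra.
  - rewrite Rminus_0_r; unfold Rdiv; rewrite Rmult_comm.
    apply Rmult_le_compat_l; [exact B0|unfold eta; apply Rinv_le_contravar; lra]. }
assert (I1 : 5 * B / la * Rabs (1 / 2 - eta) <= 5 * (B / INR N)).
{ rewrite Rabs_pos_eq by lra.
  apply Rle_trans with (5 * B / la * 1).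
  - apply Rmult_le_compat_l; [|lra].
    apply Rmult_le_pos; [lra|inv_nonneg].
  - rewrite Rmult_1_r; unfold Rdiv; rewrite <- Rmult_assoc.
    apply Rmult_le_compat_l; [lra|apply Rinv_le_contravar; lra]. }
assert (I2 := Bb eta ltac:(lra)); assert (I3 := Bb (1 / 2) ltac:(lra)).
assert (P : 0 <= B / INR N) by (apply Rmult_le_pos; [lra|inv_nonneg]).
rewrite E.
replace (10 * B / INR N) with (10 * (B / INR N)) by (unfold Rdiv; ring).
apply Rabs_le; apply Rabs_le_between in I0, I2, I3, M; lra.
Qed.

(** The kernel has integral 1, so the error equals the integral of [(f t - f 0) * dirichlet N t];
    evenness and periodicity make the halves [[0,1/2]] and [[1/2,1]] contribute equally. *)
Lemma fourier_at_0 (f f' f'' : R -> R) :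
  (forall x, is_derive f x (f' x)) -> (forall x, is_derive f' x (f'' x)) ->
  continuity f'' -> period1 f -> (forall x, f (- x) = f x) ->
  exists K, forall N, (1 <= N)%nat ->
    Rabs (cosc f 0 + 2 * sumR N (fun i => cosc f (S i)) - f 0) <= K / INR N.
Proof.
intros Hf Hf' Hc Hp He.
destruct (dirichlet_half_bound f f' f'' Hf Hf' Hc (even_derive_0 f f' Hf He)) as [K HK].
exists (2 * K); intros N HN.
assert (Cf := derive_continuity f f' Hf).
set (g := fun t => (f t - f 0) * dirichlet N t).
assert (C1 : continuity (fun _ : R => f 0)) by (apply continuity_const; now intros ? ?).
assert (Cg : continuity g).
{ apply continuity_times; [|apply dirichlet_continuity].
  now apply (continuity_minus f (fun _ => f 0)). }
assert (E : integ g 0 1 = cosc f 0 + 2 * sumR N (fun i => cosc f (S i)) - f 0).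
{ rewrite (integ_ext g (fun t => f t * dirichlet N t - f 0 * dirichlet N t))
    by (intros t _; unfold g; ring).
  rewrite integ_sub, integ_dirichlet, integ_mul, integ_dirichlet_1; auto.
  - ring.
  - apply dirichlet_continuity.
  - apply continuity_times; [exact Cf|apply dirichlet_continuity].
  - apply continuity_times; [exact C1|apply dirichlet_continuity]. }
rewrite <- E, (integ_split g 0 (1 / 2) 1 Cg).
assert (E2 : integ g (1 / 2) 1 = integ g 0 (1 / 2)).
{ rewrite (integ_ext g (fun t => g (1 - t))).
  - rewrite integ_reflect by exact Cg; f_equal; field.
  - intros t _; unfold g; rewrite dirichlet_sub, <- (He (1 - t)), <- (Hp (- (1 - t))).
    do 3 f_equal; ring. }
rewrite E2; specialize (HK N HN); fold g in HK.
replace (2 * K / INR N) with (2 * (K / INR N)) by (unfold Rdiv; ring).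
apply Rabs_le; apply Rabs_le_between in HK; lra.
Qed.

Lemma integ_period_shift (f : R -> R) (v : R) : continuity f -> period1 f ->
  integ (fun t => f (t + v)) 0 1 = integ f 0 1.
Proof.
intros Cf Hp; rewrite integ_shift, Rplus_0_l by exact Cf.
rewrite (integ_split f v 0 (1 + v) Cf), (integ_split f 0 1 (1 + v) Cf).
replace (integ f 1 (1 + v)) with (integ f 0 v).
- rewrite (integ_swap f 0 v) by exact Cf; ring.
- rewrite (integ_ext f (fun t => f (t + 1))) by (intros; now rewrite Hp).
  rewrite integ_shift by exact Cf; f_equal; ring.
Qed.

(** The symmetrised translate is even and takes the value [2 * w y] at 0, so convergence at an
    arbitrary point [y] reduces to convergence at 0. *)
Lemma cosc_translates (w : R -> R) (y : R) (j : nat) :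
  continuity w -> period1 w -> (forall x, w (- x) = w x) ->
  cosc (fun t => w (y + t) + w (y - t)) j = 2 * cos (2 * PI * INR j * y) * cosc w j.
Proof.
intros Cw Hp He; unfold cosc; set (om := 2 * PI * INR j).
assert (Cv : forall v, continuity (fun t => cos (om * (t - v)))).
{ intro v; apply (derive_continuity _ (fun t => - sin (om * (t - v)) * om)).
  intro; auto_derive; auto; unfold Rminus; ring. }
assert (Cs : forall v, continuity (fun t => w (t + v))).
{ intro v; intro t; apply (continuity_pt_comp (fun t => t + v) w); [|apply Cw].
  apply (derive_continuity _ (fun _ => 1)); intro; auto_derive; auto; ring. }
assert (Cc : forall v, continuity (fun t => w (t + v) * cos (om * t))).
{ intro v; apply continuity_times; [apply Cs|apply continuity_cos_lin]. }
assert (A : forall v, integ (fun t => w (t + v) * cos (om * t)) 0 1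
                      = integ (fun t => w t * cos (om * (t - v))) 0 1).
{ intro v.
  rewrite <- (integ_period_shift (fun t => w t * cos (om * (t - v))) v).
  - apply integ_ext; intros t _; do 3 f_equal; ring.
  - apply continuity_times; [exact Cw|apply Cv].
  - intro t; cbv beta; rewrite Hp; f_equal.
    rewrite <- (cos_2PI_INR j (om * (t - v))); f_equal; unfold om; ring. }
rewrite (integ_ext _ (fun t => w (t + y) * cos (om * t) + w (t + - y) * cos (om * t))).
2:{ intros t _; rewrite (Rplus_comm y t), <- (He (y - t)).
    replace (- (y - t)) with (t + - y) by ring; ring. }
rewrite integ_add, (A y), (A (- y)), <- integ_add, <- integ_mul by
  (try apply Cc; apply continuity_times; try apply Cv; try apply continuity_cos_lin; exact Cw).
apply integ_ext; intros t _.
replace (om * (t - y)) with (om * t - om * y) by ring.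
replace (om * (t - - y)) with (om * t + om * y) by ring.
rewrite cos_plus, cos_minus; ring.
Qed.

Lemma fourier_inversion (w w' w'' : R -> R) (y : R) :
  (forall x, is_derive w x (w' x)) -> (forall x, is_derive w' x (w'' x)) ->
  continuity w'' -> period1 w -> (forall x, w (- x) = w x) ->
  exists K, forall N, (1 <= N)%nat ->
    Rabs (cosc w 0 + sumR N (fun i => 2 * cosc w (S i) * cos (2 * PI * INR (S i) * y)) - w y)
      <= K / INR N.
Proof.
intros H H' Hc Hp He.
assert (Cw := derive_continuity w w' H).
assert (D1 : forall (f f' : R -> R) x, (forall x, is_derive f x (f' x)) ->
   is_derive (fun t => f (y + t)) x (f' (y + x))).
{ intros f f' x Hf; eapply is_derive_eq; [apply (is_derive_comp f (fun t => y + t))|].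
  - apply Hf.
  - auto_derive; auto.
  - unfold scal; simpl; unfold mult; simpl; ring. }
assert (D2 : forall (f f' : R -> R) x, (forall x, is_derive f x (f' x)) ->
   is_derive (fun t => f (y - t)) x (- f' (y - x))).
{ intros f f' x Hf; eapply is_derive_eq; [apply (is_derive_comp f (fun t => y - t))|].
  - apply Hf.
  - auto_derive; auto.
  - unfold scal; simpl; unfold mult; simpl; ring. }
destruct (fourier_at_0 (fun t => w (y + t) + w (y - t)) (fun t => w' (y + t) - w' (y - t))
  (fun t => w'' (y + t) + w'' (y - t))) as [K HK].
- intro x; apply (is_derive_add (fun t => w (y + t))); auto.
- intro x; eapply is_derive_eq.
  + apply (is_derive_sub (fun t => w' (y + t))); auto.
  + cbv beta; ring.
- apply (continuity_plus (fun t => w'' (y + t)) (fun t => w'' (y - t))); intro t.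
  + apply (continuity_pt_comp (fun t => y + t) w''); [|apply Hc].
    apply (derive_continuity _ (fun _ => 1)); intro; auto_derive; auto; ring.
  + apply (continuity_pt_comp (fun t => y - t) w''); [|apply Hc].
    apply (derive_continuity _ (fun _ => -1)); intro; auto_derive; auto; ring.
- intro x; cbv beta; rewrite <- Rplus_assoc, Hp.
  f_equal; rewrite <- (Hp (y - (x + 1))); f_equal; ring.
- intro x; cbv beta; rewrite Rplus_comm; f_equal; f_equal; ring.
- exists (K / 2); intros N HN; specialize (HK N HN).
  rewrite Rplus_0_r, Rminus_0_r in HK.
  rewrite (cosc_translates w y 0 Cw Hp He) in HK.
  rewrite (sumR_ext _ _ (fun i => 2 * cosc w (S i) * cos (2 * PI * INR (S i) * y))) in HK.
  2:{ intros i _; rewrite (cosc_translates w y (S i) Cw Hp He); ring. }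
  simpl (INR 0) in HK; replace (2 * PI * 0 * y) with 0 in HK by ring; rewrite cos_0 in HK.
  replace (K / 2 / INR N) with (K / INR N / 2) by (unfold Rdiv; ring).
  apply Rabs_le; apply Rabs_le_between in HK; lra.
Qed.

(** * Trigonometric sums *)

Definition lip (L : R) (f : R -> R) : Prop :=
  forall s t, Rabs (f s - f t) <= L * Rabs (s - t).

Lemma lip_nonneg (L : R) (f : R -> R) : lip L f -> 0 <= L.
Proof.
intro H; specialize (H 1 0); rewrite Rminus_0_r, Rabs_R1, Rmult_1_r in H.
eapply Rle_trans; [apply Rabs_pos|exact H].
Qed.

Lemma lip_continuity (L : R) (f : R -> R) : lip L f -> continuity f.
Proof.
intros H x e He; assert (L0 := lip_nonneg L f H).
exists (e / (L + 1)); split; [apply Rdiv_lt_0_compat; lra|].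
intros y [_ Hy]; simpl in *; unfold Rdist in *.
eapply Rle_lt_trans; [apply H|].
apply Rle_lt_trans with ((L + 1) * Rabs (y - x)).
- apply Rmult_le_compat_r; [apply Rabs_pos|lra].
- apply Rlt_le_trans with ((L + 1) * (e / (L + 1))).
  + apply Rmult_lt_compat_l; lra.
  + right; field; lra.
Qed.

Lemma lip_mult (L M A B : R) (f g : R -> R) :
  lip L f -> lip M g -> (forall s, Rabs (f s) <= A) -> (forall s, Rabs (g s) <= B) ->
  lip (L * B + A * M) (fun t => f t * g t).
Proof.
intros Hf Hg Ha Hb s t.
replace (f s * g s - f t * g t) with ((f s - f t) * g s + f t * (g s - g t)) by ring.
eapply Rle_trans; [apply Rabs_triang|]; rewrite !Rabs_mult.
replace ((L * B + A * M) * Rabs (s - t))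
  with (L * Rabs (s - t) * B + A * (M * Rabs (s - t))) by ring.
apply Rplus_le_compat; apply Rmult_le_compat; try apply Rabs_pos; auto.
Qed.

Lemma lip_derive (L : R) (f f' : R -> R) :
  (forall x, is_derive f x (f' x)) -> (forall x, Rabs (f' x) <= L) -> lip L f.
Proof. intros H B s t; apply (MVT_bound f f' t s L); auto. Qed.

Lemma lip_cos (w : R) : lip (Rabs w) (fun t => cos (w * t)).
Proof.
apply (lip_derive _ _ (fun t => - sin (w * t) * w)).
- intro x; auto_derive; auto; ring.
- intro x; rewrite Rabs_mult; apply Rle_trans with (1 * Rabs w); [|lra].
  apply Rmult_le_compat_r; [apply Rabs_pos|].
  rewrite Rabs_Ropp; apply Rabs_le, SIN_bound.
Qed.

Lemma lip_sin (w : R) : lip (Rabs w) (fun t => sin (w * t)).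
Proof.
apply (lip_derive _ _ (fun t => cos (w * t) * w)).
- intro x; auto_derive; auto; ring.
- intro x; rewrite Rabs_mult; apply Rle_trans with (1 * Rabs w); [|lra].
  apply Rmult_le_compat_r; [apply Rabs_pos|apply Rabs_le, COS_bound].
Qed.

Lemma Rabs_cos (x : R) : Rabs (cos x) <= 1.
Proof. apply Rabs_le, COS_bound. Qed.

Lemma Rabs_sin (x : R) : Rabs (sin x) <= 1.
Proof. apply Rabs_le, SIN_bound. Qed.

Lemma INR_pos (q : nat) : (1 <= q)%nat -> 1 <= INR q.
Proof. intro H; apply (le_INR 1); auto. Qed.

(** Every cell costs at most [L / q^2]. An arbitrary prefix [n] is allowed because the positions of
    the vertices are themselves partial sums, compared with an integral up to [k/q]. *)
Lemma riemann_sum_lip (L : R) (f : R -> R) (q n : nat) : lip L f -> (1 <= q)%nat ->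
  Rabs (sumR n (fun k => f (INR k / INR q)) / INR q - integ f 0 (INR n / INR q))
    <= INR n * (L / INR q ^ 2).
Proof.
intros Hf Hq; assert (Q := INR_pos q Hq); assert (Cf := lip_continuity L f Hf).
assert (L0 := lip_nonneg L f Hf).
induction n as [|n IH].
- change (sumR 0 ?g) with 0; simpl INR; unfold Rdiv; rewrite !Rmult_0_l, integ_nil.
  rewrite Rminus_0_r, Rabs_R0; lra.
- set (a := INR n / INR q) in *.
  assert (Ea : INR (S n) / INR q = a + / INR q) by (rewrite S_INR; unfold a; field; lra).
  assert (I0 : 0 < / INR q) by (inv_pos).
  rewrite Ea, sumR_S, (integ_split f 0 a (a + / INR q) Cf).
  fold a.
  assert (E : integ (fun t => f a - f t) a (a + / INR q)
              = f a / INR q - integ f a (a + / INR q)).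
  { rewrite integ_sub, integ_cst; [unfold Rdiv; ring| |exact Cf].
    apply continuity_const; now intros ? ?. }
  assert (B : Rabs (integ (fun t => f a - f t) a (a + / INR q)) <= L / INR q ^ 2).
  { eapply Rle_trans.
    - apply integ_abs_le_const with (M := L * / INR q); [lra| |].
      + apply (continuity_minus (fun _ => f a) f); [|exact Cf].
        apply continuity_const; now intros ? ?.
      + intros t Ht; eapply Rle_trans; [apply Hf|].
        apply Rmult_le_compat_l; [exact L0|].
        rewrite Rabs_minus_sym, Rabs_pos_eq; lra.
    - right; field; lra. }
  rewrite E in B.
  match goal with |- Rabs ?x <= _ => replace x with
   ((sumR n (fun k => f (INR k / INR q)) / INR q - integ f 0 a)
    + (f a / INR q - integ f a (a + / INR q))) by (unfold Rdiv; ring) end.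
  eapply Rle_trans; [apply Rabs_triang|]; rewrite S_INR; lra.
Qed.

Lemma riemann_sum_lip_1 (L : R) (f : R -> R) (q : nat) : lip L f -> (1 <= q)%nat ->
  Rabs (sumR q (fun k => f (INR k / INR q)) / INR q - integ f 0 1) <= L / INR q.
Proof.
intros Hf Hq; assert (Q := INR_pos q Hq).
pose proof (riemann_sum_lip L f q q Hf Hq) as H.
replace (INR q / INR q) with 1 in H by (field; lra).
replace (L / INR q) with (INR q * (L / INR q ^ 2)) by (field; lra); exact H.
Qed.

Lemma cos_sum (n : nat) (th : R) :
  sumR n (fun k => cos (th * INR k)) * (2 * sin (th / 2))
  = sin (th * INR n - th / 2) + sin (th / 2).
Proof.
induction n as [|n IH].
- change (sumR 0 ?g) with 0; simpl INR.
  replace (th * 0 - th / 2) with (- (th / 2)) by ring; rewrite sin_neg; ring.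
- rewrite sumR_S, Rmult_plus_distr_r, IH, S_INR.
  replace (th * (INR n + 1) - th / 2) with (th * INR n + th / 2) by field.
  rewrite sin_plus, sin_minus; ring.
Qed.

(* Summation by parts: [2 sin(th/2) sin(k th)] is a difference of cosines. *)
Lemma sin_sum_variation (n : nat) (a : nat -> R) (A V th : R) :
  (forall k, Rabs (a k) <= A) -> (forall k, Rabs (a (S k) - a k) <= V) ->
  Rabs (sumR (S n) (fun k => a k * sin (th * INR k)) * (2 * sin (th / 2)))
    <= 2 * A + INR n * V.
Proof.
intros HA HV.
assert (E : sumR (S n) (fun k => a k * sin (th * INR k)) * (2 * sin (th / 2))
  = a 0%nat * cos (th / 2) - a n * cos (th * INR n + th / 2)
    + sumR n (fun k => (a (S k) - a k) * cos (th * INR k + th / 2))).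
{ induction n as [|n IH].
  - rewrite sumR_S; change (sumR 0 ?g) with 0; simpl INR.
    rewrite Rmult_0_r, !Rplus_0_l, sin_0; ring.
  - rewrite sumR_S, Rmult_plus_distr_r, IH, (sumR_S n), S_INR.
    set (y := th * INR n + th / 2).
    replace (th * (INR n + 1)) with (y + th / 2) by (unfold y; field).
    replace (y + th / 2 + th / 2) with ((y + th / 2) + th / 2) by ring.
    assert (F : cos y = cos ((y + th / 2) - th / 2)) by (f_equal; ring).
    rewrite cos_minus in F; rewrite (cos_plus (y + th / 2)).
    rewrite Rmult_minus_distr_r, F; ring. }
rewrite E; eapply Rle_trans; [apply Rabs_triang|].
apply Rplus_le_compat.
- unfold Rminus; eapply Rle_trans; [apply Rabs_triang|].
  rewrite Rabs_Ropp, !Rabs_mult.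
  assert (G : forall k x, Rabs (a k) * Rabs (cos x) <= A).
  { intros k x; rewrite <- (Rmult_1_r A).
    apply Rmult_le_compat; try apply Rabs_pos; [apply HA|apply Rabs_cos]. }
  pose proof (G 0%nat (th / 2)); pose proof (G n (th * INR n + th / 2)); lra.
- apply sumR_abs_le_const; intros k _; rewrite Rabs_mult, <- (Rmult_1_r V).
  apply Rmult_le_compat; try apply Rabs_pos; [apply HV|apply Rabs_cos].
Qed.

(** Aliasing: on the grid [k/q] a frequency is seen only through its residue modulo [q]. *)
Lemma angle_mod (q j k : nat) : (1 <= q)%nat ->
  exists m, 2 * PI * INR j / INR q * INR k
   = 2 * PI * INR (j mod q) / INR q * INR k + 2 * PI * INR m.
Proof.
intro Hq; assert (Q := INR_pos q Hq); exists (j / q * k)%nat.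
pose proof (Nat.div_mod_eq j q) as E; apply (f_equal INR) in E.
rewrite plus_INR, mult_INR in E; rewrite mult_INR, E; field; lra.
Qed.

(** By [sin (PI t) >= t] on [[0,1/2]] and the symmetry [t -> 1 - t]; adding both reciprocals spares
    later case distinctions. *)
Lemma sin_frac_lower (q i : nat) : (1 <= i < q)%nat ->
  / (INR q * sin (PI * (INR i / INR q))) <= / INR i + / (INR q - INR i) /\
  0 < sin (PI * (INR i / INR q)).
Proof.
intros [H1 H2]; apply (le_INR 1) in H1; apply lt_INR in H2; simpl in H1.
set (s := sin _); set (I := INR i) in *; set (Q := INR q) in *.
assert (P1 : 0 < / I) by (inv_pos).
assert (P2 : 0 < / (Q - I)) by (inv_pos).
destruct (Rle_dec (I / Q) (1 / 2)) as [H|H].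
- assert (B : I / Q <= s).
  { apply sin_PI_lower; split; [|exact H].
    apply Rmult_le_pos; [lra|inv_nonneg]. }
  assert (0 < I / Q) by (apply Rdiv_lt_0_compat; lra).
  split; [|lra].
  apply Rle_trans with (/ I); [|lra]; apply Rinv_le_contravar; [lra|].
  replace I with (Q * (I / Q)) by (field; lra); apply Rmult_le_compat_l; lra.
- assert (B : (Q - I) / Q <= s).
  { unfold s; replace (PI * (I / Q)) with (PI - PI * ((Q - I) / Q)) by (field; lra).
    rewrite sin_PI_x; apply sin_PI_lower; split.
    - apply Rmult_le_pos; [lra|inv_nonneg].
    - replace ((Q - I) / Q) with (1 - I / Q) by (field; lra); lra. }
  assert (0 < (Q - I) / Q) by (apply Rdiv_lt_0_compat; lra).
  split; [|lra].
  apply Rle_trans with (/ (Q - I)); [|lra]; apply Rinv_le_contravar; [lra|].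
  replace (Q - I) with (Q * ((Q - I) / Q)) by (field; lra); apply Rmult_le_compat_l; lra.
Qed.

Definition divides_ind (q j : nat) : R := if Nat.eq_dec (j mod q) 0 then 1 else 0.

(** If [q] does not divide [j], the telescoped cosine sum returns to its start after [q] steps,
    while the factor [sin (PI i / q)] is not zero. *)
Lemma roots_of_unity_sum (q j : nat) : (1 <= q)%nat ->
  sumR q (fun k => cos (2 * PI * INR j / INR q * INR k)) / INR q = divides_ind q j.
Proof.
intro Hq; assert (Q := INR_pos q Hq).
rewrite (sumR_ext _ _ (fun k => cos (2 * PI * INR (j mod q) / INR q * INR k))).
2:{ intros k _; destruct (angle_mod q j k Hq) as [m ->]; apply cos_2PI_INR. }
unfold divides_ind; destruct (Nat.eq_dec (j mod q) 0) as [E|E].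
- rewrite E, (sumR_ext _ _ (fun _ => 1)), sumR_const; [field; lra|].
  intros k _; simpl INR; replace (2 * PI * 0 / INR q * INR k) with 0 by (field; lra).
  apply cos_0.
- set (i := (j mod q)%nat) in *.
  assert (Hi : (1 <= i < q)%nat) by (pose proof (Nat.mod_upper_bound j q); lia).
  destruct (sin_frac_lower q i Hi) as [_ Hs].
  set (th := 2 * PI * INR i / INR q).
  assert (Eth : th / 2 = PI * (INR i / INR q)) by (unfold th; field; lra).
  assert (Z : sumR q (fun k => cos (th * INR k)) * (2 * sin (th / 2)) = 0).
  { rewrite cos_sum.
    replace (th * INR q - th / 2) with (- (th / 2) + 2 * PI * INR i)
      by (unfold th; field; lra).
    rewrite sin_2PI_INR, sin_neg; ring. }
  apply Rmult_integral in Z; rewrite Eth in Z; destruct Z as [Z|Z]; [|lra].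
  rewrite Z; unfold Rdiv; ring.
Qed.

Definition dft (f : R -> R) (q j : nat) : R :=
  sumR q (fun k => f (INR k / INR q) * sin (2 * PI * INR j / INR q * INR k)) / INR q.

Lemma dft_mod (f : R -> R) (q j : nat) : (1 <= q)%nat -> dft f q j = dft f q (j mod q).
Proof.
intro Hq; unfold dft; f_equal; apply sumR_ext; intros k _; f_equal.
destruct (angle_mod q j k Hq) as [m ->]; apply sin_2PI_INR.
Qed.

(** Summation by parts: the samples are bounded by [A] and vary by at most [A] in total, so the
    numerator is at most [3 A]. *)
Lemma dft_bound (A : R) (f : R -> R) (q i : nat) :
  lip A f -> (forall t, Rabs (f t) <= A) -> (1 <= i < q)%nat ->
  Rabs (dft f q i) <= 3 / 2 * A * (/ INR i + / (INR q - INR i)).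
Proof.
intros HL HA Hi; destruct (sin_frac_lower q i Hi) as [B Hs].
assert (A0 := lip_nonneg _ _ HL).
assert (Q : 1 <= INR q) by (apply INR_pos; lia).
set (th := 2 * PI * INR i / INR q).
assert (Eth : th / 2 = PI * (INR i / INR q)) by (unfold th; field; lra).
destruct q as [|n]; [lia|].
assert (V := sin_sum_variation n (fun k => f (INR k / INR (S n))) A (A / INR (S n)) th
  ltac:(intro; apply HA)).
rewrite Eth in V; set (s := sin (PI * (INR i / INR (S n)))) in *.
assert (W : Rabs (sumR (S n) (fun k => f (INR k / INR (S n)) * sin (th * INR k)) * (2 * s)) <= 3 * A).
{ eapply Rle_trans; [apply V|].
  - intro k; eapply Rle_trans; [apply HL|right].
    rewrite S_INR; replace ((INR k + 1) / INR (S n) - INR k / INR (S n)) with (/ INR (S n))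
      by (field; lra).
    rewrite Rabs_pos_eq; [reflexivity|inv_nonneg].
  - assert (INR n * (A / INR (S n)) <= A); [|lra].
    replace A with (INR (S n) * (A / INR (S n))) at 2 by (field; lra).
    apply Rmult_le_compat_r; [|apply le_INR; lia].
    apply Rmult_le_pos; [lra|inv_nonneg]. }
rewrite Rabs_mult, (Rabs_pos_eq (2 * s)) in W by lra.
unfold dft; fold th; set (X := sumR _ _) in *.
unfold Rdiv at 1; rewrite Rabs_mult, Rabs_inv, (Rabs_pos_eq (INR (S n))) by lra.
apply Rle_trans with (3 / 2 * A * / (INR (S n) * s)).
- apply Rmult_le_reg_r with (INR (S n) * s * 2); [nra|].
  replace (Rabs X * / INR (S n) * (INR (S n) * s * 2)) with (Rabs X * (2 * s)) by (field; lra).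
  replace (3 / 2 * A * / (INR (S n) * s) * (INR (S n) * s * 2)) with (3 * A) by (field; lra).
  exact W.
- apply Rmult_le_compat_l; [lra|exact B].
Qed.

(** A square root in place of the logarithm is enough for the power count, and it follows termwise
    from [1/b^2 <= 2 (b - a)] when [b^2 = a^2 + 1]. *)
Lemma sum_inv_sqrt (n : nat) : sumR n (fun i => / INR (S i)) <= 2 * sqrt (INR n).
Proof.
induction n as [|n IH]; [change (sumR 0 ?g) with 0; simpl; rewrite sqrt_0; lra|].
rewrite sumR_S.
assert (H0 := pos_INR n); rewrite S_INR.
set (a := sqrt (INR n)) in *; set (b := sqrt (INR n + 1)).
assert (Ha : 0 <= a) by apply sqrt_pos.
assert (Hb : 1 <= b) by (unfold b; rewrite <- sqrt_1 at 1; apply sqrt_le_1; lra).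
assert (Ea : a * a = INR n) by (apply sqrt_sqrt; lra).
assert (Eb : b * b = INR n + 1) by (apply sqrt_sqrt; lra).
rewrite <- Eb.
assert (a <= b) by (apply sqrt_le_1; lra).
assert (/ (b * b) <= 2 * b - 2 * a); [|lra].
apply Rmult_le_reg_r with (b * b); [nra|]; rewrite Rinv_l by nra.
assert ((b - a) * (b + a) = 1) by nra.
assert (1 <= 2 * (b - a) * b) by nra.
nra.
Qed.

(** The saving for aliased frequencies: the trivial bound of a sum over one period is [A q]. Residue
    0 contributes nothing, since every sine vanishes, and the rest is two harmonic sums. *)
Lemma dft_sum_bound (A : R) (f : R -> R) (q : nat) :
  lip A f -> (forall t, Rabs (f t) <= A) -> (1 <= q)%nat ->
  sumR q (fun i => Rabs (dft f q i)) <= 6 * A * sqrt (INR q).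
Proof.
intros HL HA Hq; assert (A0 := lip_nonneg _ _ HL); assert (Q := INR_pos q Hq).
destruct q as [|n]; [lia|].
rewrite sumR_head.
replace (dft f (S n) 0) with 0.
2:{ unfold dft; rewrite (sumR_ext _ _ (fun _ => 0)), sumR_const; [field; lra|].
    intros k _; simpl (INR 0); rewrite Rmult_0_r; unfold Rdiv; rewrite !Rmult_0_l, sin_0; ring. }
rewrite Rabs_R0, Rplus_0_l.
apply Rle_trans with (sumR n (fun i => 3 / 2 * A * (/ INR (S i) + / INR (S (n - 1 - i))))).
- apply sumR_le; intros i Hi.
  replace (INR (S (n - 1 - i))) with (INR (S n) - INR (S i)).
  + apply dft_bound; auto; lia.
  + rewrite <- minus_INR by lia; f_equal; lia.
- rewrite sumR_scal, sumR_plus, (sumR_rev n (fun i => / INR (S i))).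
  assert (S1 := sum_inv_sqrt n).
  assert (sqrt (INR n) <= sqrt (INR (S n))) by (apply sqrt_le_1; try apply pos_INR; apply le_INR; lia).
  replace (6 * A * sqrt (INR (S n))) with (3 / 2 * A * (4 * sqrt (INR (S n)))) by field.
  apply Rmult_le_compat_l; lra.
Qed.

(** * Expansion of the matrix coefficients *)

(** What the analytic half has to know of an orbit: [xs] stands for the Lazutkin coordinates of the
    vertices and [ws] for the factors [sin phi / mu]. A row has [q] weights of size about [1/q], so
    both errors enter it at order [q^-3]. *)
Definition near_equidistributed (al b : R -> R) (K : R) (q : nat) (xs ws : nat -> R) : Prop :=
  forall k, (k < q)%nat ->
    Rabs (xs k - (INR k / INR q + al (INR k / INR q) / INR q ^ 2)) <= K / INR q ^ 3 /\
    Rabs (ws k - (1 + b (INR k / INR q) / INR q ^ 2) / INR q) <= K / INR q ^ 4.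

(** The matrix coefficient of the operator: row [q] evaluated at [cos (2 PI j x)]. *)
Definition cos_moment (q : nat) (xs ws : nat -> R) (j : nat) : R :=
  sumR q (fun k => ws k * cos (2 * PI * INR j * xs k)).

Definition sinc (f : R -> R) (j : nat) : R :=
  integ (fun t => f t * sin (2 * PI * INR j * t)) 0 1.

(* The [q]-independent functional multiplying [q^-2] in the expansion. *)
Definition second_order (al b : R -> R) (j : nat) : R :=
  cosc b j - 2 * PI * INR j * sinc al j.

Lemma two_PI_INR_bound (j : nat) : 0 <= 2 * PI * INR j <= 8 * INR j.
Proof. pose proof PI_4; pose proof PI2_3_2; pose proof (pos_INR j); nra. Qed.

Lemma lip_mult_osc (A : R) (f g : R -> R) (j : nat) : (1 <= j)%nat ->
  lip A f -> (forall t, Rabs (f t) <= A) ->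
  lip (Rabs (2 * PI * INR j)) g -> (forall t, Rabs (g t) <= 1) ->
  lip (9 * A * INR j) (fun t => f t * g t).
Proof.
intros Hj HL HA HL' H1 s t; assert (A0 := lip_nonneg _ _ HL).
eapply Rle_trans; [apply (lip_mult _ _ _ _ f g HL HL' HA H1)|].
apply Rmult_le_compat_r; [apply Rabs_pos|].
pose proof (two_PI_INR_bound j); rewrite Rabs_pos_eq by lra.
pose proof (INR_pos j Hj); nra.
Qed.

Lemma dft_sinc (A : R) (f : R -> R) (q j : nat) : (1 <= j)%nat -> (1 <= q)%nat ->
  lip A f -> (forall t, Rabs (f t) <= A) ->
  Rabs (dft f q j - sinc f j) <= 9 * A * INR j / INR q.
Proof.
intros Hj Hq HL HA; assert (Q := INR_pos q Hq).
pose proof (riemann_sum_lip_1 _ _ q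
  (lip_mult_osc A f (fun t => sin (2 * PI * INR j * t)) j Hj HL HA (lip_sin _)
    (fun t => Rabs_sin _)) Hq) as H.
unfold dft, sinc; erewrite sumR_ext; [apply H|].
intros k _; cbv beta; f_equal; f_equal; field; lra.
Qed.

(** The decay is taken from the discrete side: a grid of [10 j^2] points is fine enough for a
    Riemann error of [0.9 A / j], and on it [dft_bound] applies. This suits a function that is
    merely Lipschitz. *)
Lemma sinc_bound (A : R) (f : R -> R) (j : nat) : (1 <= j)%nat ->
  lip A f -> (forall t, Rabs (f t) <= A) -> Rabs (sinc f j) <= 3 * A / INR j.
Proof.
intros Hj HL HA; assert (A0 := lip_nonneg _ _ HL); assert (J := INR_pos j Hj).
set (q := (10 * j * j)%nat).
assert (EQ : INR q = 10 * INR j * INR j).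
{ unfold q; rewrite !mult_INR; simpl INR; ring. }
assert (Hq : (1 <= q)%nat) by (unfold q; nia).
assert (H1 := dft_sinc A f q j Hj Hq HL HA).
assert (H2 := dft_bound A f q j HL HA ltac:(unfold q; nia)).
rewrite EQ in H1, H2.
set (I := / INR j) in *.
assert (I0 : 0 < I) by (inv_pos).
assert (E1 : 9 * A * INR j / (10 * INR j * INR j) = 9 / 10 * A * I) by (unfold I; field; lra).
assert (E2 : / (10 * INR j * INR j - INR j) <= 1 / 9 * I).
{ replace (1 / 9 * I) with (/ (9 * INR j)) by (unfold I; field; lra).
  apply Rinv_le_contravar; nra. }
rewrite E1 in H1; unfold Rdiv; fold I.
assert (H3 : 3 / 2 * A * (I + / (10 * INR j * INR j - INR j)) <= 3 / 2 * A * (10 / 9 * I)).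
{ apply Rmult_le_compat_l; lra. }
assert (0 <= A * I) by (apply Rmult_le_pos; lra).
apply Rabs_le; apply Rabs_le_between in H1, H2; lra.
Qed.

(** The quadratic bound serves small shifts, the linear one shifts of order one and more; which of
    them is useful depends on the size of [j / q^2]. *)
Lemma cos_taylor_1 (a B : R) :
  Rabs (cos (a + B) - cos a + B * sin a) <= Rabs B * Rabs B /\
  Rabs (cos (a + B) - cos a + B * sin a) <= 2 * Rabs B.
Proof.
assert (D1 : forall x y, Rabs (sin x - sin y) <= Rabs (x - y)).
{ intros x y; pose proof (lip_sin 1 x y) as H; cbv beta in H; rewrite Rabs_R1, !Rmult_1_l in H; exact H. }
assert (D2 : forall x y, Rabs (cos x - cos y) <= Rabs (x - y)).
{ intros x y; pose proof (lip_cos 1 x y) as H; cbv beta in H; rewrite Rabs_R1, !Rmult_1_l in H; exact H. }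
split.
- set (f := fun t => cos (a + t) - cos a + t * sin a).
  replace (cos (a + B) - cos a + B * sin a) with (f B - f 0)
    by (unfold f; rewrite Rplus_0_r; ring).
  replace (Rabs B * Rabs B) with (Rabs B * Rabs (B - 0)) by (rewrite Rminus_0_r; ring).
  apply (MVT_bound f (fun t => sin a - sin (a + t))).
  + intros x _; unfold f; auto_derive; auto; ring.
  + intros x Hx; eapply Rle_trans; [apply D1|].
    replace (a - (a + x)) with (- x) by ring; rewrite Rabs_Ropp.
    revert Hx; unfold Rmin, Rmax; destruct (Rle_dec 0 B); unfold Rabs;
      destruct (Rcase_abs x), (Rcase_abs B); lra.
- eapply Rle_trans; [apply Rabs_triang|].
  assert (H := D2 (a + B) a); replace (a + B - a) with B in H by ring.
  assert (Rabs (B * sin a) <= Rabs B); [|lra].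
  rewrite Rabs_mult; pose proof (Rabs_sin a); pose proof (Rabs_pos B); nra.
Qed.

Lemma Rpower_le_1 (x p : R) : 0 < x <= 1 -> 0 <= p -> Rpower x p <= 1.
Proof.
intros Hx Hp; unfold Rpower; rewrite <- exp_0.
assert (ln x <= 0) by (rewrite <- ln_1; apply ln_le; lra).
apply Rminus_le_0; assert (p * ln x <= 0) by nra.
destruct (Req_dec (p * ln x) 0) as [->|E]; [lra|].
assert (exp (p * ln x) < exp 0) by (apply exp_increasing; lra); lra.
Qed.

(** Interpolates the two Taylor bounds. With [X = j/q^2] an exponent [p] has to satisfy [p < 4/3],
    so that [j^p] is summable against [j^(-7/3)], and [p > 7/6], so that [q^(-2p)] beats
    [q^(-7/3)]. *)
Lemma min_le_power_5_4 (X y : R) : 0 < X -> y <= X -> y <= X * X -> y <= Rpower X (5 / 4).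
Proof.
intros HX H1 H2; destruct (Rle_dec X 1) as [H|H].
- apply Rle_trans with (1 := H2).
  replace (X * X) with (Rpower X (5 / 4) * Rpower X (3 / 4)).
  + pose proof (Rpower_le_1 X (3 / 4) ltac:(lra) ltac:(lra)).
    assert (0 < Rpower X (5 / 4)) by apply exp_pos; nra.
  + rewrite <- Rpower_plus; replace (5 / 4 + 3 / 4) with (INR 2) by (simpl; field).
    rewrite Rpower_pow by lra; ring.
- apply Rle_trans with (1 := H1); rewrite <- (Rpower_1 X) at 1 by lra.
  apply Rle_Rpower; lra.
Qed.

Lemma power_5_4_inv_sq (Q : R) : 0 < Q -> Rpower (/ Q ^ 2) (5 / 4) = / (Q ^ 2 * sqrt Q).
Proof.
intro HQ; rewrite <- Rpower_sqrt by lra.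
replace (Q ^ 2) with (Rpower Q 2) at 2.
2:{ change 2 with (INR 2); apply Rpower_pow; lra. }
rewrite <- Rpower_plus, <- Rpower_Ropp; unfold Rpower; f_equal.
replace (Q ^ 2) with (Q * Q) by ring.
rewrite ln_Rinv, ln_mult by nra; field.
Qed.

(** Points and weights are replaced one at a time by their expansions. What remains is a
    root-of-unity sum, a Riemann sum for [cosc b j], and [dft al q j], which approximates
    [sinc al j] only below the aliasing threshold [q/2]; above it the discrete coefficient stays in
    the remainder, to be summed over [j] later. *)
Lemma cos_moment_expansion (al b : R -> R) (A K : R) :
  lip A al -> lip A b -> (forall t, Rabs (al t) <= A) -> (forall t, Rabs (b t) <= A) ->
  0 <= K ->
  exists K1, 0 <= K1 /\ forall q j xs ws, (1 <= q)%nat -> (1 <= j)%nat ->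
    near_equidistributed al b K q xs ws ->
    Rabs (cos_moment q xs ws j - divides_ind q j - second_order al b j / INR q ^ 2)
    <= K1 * (Rpower (INR j) (5 / 4) / (INR q ^ 2 * sqrt (INR q)))
       + (if le_dec (2 * j) q then 0 else K1 * (INR j / INR q ^ 2 * Rabs (dft al q j))).
Proof.
intros La Lb Ba Bb K0; assert (A0 := lip_nonneg _ _ La).
exists (9 * K + 8 * A * (A + K) + 9 * A + (16 * A + 64 * A * A) + 64 * A + 48 * A + 8).
set (K1 := _ + 8).
assert (AK : 0 <= 8 * A * (A + K)) by (apply Rmult_le_pos; lra).
assert (AA : 0 <= A * A) by (apply Rmult_le_pos; lra).
assert (K1p : 8 <= K1) by (unfold K1; lra).
split; [lra|].
intros q j xs ws Hq Hj Hn.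
assert (Q1 := INR_pos q Hq); assert (J1 := INR_pos j Hj).
set (Q := INR q) in *; set (J := INR j) in *.
set (P := Rpower J (5 / 4)).
assert (PJ : J <= P).
{ unfold P; rewrite <- (Rpower_1 J) at 1 by lra; apply Rle_Rpower; lra. }
set (r := sqrt Q).
assert (r1 : 1 <= r) by (unfold r; rewrite <- sqrt_1; apply sqrt_le_1; lra).
assert (rr : r * r = Q) by (apply sqrt_sqrt; lra).
assert (rQ : r <= Q) by nra.
set (U := P / (Q ^ 2 * r)).
assert (Q2 : 0 < Q ^ 2) by (apply pow_lt; lra).
assert (IQ : 0 < / Q) by (inv_pos).
assert (IQ1 : / Q <= 1) by (rewrite <- Rinv_1; apply Rinv_le_contravar; lra).
assert (U0 : J / Q ^ 3 <= U).
{ unfold U, Rdiv; replace (Q ^ 3) with (Q ^ 2 * Q) by ring.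
  apply Rmult_le_compat; [lra| |exact PJ|].
  - left; apply Rinv_0_lt_compat; nra.
  - apply Rinv_le_contravar; [nra|apply Rmult_le_compat_l; lra]. }
assert (U00 : 0 < J / Q ^ 3) by (apply Rdiv_lt_0_compat; [lra|apply pow_lt; lra]).
assert (om := two_PI_INR_bound j); fold J in om; set (w := 2 * PI * J) in *.
assert (lipc : forall s t, Rabs (cos (w * s) - cos (w * t)) <= 8 * J * Rabs (s - t)).
{ intros s t; eapply Rle_trans; [apply lip_cos|].
  rewrite (Rabs_pos_eq w) by lra; apply Rmult_le_compat_r; [apply Rabs_pos|lra]. }
set (t_ := fun k => INR k / Q).
(* [eA] replaces the weight, [eB] the point in the [b] term, [eD] drops the position error beyond
   [al / q^2], and [eE] linearises the cosine in that shift. Only [eE] calls for the interpolated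
   exponent; the other three are at most of order [j / q^3]. *)
set (eA := fun k => (ws k - (1 + b (t_ k) / Q ^ 2) / Q) * cos (w * xs k)).
set (eB := fun k => b (t_ k) / Q ^ 3 * (cos (w * xs k) - cos (w * t_ k))).
set (eD := fun k => / Q * (cos (w * xs k) - cos (w * (t_ k + al (t_ k) / Q ^ 2)))).
set (B_ := fun k => w * al (t_ k) / Q ^ 2).
set (eE := fun k => / Q * (cos (w * t_ k + B_ k) - cos (w * t_ k) + B_ k * sin (w * t_ k))).
assert (Dec : cos_moment q xs ws j = sumR q eA + sumR q eB + sumR q eD + sumR q eE
  + divides_ind q j
  + (/ Q ^ 2 * (sumR q (fun k => b (t_ k) * cos (w * t_ k)) / Q)
     - w / Q ^ 2 * dft al q j)).
{ rewrite <- (roots_of_unity_sum q j Hq); unfold dft, cos_moment; fold Q J w.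
  rewrite (sumR_ext q _ (fun k => eA k + eB k + eD k + eE k + / Q * cos (w / Q * INR k)
    + (/ Q ^ 3 * (b (t_ k) * cos (w * t_ k))
       - w / Q ^ 3 * (al (INR k / Q) * sin (w / Q * INR k))))).
  - rewrite sumR_plus, sumR_plus, sumR_plus, sumR_plus, sumR_plus, sumR_minus, !sumR_scal.
    field; lra.
  - intros k _; unfold eA, eB, eD, eE, B_, t_.
    replace (w * (INR k / Q + al (INR k / Q) / Q ^ 2))
      with (w * (INR k / Q) + w * al (INR k / Q) / Q ^ 2) by (field; lra).
    replace (w / Q * INR k) with (w * (INR k / Q)) by (field; lra).
    field; lra. }
assert (HA : Rabs (sumR q eA) <= K * U).
{ apply Rle_trans with (Q * (K / Q ^ 4)).
  - apply sumR_abs_le_const; intros k Hk; unfold eA; rewrite Rabs_mult.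
    rewrite <- (Rmult_1_r (K / Q ^ 4)).
    apply Rmult_le_compat; try apply Rabs_pos; [apply Hn, Hk|apply Rabs_cos].
  - replace (Q * (K / Q ^ 4)) with (K * (1 / Q ^ 3)) by (field; lra).
    apply Rmult_le_compat_l; [exact K0|]; eapply Rle_trans; [|exact U0].
    apply Rmult_le_compat_r; [inv_nonneg|lra]. }
assert (Hx : forall k, (k < q)%nat -> Rabs (xs k - t_ k) <= (A + K) / Q ^ 2).
{ intros k Hk; destruct (Hn k Hk) as [H _]; fold Q in H; fold (t_ k) in H.
  replace (xs k - t_ k) with ((xs k - (t_ k + al (t_ k) / Q ^ 2)) + al (t_ k) / Q ^ 2) by ring.
  eapply Rle_trans; [apply Rabs_triang|].
  replace ((A + K) / Q ^ 2) with (K / Q ^ 2 + A / Q ^ 2) by (field; lra).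
  apply Rplus_le_compat.
  - eapply Rle_trans; [exact H|]; apply Rmult_le_compat_l; [exact K0|].
    apply Rinv_le_contravar; [lra|]; apply Rle_pow; [lra|lia].
  - unfold Rdiv; rewrite Rabs_mult, Rabs_inv, (Rabs_pos_eq (Q ^ 2)) by lra.
    apply Rmult_le_compat_r; [inv_nonneg|apply Ba]. }
assert (HB : Rabs (sumR q eB) <= 8 * A * (A + K) * U).
{ apply Rle_trans with (Q * (A / Q ^ 3 * (8 * J * ((A + K) / Q ^ 2)))).
  - apply sumR_abs_le_const; intros k Hk; unfold eB; rewrite Rabs_mult.
    apply Rmult_le_compat; try apply Rabs_pos.
    + unfold Rdiv; rewrite Rabs_mult, Rabs_inv, (Rabs_pos_eq (Q ^ 3)) by (apply pow_le; lra).
      apply Rmult_le_compat_r; [inv_nonneg|apply Bb].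
    + eapply Rle_trans; [apply lipc|apply Rmult_le_compat_l; [lra|now apply Hx]].
  - replace (Q * (A / Q ^ 3 * (8 * J * ((A + K) / Q ^ 2))))
      with (8 * A * (A + K) * (J / Q ^ 3 * / Q)) by (field; lra).
    apply Rmult_le_compat_l; [exact AK|]; eapply Rle_trans; [|exact U0]; nra. }
assert (HD : Rabs (sumR q eD) <= 8 * K * U).
{ apply Rle_trans with (Q * (/ Q * (8 * J * (K / Q ^ 3)))).
  - apply sumR_abs_le_const; intros k Hk; unfold eD; rewrite Rabs_mult, (Rabs_pos_eq (/ Q)) by lra.
    apply Rmult_le_compat_l; [lra|].
    eapply Rle_trans; [apply lipc|apply Rmult_le_compat_l; [lra|apply (Hn k Hk)]].
  - replace (Q * (/ Q * (8 * J * (K / Q ^ 3)))) with (8 * K * (J / Q ^ 3)) by (field; lra).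
    apply Rmult_le_compat_l; lra. }
assert (HE : Rabs (sumR q eE) <= (16 * A + 64 * A * A) * U).
{ apply Rle_trans with (Q * (/ Q * ((16 * A + 64 * A * A) * U))); [|right; field; lra].
  apply sumR_abs_le_const; intros k Hk; unfold eE; rewrite Rabs_mult, (Rabs_pos_eq (/ Q)) by lra.
  apply Rmult_le_compat_l; [lra|].
  set (X := J / Q ^ 2); assert (X0 : 0 < X) by (apply Rdiv_lt_0_compat; lra).
  assert (HB_ : Rabs (B_ k) <= 8 * A * X).
  { unfold B_, Rdiv; rewrite !Rabs_mult, Rabs_inv, (Rabs_pos_eq (Q ^ 2)), (Rabs_pos_eq w) by lra.
    replace (8 * A * X) with ((8 * J) * A * / Q ^ 2) by (unfold X; field; lra).
    apply Rmult_le_compat_r; [inv_nonneg|].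
    apply Rmult_le_compat; [lra|apply Rabs_pos|lra|apply Ba]. }
  destruct (cos_taylor_1 (w * t_ k) (B_ k)) as [T1 T2].
  assert (EU : U = Rpower X (5 / 4)).
  { unfold X, Rdiv; rewrite <- Rpower_mult_distr, power_5_4_inv_sq;
      [reflexivity|lra|lra|inv_pos]. }
  rewrite EU; set (M := 16 * A + 64 * A * A).
  (* [M] is divided out to reach [min_le_power_5_4]; [M = 0] means [A = 0], where the shift [B_ k]
     vanishes. *)
  destruct (Req_dec M 0) as [M0|M0].
  - assert (A = 0) by (unfold M in M0; nra).
    rewrite M0, Rmult_0_l; eapply Rle_trans; [exact T2|]; subst A; lra.
  - assert (Mp : 0 < M) by (unfold M in *; nra).
    set (Y := Rabs (cos _ - _ + _)) in *.
    apply Rmult_le_reg_l with (/ M); [inv_pos|].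
    rewrite <- Rmult_assoc, Rinv_l, Rmult_1_l by lra.
    apply min_le_power_5_4; [exact X0| |];
      (apply Rmult_le_reg_l with M; [lra|];
       rewrite <- Rmult_assoc, Rinv_r, Rmult_1_l by lra); unfold M.
    + eapply Rle_trans; [exact T2|]; nra.
    + eapply Rle_trans; [exact T1|].
      apply Rle_trans with ((8 * A * X) * (8 * A * X)).
      * apply Rmult_le_compat; try apply Rabs_pos; exact HB_.
      * assert (0 <= 16 * A * (X * X)) by (apply Rmult_le_pos; nra); nra. }
assert (HC : Rabs (/ Q ^ 2 * (sumR q (fun k => b (t_ k) * cos (w * t_ k)) / Q)
    - cosc b j / Q ^ 2) <= 9 * A * U).
{ pose proof (riemann_sum_lip_1 _ _ q
  (lip_mult_osc A b (fun t => cos (2 * PI * INR j * t)) j Hj Lb Bb (lip_cos _)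
    (fun t => Rabs_cos _)) Hq) as H.
  cbv beta in H; fold J in H; fold w in H; fold Q in H.
  change (integ (fun t => b t * cos (w * t)) 0 1) with (cosc b j) in H.
  replace (/ Q ^ 2 * (sumR q (fun k => b (t_ k) * cos (w * t_ k)) / Q) - cosc b j / Q ^ 2)
    with (/ Q ^ 2 * (sumR q (fun k => b (t_ k) * cos (w * t_ k)) / Q - cosc b j))
    by (field; lra).
  rewrite Rabs_mult, (Rabs_pos_eq (/ Q ^ 2)) by (inv_nonneg).
  apply Rle_trans with (/ Q ^ 2 * (9 * A * J / Q)).
  - apply Rmult_le_compat_l; [inv_nonneg|exact H].
  - replace (/ Q ^ 2 * (9 * A * J / Q)) with (9 * A * (J / Q ^ 3)) by (field; lra).
    apply Rmult_le_compat_l; lra. }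
set (Y := dft al q j - sinc al j).
assert (TB := sinc_bound A al j Hj La Ba); fold J in TB.
assert (HF : Rabs (w / Q ^ 2 * Y) <= (64 * A + 48 * A) * U
   + (if le_dec (2 * j) q then 0 else K1 * (J / Q ^ 2 * Rabs (dft al q j)))).
{ assert (wQ : 0 <= w / Q ^ 2 <= 8 * J / Q ^ 2).
  { split; [apply Rmult_le_pos; [lra|inv_nonneg]|].
    apply Rmult_le_compat_r; [inv_nonneg|lra]. }
  rewrite Rabs_mult, (Rabs_pos_eq (w / Q ^ 2)) by lra.
  destruct (le_dec (2 * j) q) as [Hjq|Hjq].
  - apply le_INR in Hjq as HJQ; rewrite mult_INR in HJQ; simpl (INR 2) in HJQ; fold J Q in HJQ.
    assert (Y1 : Rabs Y <= 9 * A * J / Q) by (apply dft_sinc; auto).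
    assert (Y2 : Rabs Y <= 6 * A / J).
    { assert (H := dft_bound A al q j La Ba ltac:(lia)); fold J Q in H.
      assert (/ (Q - J) <= / J) by (apply Rinv_le_contravar; lra).
      assert (3 / 2 * A * (/ J + / (Q - J)) <= 3 / 2 * A * (2 * / J))
        by (apply Rmult_le_compat_l; lra).
      unfold Y; unfold Rdiv in *; apply Rabs_le; apply Rabs_le_between in H, TB; lra. }
    (* Geometric mean of two bounds: the Riemann error [9 A j / q] is good for small [j], the decay
       [6 A / j] for large [j], and their product no longer contains [j]. *)
    assert (Y3 : Rabs Y <= 8 * A / r).
    { assert (0 < / r) by (inv_pos).
      apply Rsqr_incr_0; [|apply Rabs_pos|apply Rmult_le_pos; lra]; unfold Rsqr.
      apply Rle_trans with ((9 * A * J / Q) * (6 * A / J)).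
      - apply Rmult_le_compat; try apply Rabs_pos; auto.
      - replace (9 * A * J / Q * (6 * A / J)) with (54 * (A * A) * / Q) by (field; lra).
        replace (8 * A / r * (8 * A / r)) with (64 * (A * A) * / (r * r)) by (field; lra).
        rewrite rr; apply Rmult_le_compat_r; lra. }
    rewrite Rplus_0_r.
    apply Rle_trans with (8 * J / Q ^ 2 * (8 * A / r)).
    + apply Rmult_le_compat; try lra; apply Rabs_pos.
    + replace (8 * J / Q ^ 2 * (8 * A / r)) with (64 * A * (J / (Q ^ 2 * r))) by (field; lra).
      assert (J / (Q ^ 2 * r) <= U).
      { apply Rmult_le_compat_r; [left; apply Rinv_0_lt_compat; nra|exact PJ]. }
      assert (64 * A * (J / (Q ^ 2 * r)) <= 64 * A * U) by (apply Rmult_le_compat_l; lra).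
      assert (0 <= 48 * A * U) by (apply Rmult_le_pos; lra); lra.
  - assert (HJQ : Q <= 2 * J).
    { unfold Q, J; replace 2 with (INR 2) by reflexivity; rewrite <- mult_INR; apply le_INR; lia. }
    assert (YB : Rabs Y <= Rabs (dft al q j) + 3 * A / J).
    { unfold Y; unfold Rminus; eapply Rle_trans; [apply Rabs_triang|rewrite Rabs_Ropp; lra]. }
    apply Rle_trans with (8 * J / Q ^ 2 * (Rabs (dft al q j) + 3 * A / J)).
    + apply Rmult_le_compat; try lra; apply Rabs_pos.
    + rewrite Rmult_plus_distr_l, Rplus_comm; apply Rplus_le_compat.
      * replace (8 * J / Q ^ 2 * (3 * A / J)) with (24 * A * / Q ^ 2) by (field; lra).
        assert (/ Q ^ 2 <= 2 * U).
        { unfold U; replace (/ Q ^ 2) with (r / (Q ^ 2 * r)) by (field; lra).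
          replace (2 * (P / (Q ^ 2 * r))) with ((2 * P) / (Q ^ 2 * r)) by (field; lra).
          apply Rmult_le_compat_r; [left; apply Rinv_0_lt_compat; nra|lra]. }
        assert (24 * A * / Q ^ 2 <= 24 * A * (2 * U)) by (apply Rmult_le_compat_l; lra).
        assert (0 <= A * U) by (apply Rmult_le_pos; lra); lra.
      * replace (8 * J / Q ^ 2 * Rabs (dft al q j)) with (8 * (J / Q ^ 2 * Rabs (dft al q j)))
          by (unfold Rdiv; ring).
        apply Rmult_le_compat_r; [|exact K1p].
        apply Rmult_le_pos; [|apply Rabs_pos].
        apply Rmult_le_pos; [lra|inv_nonneg]. }
rewrite Dec; unfold second_order; fold J w.
set (c1 := / Q ^ 2 * (sumR q (fun k => b (t_ k) * cos (w * t_ k)) / Q)) in *.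
match goal with |- Rabs ?x <= _ => replace x with
  (sumR q eA + sumR q eB + sumR q eD + sumR q eE + (c1 - cosc b j / Q ^ 2) - w / Q ^ 2 * Y)
  by (unfold Y; field; lra) end.
fold P r; fold U.
set (G := if le_dec (2 * j) q then _ else _) in *.
replace (K1 * U + G) with (K * U + 8 * A * (A + K) * U + 8 * K * U + (16 * A + 64 * A * A) * U
  + 9 * A * U + ((64 * A + 48 * A) * U + G) + 8 * U) by (unfold K1; ring).
apply Rabs_le; apply Rabs_le_between in HA, HB, HC, HD, HE, HF; lra.
Qed.

(** * Injectivity on weighted sequences *)

Lemma exp_ge (x : R) : 1 + x <= exp x.
Proof. destruct (Req_dec x 0) as [->|H]; [rewrite exp_0; lra|left; now apply exp_ineq1]. Qed.

Lemma Rpower_neg_le (x y p : R) : 0 < x <= y -> 0 <= p -> Rpower y (- p) <= Rpower x (- p).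
Proof.
intros Hxy Hp; rewrite !Rpower_Ropp; apply Rinv_le_contravar; [apply exp_pos|].
now apply Rle_Rpower_l.
Qed.

(** A discrete integral test: for consecutive [y] and [x = y + 1],
    [x^(-1-e) <= (y^(-e) - x^(-e)) / e], and the right side telescopes. *)
Lemma sum_power_bound (e : R) (n : nat) : 0 < e ->
  sumR n (fun i => Rpower (INR (S i)) (- (1 + e))) <= 1 + / e.
Proof.
intro He; assert (Ie : 0 < / e) by (inv_pos).
assert (H : sumR (S n) (fun i => Rpower (INR (S i)) (- (1 + e)))
            <= 1 + / e * (1 - Rpower (INR (S n)) (- e))).
{ induction n as [|n IH].
  - rewrite sumR_S; change (sumR 0 ?g) with 0; simpl INR.
    unfold Rpower; rewrite ln_1, !Rmult_0_r, exp_0; lra.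
  - rewrite sumR_S.
    set (x := INR (S (S n))) in *; set (y := INR (S n)) in *.
    assert (Ex : x = y + 1) by (unfold x, y; rewrite (S_INR (S n)); ring).
    assert (y1 : 1 <= y) by (apply INR_pos; lia).
    assert (D : Rpower x (- (1 + e)) <= / e * (Rpower y (- e) - Rpower x (- e))); [|nra].
    replace (- (1 + e)) with (- e + - (1)) by ring; rewrite Rpower_plus, (Rpower_Ropp x 1), Rpower_1 by lra.
    set (r := y / x).
    assert (r0 : 0 < r) by (apply Rdiv_lt_0_compat; lra).
    replace y with (x * r) by (unfold r; field; lra).
    rewrite <- Rpower_mult_distr by lra.
    (* [1 + ln r <= r] with [r = 1 - 1/x]; hence [r^(-e) = exp(-e ln r) >= 1 + e/x]. *)
    assert (L : ln r <= - / x).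
    { assert (G := exp_ge (ln r)); rewrite exp_ln in G by exact r0.
      replace r with (1 - / x) in G at 2 by (unfold r; rewrite Ex; field; lra); lra. }
    assert (F : 1 + e * / x <= Rpower r (- e)).
    { eapply Rle_trans; [|apply exp_ge]; nra. }
    assert (X : 0 < Rpower x (- e)) by apply exp_pos.
    apply Rmult_le_reg_l with e; [exact He|].
    rewrite <- (Rmult_assoc e (/ e)), Rinv_r, Rmult_1_l by lra; nra. }
rewrite sumR_S in H.
assert (0 < Rpower (INR (S n)) (- (1 + e))) by apply exp_pos.
assert (0 < Rpower (INR (S n)) (- e)) by apply exp_pos; nra.
Qed.

Lemma Rpower_neg_small (e eps : R) : 0 < e -> 0 < eps ->
  exists n, (1 <= n)%nat /\ forall q, (n <= q)%nat -> Rpower (INR q) (- e) <= eps.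
Proof.
intros He Heps; set (B := Rpower (/ eps) (/ e)).
destruct (nfloor_ex B) as [n [_ Hn]]; [left; apply exp_pos|].
exists (S n); split; [lia|intros q Hq].
apply le_INR in Hq; rewrite S_INR in Hq.
rewrite Rpower_Ropp, <- (Rinv_inv eps); apply Rinv_le_contravar.
- inv_pos.
- apply Rle_trans with (Rpower B e).
  + unfold B; rewrite Rpower_mult, Rinv_l, Rpower_1 by (try apply Rinv_0_lt_compat; lra); lra.
  + apply Rle_Rpower_l; [lra|split; [apply exp_pos|lra]].
Qed.

(** The first term is [1/4], and the others telescope below [1/2] through
    [1/(x+1)^2 <= 1/x - 1/(x+1)]. A value well below 1 is the point, as it bounds the share of the
    proper multiples of [q]. *)
Lemma sum_inv_sq (n : nat) : sumR n (fun i => / INR (S (S i)) ^ 2) <= 3 / 4.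
Proof.
assert (H : forall n, sumR (S n) (fun i => / INR (S (S i)) ^ 2) <= 3 / 4 - / INR (S (S n))).
{ intro m; induction m as [|m IH].
  - rewrite sumR_S; change (sumR 0 ?g) with 0; simpl INR; lra.
  - rewrite sumR_S; set (x := INR (S (S m))) in *.
    replace (INR (S (S (S m)))) with (x + 1) by (unfold x; rewrite (S_INR (S (S m))); ring).
    assert (x1 : 1 <= x) by (apply INR_pos; lia).
    assert (/ (x + 1) ^ 2 <= / x - / (x + 1)); [|lra].
    replace (/ x - / (x + 1)) with (/ (x * (x + 1))) by (field; lra).
    apply Rinv_le_contravar; nra. }
destruct n as [|n]; [change (sumR 0 ?g) with 0; lra|].
specialize (H n); assert (0 < / INR (S (S n))); [|lra].
apply Rinv_0_lt_compat, lt_0_INR; lia.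
Qed.

(* The exponent must exceed [2 + 1/4], so that [j^(5/4)] is summable against the weight, and
   stay below [5/2], so that a remainder [q^-(5/2)] gains a power of [q]. *)
Definition wgt (j : nat) : R :=
  match j with O => 0 | S _ => Rpower (INR j) (- (7 / 3)) end.

Lemma wgt_pos (j : nat) : (1 <= j)%nat -> wgt j = Rpower (INR j) (- (7 / 3)).
Proof. destruct j; [lia|reflexivity]. Qed.

Lemma wgt_nonneg (j : nat) : 0 <= wgt j.
Proof. destruct j; simpl; [lra|left; apply exp_pos]. Qed.

Definition remainder_bound (al : R -> R) (K1 : R) (q j : nat) : R :=
  K1 * (Rpower (INR j) (5 / 4) / (INR q ^ 2 * sqrt (INR q)))
  + (if le_dec (2 * j) q then 0 else K1 * (INR j / INR q ^ 2 * Rabs (dft al q j))).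

Lemma low_frequency_sum (N : nat) :
  sumR N (fun j => wgt j * Rpower (INR j) (5 / 4)) <= 13.
Proof.
destruct N as [|N]; [change (sumR 0 ?g) with 0; lra|].
rewrite sumR_head; unfold wgt at 1; rewrite Rmult_0_l, Rplus_0_l.
(* [7/3 - 5/4 = 1 + 1/12], so the series is at most [1 + 12]. *)
eapply Rle_trans; [|apply Rle_trans with (1 + / (1 / 12)); [apply (sum_power_bound (1 / 12) N)|]; lra].
apply sumR_le; intros i _; right; rewrite wgt_pos by lia.
rewrite <- Rpower_plus; f_equal; lra.
Qed.

(** From [2 j > q] follows [3 j >= q (n + 1)], also in the block [n = 0]; the factor 9 bounds
    [3^(4/3)]. *)
Lemma high_frequency_term (q n i : nat) : (1 <= q)%nat -> (i < q)%nat ->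
  ~ (2 * (n * q + i) <= q)%nat ->
  wgt (n * q + i) * INR (n * q + i) <= 9 * Rpower (INR q) (- (4 / 3)) * Rpower (INR (S n)) (- (4 / 3)).
Proof.
intros Hq Hi Hj; set (j := (n * q + i)%nat) in *.
assert (Q1 := INR_pos q Hq).
assert (N1 : 1 <= INR (S n)) by (apply INR_pos; lia).
assert (Hj1 : (1 <= j)%nat) by lia; assert (J1 := INR_pos j Hj1).
rewrite wgt_pos by exact Hj1.
rewrite <- (Rpower_1 (INR j)) at 2 by lra; rewrite <- Rpower_plus.
replace (- (7 / 3) + 1) with (- (4 / 3)) by field.
assert (B : INR q * INR (S n) * / 3 <= INR j).
{ assert (H : (q * S n <= 3 * j)%nat) by (unfold j in *; destruct n; nia).
  apply le_INR in H; rewrite !mult_INR in H; simpl (INR 3) in H; lra. }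
eapply Rle_trans; [apply Rpower_neg_le with (x := INR q * INR (S n) * / 3); [|lra]|].
- split; [|exact B]; apply Rmult_lt_0_compat; [nra|lra].
- rewrite <- !Rpower_mult_distr by nra.
  assert (T : Rpower (/ 3) (- (4 / 3)) <= 9).
  { rewrite Rpower_Ropp.
    replace 9 with (/ (Rpower (/ 3) (INR 2))) by (rewrite Rpower_pow by lra; field).
    apply Rinv_le_contravar; [apply exp_pos|].
    unfold Rpower; rewrite ln_Rinv by lra; simpl INR.
    assert (0 <= ln 3) by (rewrite <- ln_1; apply ln_le; lra).
    assert (L : (1 + 1) * - ln 3 <= 4 / 3 * - ln 3) by lra.
    destruct L as [L|L]; [left; now apply exp_increasing|right; now rewrite L]. }
  assert (0 < Rpower (INR q) (- (4 / 3))) by apply exp_pos.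
  assert (0 < Rpower (INR (S n)) (- (4 / 3))) by apply exp_pos.
  rewrite (Rmult_comm _ (Rpower (/ 3) _)), <- Rmult_assoc.
  apply Rmult_le_compat_r; [lra|]; apply Rmult_le_compat_r; lra.
Qed.

(** All frequencies of one residue share the same discrete coefficient, so the sum is dominated by
    the product of a sum over residues, of order [sqrt q], and a convergent series over blocks;
    [216 = 9 * 6 * 4]. *)
Lemma high_frequency_sum (A : R) (al : R -> R) (q P : nat) :
  lip A al -> (forall t, Rabs (al t) <= A) -> (1 <= q)%nat ->
  sumR (P * q) (fun j => wgt j * (if le_dec (2 * j) q then 0 else INR j * Rabs (dft al q j)))
  <= 216 * A * (Rpower (INR q) (- (4 / 3)) * sqrt (INR q)).
Proof.
intros HL HA Hq; assert (A0 := lip_nonneg _ _ HL).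
set (R0 := Rpower (INR q) (- (4 / 3))).
assert (R0p : 0 < R0) by apply exp_pos.
rewrite sumR_mul.
apply Rle_trans with (sumR P (fun n => 9 * R0 * (6 * A * sqrt (INR q)) * Rpower (INR (S n)) (- (4 / 3)))).
- apply sumR_le; intros n _.
  apply Rle_trans with (sumR q (fun i => 9 * R0 * Rpower (INR (S n)) (- (4 / 3)) * Rabs (dft al q i))).
  + apply sumR_le; intros i Hi.
    assert (0 < Rpower (INR (S n)) (- (4 / 3))) by apply exp_pos.
    destruct (le_dec (2 * (n * q + i)) q) as [H1|H1].
    * rewrite Rmult_0_r; apply Rmult_le_pos; [nra|apply Rabs_pos].
    * rewrite (dft_mod al q (n * q + i)) by exact Hq.
      replace ((n * q + i) mod q)%nat with i.
      2:{ rewrite Nat.add_comm, Nat.Div0.mod_add, Nat.mod_small; auto. }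
      rewrite <- Rmult_assoc; apply Rmult_le_compat_r; [apply Rabs_pos|].
      now apply high_frequency_term.
  + rewrite sumR_scal.
    replace (9 * R0 * (6 * A * sqrt (INR q)) * Rpower (INR (S n)) (- (4 / 3)))
      with (9 * R0 * Rpower (INR (S n)) (- (4 / 3)) * (6 * A * sqrt (INR q))) by ring.
    apply Rmult_le_compat_l; [|now apply dft_sum_bound].
    assert (0 < Rpower (INR (S n)) (- (4 / 3))) by apply exp_pos; nra.
- rewrite sumR_scal.
  assert (S4 := sum_power_bound (1 / 3) P ltac:(lra)).
  replace (- (1 + 1 / 3)) with (- (4 / 3)) in S4 by field.
  replace (1 + / (1 / 3)) with 4 in S4 by field.
  replace (216 * A * (R0 * sqrt (INR q))) with (9 * R0 * (6 * A * sqrt (INR q)) * 4) by ring.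
  apply Rmult_le_compat_l; [|exact S4].
  assert (0 <= sqrt (INR q)) by apply sqrt_pos.
  apply Rmult_le_pos; [lra|]; apply Rmult_le_pos; lra.
Qed.

(** The interpolated part gives [q^(-5/2)] directly; the aliased part gives [q^(-2 - 4/3 + 1/2)],
    which is smaller. *)
Lemma remainder_sum (A K1 : R) (al : R -> R) (q P : nat) :
  lip A al -> (forall t, Rabs (al t) <= A) -> 0 <= K1 -> (1 <= q)%nat ->
  sumR (P * q) (fun j => wgt j * remainder_bound al K1 q j)
  <= K1 * (13 + 216 * A) * Rpower (INR q) (- (5 / 2)).
Proof.
intros HL HA HK Hq; assert (A0 := lip_nonneg _ _ HL); assert (Q1 := INR_pos q Hq).
set (Q := INR q) in *.
assert (Q2 : 0 < Q ^ 2) by (apply pow_lt; lra).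
assert (E2 : Q ^ 2 = Rpower Q 2) by (symmetry; apply (Rpower_pow 2); lra).
assert (E1 : / (Q ^ 2 * sqrt Q) = Rpower Q (- (5 / 2))).
{ rewrite E2, <- Rpower_sqrt, <- Rpower_plus, <- Rpower_Ropp by lra; f_equal; field. }
assert (E3 : Rpower Q (- (4 / 3)) * sqrt Q * / Q ^ 2 <= Rpower Q (- (5 / 2))).
{ rewrite E2, <- Rpower_sqrt, <- Rpower_Ropp, <- !Rpower_plus by lra.
  apply Rle_Rpower; lra. }
rewrite (sumR_ext _ _ (fun j => K1 * / (Q ^ 2 * sqrt Q) * (wgt j * Rpower (INR j) (5 / 4))
  + K1 * / Q ^ 2 * (wgt j * (if le_dec (2 * j) q then 0 else INR j * Rabs (dft al q j))))).
2:{ intros j _; unfold remainder_bound; fold Q.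
    destruct (le_dec (2 * j) q); unfold Rdiv; ring. }
rewrite sumR_plus, !sumR_scal, E1.
assert (H1 := low_frequency_sum (P * q)); assert (H2 := high_frequency_sum A al q P HL HA Hq).
fold Q in H2.
assert (R5 : 0 < Rpower Q (- (5 / 2))) by apply exp_pos.
set (S1 := sumR (P * q) (fun j => wgt j * Rpower (INR j) (5 / 4))) in *.
set (S2 := sumR (P * q) (fun j => wgt j * (if le_dec (2 * j) q then 0 else _))) in *.
assert (B1 : K1 * Rpower Q (- (5 / 2)) * S1 <= K1 * Rpower Q (- (5 / 2)) * 13).
{ apply Rmult_le_compat_l; [apply Rmult_le_pos; lra|exact H1]. }
assert (B2 : K1 * / Q ^ 2 * S2 <= K1 * (216 * A) * Rpower Q (- (5 / 2))).
{ apply Rle_trans with (K1 * / Q ^ 2 * (216 * A * (Rpower Q (- (4 / 3)) * sqrt Q))).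
  - apply Rmult_le_compat_l; [|exact H2].
    apply Rmult_le_pos; [exact HK|left; apply Rinv_0_lt_compat; exact Q2].
  - replace (K1 * / Q ^ 2 * (216 * A * (Rpower Q (- (4 / 3)) * sqrt Q)))
      with (K1 * (216 * A) * (Rpower Q (- (4 / 3)) * sqrt Q * / Q ^ 2)) by ring.
    apply Rmult_le_compat_l; [|exact E3]; apply Rmult_le_pos; lra. }
lra.
Qed.

Lemma divides_sum (a : nat -> R) (q P : nat) : (1 <= q)%nat ->
  sumR (P * q) (fun j => a j * divides_ind q j) = sumR P (fun n => a (n * q)%nat).
Proof.
intro Hq; rewrite sumR_mul; apply sumR_ext; intros n _.
rewrite (sumR_ext _ _ (fun i => if Nat.eq_dec i 0 then a (n * q)%nat else 0)).
- apply sumR_single; lia.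
- intros i Hi; unfold divides_ind.
  replace ((n * q + i) mod q)%nat with i.
  2:{ rewrite Nat.add_comm, Nat.Div0.mod_add, Nat.mod_small; auto. }
  destruct (Nat.eq_dec i 0) as [->|_]; [rewrite Nat.add_0_r|]; ring.
Qed.

(** For [j = n q] the weight is [n^(-7/3) wgt q], and [n^(-7/3) <= n^-2]. *)
Lemma multiples_sum (a : nat -> R) (M : R) (q P : nat) : (1 <= q)%nat -> 0 <= M ->
  (forall j, Rabs (a j) <= M * wgt j) -> (2 <= P)%nat ->
  Rabs (sumR P (fun n => a (n * q)%nat) - a q) <= 3 / 4 * (M * wgt q).
Proof.
intros Hq HM Ha HP; destruct P as [|[|P]]; [lia|lia|].
rewrite !sumR_head; simpl (0 * q)%nat; rewrite Nat.mul_1_l.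
(* [wgt 0 = 0] forces [a 0 = 0], so the multiple 0 of [q] drops out. *)
assert (A0 : a 0%nat = 0).
{ specialize (Ha 0%nat); simpl in Ha; rewrite Rmult_0_r in Ha.
  apply Rabs_eq_0; apply Rle_antisym; [exact Ha|apply Rabs_pos]. }
rewrite A0; match goal with |- Rabs ?x <= _ =>
  replace x with (sumR P (fun i => a (S (S i) * q)%nat)) by ring end.
apply Rle_trans with (sumR P (fun i => M * wgt q * / INR (S (S i)) ^ 2)).
- apply sumR_abs_le; intros i _; eapply Rle_trans; [apply Ha|].
  rewrite Rmult_assoc; apply Rmult_le_compat_l; [exact HM|].
  rewrite !wgt_pos by nia; rewrite mult_INR.
  assert (Q1 := INR_pos q Hq).
  assert (S1 : 1 <= INR (S (S i))) by (apply INR_pos; lia).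
  rewrite <- Rpower_mult_distr, Rmult_comm by lra.
  apply Rmult_le_compat_l; [left; apply exp_pos|].
  rewrite <- (Rpower_pow 2), <- Rpower_Ropp by lra.
  apply Rle_Rpower; [exact S1|simpl; lra].
- rewrite sumR_scal, Rmult_comm; apply Rmult_le_compat_r; [|apply sum_inv_sq].
  apply Rmult_le_pos; [exact HM|apply wgt_nonneg].
Qed.

Lemma is_lim_seq_0_bound (u : nat -> R) (eps : R) : is_lim_seq u 0 -> 0 < eps ->
  exists N, forall n, (N <= n)%nat -> Rabs (u n) <= eps.
Proof.
intros H He; apply is_lim_seq_spec in H; destruct (H (mkposreal eps He)) as [N HN].
exists N; intros n Hn; specialize (HN n Hn); simpl in HN; rewrite Rminus_0_r in HN; lra.
Qed.

(* Letting [N] and then an auxiliary row [q'] tend to infinity shows that the functional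
   [sum_j a_j sigma_j] vanishes; row [q] then bounds [a_q] by its proper multiples. *)
Lemma kernel_contraction (al : R -> R) (A K1 M : R) (q0 : nat) (sg a : nat -> R)
    (c : nat -> nat -> R) :
  lip A al -> (forall t, Rabs (al t) <= A) -> 0 <= K1 -> 0 <= M -> (1 <= q0)%nat ->
  K1 * (13 + 216 * A) * Rpower (INR q0) (- (1 / 6)) <= 3 / 20 ->
  (forall q j, (q0 <= q)%nat -> (1 <= j)%nat ->
     Rabs (c q j - divides_ind q j - sg j / INR q ^ 2) <= remainder_bound al K1 q j) ->
  (forall q, (q0 <= q)%nat -> is_lim_seq (fun N => sumR N (fun j => a j * c q j)) 0) ->
  (forall j, Rabs (a j) <= M * wgt j) ->
  forall q, (q0 <= q)%nat -> Rabs (a q) <= 9 / 10 * (M * wgt q).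
Proof.
intros HL HA HK HM Hq0 Hsmall Hc Hlim Ha.
assert (A0 := lip_nonneg _ _ HL).
set (K2 := K1 * (13 + 216 * A)) in *.
assert (K20 : 0 <= K2) by (apply Rmult_le_pos; lra).
set (La := fun N => sumR N (fun j => a j * sg j)).
(* [9/10] is [3/4] from the proper multiples of [q] plus [3/20] from the remainder, which is small
   because [q^(-5/2) = q^(-1/6) q^(-7/3)]. *)
assert (Row : forall q P, (q0 <= q)%nat -> (2 <= P)%nat ->
  Rabs (sumR (P * q) (fun j => a j * c q j) - a q - La (P * q)%nat / INR q ^ 2)
  <= 9 / 10 * (M * wgt q)).
{ intros q P Hq HP; assert (Hq1 : (1 <= q)%nat) by lia; assert (Q1 := INR_pos q Hq1).
  assert (R1 : Rabs (sumR (P * q) (fun j => a j * (c q j - divides_ind q j - sg j / INR q ^ 2)))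
              <= M * (K2 * Rpower (INR q) (- (5 / 2)))).
  { eapply Rle_trans; [|apply Rmult_le_compat_l; [exact HM|apply (remainder_sum A K1 al q P); auto]].
    rewrite <- sumR_scal; apply sumR_abs_le; intros j _.
    rewrite Rabs_mult, <- Rmult_assoc; destruct j as [|j].
    - specialize (Ha 0%nat); simpl in *; rewrite Rmult_0_r in Ha.
      assert (Rabs (a 0%nat) = 0) as -> by (pose proof (Rabs_pos (a 0%nat)); lra); lra.
    - apply Rmult_le_compat; try apply Rabs_pos; [apply Ha|apply Hc; lia]. }
  assert (R2 := multiples_sum a M q P Hq1 HM Ha HP).
  rewrite <- divides_sum in R2 by exact Hq1.
  rewrite (sumR_ext _ _ (fun j => a j * c q j - a j * divides_ind q j - / INR q ^ 2 * (a j * sg j)))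
    in R1 by (intros; field; lra).
  rewrite !sumR_minus, sumR_scal in R1; fold (La (P * q)%nat) in R1.
  assert (R3 : K2 * Rpower (INR q) (- (5 / 2)) <= 3 / 20 * wgt q).
  { rewrite wgt_pos by exact Hq1.
    replace (- (5 / 2)) with (- (1 / 6) + - (7 / 3)) by field; rewrite Rpower_plus, <- Rmult_assoc.
    apply Rmult_le_compat_r; [left; apply exp_pos|]; apply Rle_trans with (2 := Hsmall).
    apply Rmult_le_compat_l; [exact K20|]; apply Rpower_neg_le; [|lra].
    split; [apply lt_0_INR; lia|now apply le_INR]. }
  assert (R4 : M * (K2 * Rpower (INR q) (- (5 / 2))) <= 3 / 20 * (M * wgt q)).
  { replace (3 / 20 * (M * wgt q)) with (M * (3 / 20 * wgt q)) by ring.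
    now apply Rmult_le_compat_l. }
  unfold Rdiv at 1; rewrite (Rmult_comm (La _)).
  apply Rabs_le; apply Rabs_le_between in R1, R2; lra. }
intros q Hq; apply Rle_plus_epsilon; intros eps Heps.
assert (Q1 : 1 <= INR q) by (apply INR_pos; lia).
(* Row [q'] determines [La] up to [2 M] times [q'^2 wgt q' = q'^(-1/3)], and this is made at most
   [eps / 3]. *)
destruct (Rpower_neg_small (1 / 3) (eps / (6 * (M + 1)))) as [n1 [Hn1 Hn2]];
  [lra|apply Rdiv_lt_0_compat; lra|].
set (q' := Nat.max n1 q0).
assert (Q1' : 1 <= INR q') by (apply INR_pos; lia).
assert (IQ : 0 < / INR q' ^ 2) by (apply Rinv_0_lt_compat, pow_lt; lra).
assert (IQ1 : / INR q ^ 2 <= 1).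
{ rewrite <- Rinv_1; apply Rinv_le_contravar; [lra|apply pow_R1_Rle; lra]. }
assert (IQ0 : 0 < / INR q ^ 2) by (apply Rinv_0_lt_compat, pow_lt; lra).
destruct (is_lim_seq_0_bound _ (eps / 3) (Hlim q Hq)) as [N1 HN1]; [lra|].
destruct (is_lim_seq_0_bound _ (eps / 3 / INR q' ^ 2) (Hlim q' ltac:(lia))) as [N2 HN2].
{ apply Rdiv_lt_0_compat; [lra|apply pow_lt; lra]. }
(* Both rows are cut at one common length, a multiple of [q] as well as of [q'], so that the same
   partial sum [La N] occurs in both. *)
set (P := S (S (N1 + N2))).
assert (G1 := Row q (P * q')%nat Hq ltac:(unfold P; nia)).
assert (G2 := Row q' (P * q)%nat ltac:(lia) ltac:(unfold P; nia)).
replace (P * q' * q)%nat with (P * q * q')%nat in G1 by ring.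
assert (PB : (N1 + N2 <= P * q * q')%nat).
{ apply Nat.le_trans with (P * 1 * 1)%nat; [unfold P; lia|].
  apply Nat.mul_le_mono; [apply Nat.mul_le_mono; lia|unfold q'; lia]. }
specialize (HN1 (P * q * q')%nat ltac:(lia)).
specialize (HN2 (P * q * q')%nat ltac:(lia)).
set (N := (P * q * q')%nat) in *.
assert (G3 : Rabs (La N / INR q' ^ 2) <= eps / 3 / INR q' ^ 2 + 2 * (M * wgt q')).
{ specialize (Ha q'); pose proof (wgt_nonneg q').
  assert (0 <= M * wgt q') by (apply Rmult_le_pos; lra).
  apply Rabs_le; apply Rabs_le_between in G2, HN2, Ha; lra. }
assert (W : INR q' ^ 2 * wgt q' <= eps / (6 * (M + 1))).
{ rewrite wgt_pos by lia; rewrite <- (Rpower_pow 2), <- Rpower_plus by lra.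
  replace (INR 2 + - (7 / 3)) with (- (1 / 3)) by (simpl; field); apply Hn2; lia. }
assert (G4 : Rabs (La N) <= 2 / 3 * eps).
{ replace (La N) with (INR q' ^ 2 * (La N / INR q' ^ 2)) by (field; lra).
  rewrite Rabs_mult, Rabs_pos_eq by (apply pow_le; lra).
  apply Rle_trans with (INR q' ^ 2 * (eps / 3 / INR q' ^ 2 + 2 * (M * wgt q'))).
  - apply Rmult_le_compat_l; [apply pow_le; lra|exact G3].
  - replace (INR q' ^ 2 * (eps / 3 / INR q' ^ 2 + 2 * (M * wgt q')))
      with (eps / 3 + 2 * M * (INR q' ^ 2 * wgt q')) by (field; lra).
    assert (2 * M * (INR q' ^ 2 * wgt q') <= 2 * M * (eps / (6 * (M + 1))))
      by (apply Rmult_le_compat_l; lra).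
    assert (2 * M * (eps / (6 * (M + 1))) <= 2 * (M + 1) * (eps / (6 * (M + 1)))).
    { apply Rmult_le_compat_r; [|lra]; left; apply Rdiv_lt_0_compat; lra. }
    replace (2 * (M + 1) * (eps / (6 * (M + 1)))) with (eps / 3) in H0 by (field; lra).
    lra. }
assert (G5 : Rabs (La N / INR q ^ 2) <= 2 / 3 * eps).
{ unfold Rdiv at 1; rewrite Rabs_mult, (Rabs_pos_eq (/ _)) by lra.
  pose proof (Rabs_pos (La N)); nra. }
apply Rabs_le; apply Rabs_le_between in G1, HN1, G5; lra.
Qed.

Lemma cosc_bound (f : R -> R) (B : R) (j : nat) : continuity f ->
  (forall t, 0 <= t <= 1 -> Rabs (f t) <= B) -> Rabs (cosc f j) <= B.
Proof.
intros Cf HB; replace B with ((1 - 0) * B) by ring.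
apply integ_abs_le_const; [lra| |].
- apply continuity_times; [exact Cf|apply continuity_cos_lin].
- intros t Ht; rewrite Rabs_mult, <- (Rmult_1_r B).
  apply Rmult_le_compat; try apply Rabs_pos; [now apply HB|apply Rabs_cos].
Qed.

(** Two rounds of [cosc_parts] give [j^-4]; this makes the weighted norm finite, which is where the
    iteration starts. *)
Lemma cosc_decay (w w1 w2 w3 w4 : R -> R) :
  (forall x, is_derive w x (w1 x)) -> (forall x, is_derive w1 x (w2 x)) ->
  (forall x, is_derive w2 x (w3 x)) -> (forall x, is_derive w3 x (w4 x)) ->
  continuity w4 -> period1 w ->
  exists B, 0 <= B /\ forall j, (1 <= j)%nat -> Rabs (cosc w j) <= B * wgt j.
Proof.
intros H1 H2 H3 H4 Cw Hp.
destruct (continuity_bounded w4 0 1 Cw) as [B [B0 HB]].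
exists B; split; [exact B0|intros j Hj].
assert (P1 := period1_derive _ _ H1 Hp); assert (P2 := period1_derive _ _ H2 P1).
assert (P3 := period1_derive _ _ H3 P2).
rewrite (cosc_parts w w1 w2), (cosc_parts w2 w3 w4); auto.
2: exact (derive_continuity _ _ H3).
assert (J1 := INR_pos j Hj); assert (Hc := cosc_bound w4 B j Cw HB).
set (om := 2 * PI * INR j).
assert (Hom : INR j <= om) by (pose proof PI2_3_2; unfold om; nra).
replace (- (- cosc w4 j / om ^ 2) / om ^ 2) with (cosc w4 j * / (om ^ 2 * om ^ 2)) by (field; lra).
rewrite Rabs_mult.
assert (P4 : 0 < om ^ 2 * om ^ 2) by (apply Rmult_lt_0_compat; apply pow_lt; lra).
rewrite Rabs_inv, (Rabs_pos_eq (_ * _)) by lra.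
apply Rmult_le_compat; [apply Rabs_pos|inv_nonneg|exact Hc|].
rewrite wgt_pos, Rpower_Ropp by exact Hj; apply Rinv_le_contravar; [apply exp_pos|].
apply Rle_trans with (INR j ^ 2 * INR j ^ 2).
- rewrite <- Rpower_pow, <- Rpower_plus by lra; apply Rle_Rpower; simpl; lra.
- assert (INR j ^ 2 <= om ^ 2) by (apply pow_incr; lra).
  apply Rmult_le_compat; try apply pow_le; lra.
Qed.

Lemma is_lim_seq_sumR (n : nat) (u : nat -> nat -> R) (l : nat -> R) :
  (forall k, is_lim_seq (u k) (l k)) ->
  is_lim_seq (fun N => sumR n (fun k => u k N)) (sumR n l).
Proof.
intro H; induction n as [|n IH]; [apply is_lim_seq_const|].
rewrite sumR_S; apply is_lim_seq_ext with (fun N => sumR n (fun k => u k N) + u n N).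
- intro N; now rewrite sumR_S.
- apply (is_lim_seq_plus' _ _ _ _ IH (H n)).
Qed.

Lemma cosine_series_limit (w w1 w2 : R -> R) (y : R) :
  (forall x, is_derive w x (w1 x)) -> (forall x, is_derive w1 x (w2 x)) ->
  continuity w2 -> period1 w -> (forall x, w (- x) = w x) -> cosc w 0 = 0 ->
  is_lim_seq (fun N => sumR N (fun j => 2 * cosc w j * cos (2 * PI * INR j * y))) (w y).
Proof.
intros H1 H2 Cw Hp He H0.
destruct (fourier_inversion w w1 w2 y H1 H2 Cw Hp He) as [K HK].
apply is_lim_seq_spec; intros [eps Heps]; simpl.
destruct (nfloor_ex (Rabs K / eps)) as [n [_ Hn]].
{ apply Rmult_le_pos; [apply Rabs_pos|left; now apply Rinv_0_lt_compat]. }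
exists (S (S n)); intros N HN; destruct N as [|N]; [lia|].
specialize (HK N ltac:(lia)); rewrite H0, Rplus_0_l in HK.
rewrite sumR_head, H0, Rmult_0_r, Rmult_0_l, Rplus_0_l.
eapply Rle_lt_trans; [exact HK|].
assert (N1 : INR n + 1 <= INR N) by (rewrite <- S_INR; apply le_INR; lia).
assert (n0 := pos_INR n).
apply Rle_lt_trans with (Rabs K / INR N).
- apply Rmult_le_compat_r; [inv_nonneg|apply Rle_abs].
- apply Rmult_lt_reg_r with (INR N); [lra|].
  unfold Rdiv at 1; rewrite Rmult_assoc, Rinv_l, Rmult_1_r by lra.
  replace (Rabs K) with (eps * (Rabs K / eps)) by (field; lra).
  apply Rmult_lt_compat_l; lra.
Qed.

Lemma geometric_zero (x c : R) : 0 <= x -> 0 <= c ->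
  (forall n, x <= (9 / 10) ^ n * c) -> x = 0.
Proof.
intros Hx Hc H; apply Rle_antisym; [|exact Hx].
apply (is_lim_seq_le (fun _ => x) (fun n => (9 / 10) ^ n * c) x 0 H).
- apply is_lim_seq_const.
- replace (Finite 0) with (Rbar_mult 0 c) by (simpl; f_equal; ring).
  apply is_lim_seq_mult'; [|apply is_lim_seq_const].
  apply is_lim_seq_geom; rewrite Rabs_pos_eq; lra.
Qed.

(** No supremum is formed: a bound of the coefficients by a multiple of [wgt] is improved by the
    factor [9/10] as often as desired, starting from [cosc_decay], so the coefficients are 0. The
    threshold [qm] depends on the asymptotic data alone, neither on the orbits nor on [w]. *)
Lemma operator_kernel_trivial (al b : R -> R) (A K : R) :
  lip A al -> lip A b -> (forall t, Rabs (al t) <= A) -> (forall t, Rabs (b t) <= A) ->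
  0 <= K ->
  exists qm, (2 <= qm)%nat /\ forall q0 (xs ws : nat -> nat -> R), (qm <= q0)%nat ->
    (forall q, (q0 <= q)%nat -> near_equidistributed al b K q (xs q) (ws q)) ->
    forall w w1 w2 w3 w4 : R -> R,
    (forall x, is_derive w x (w1 x)) -> (forall x, is_derive w1 x (w2 x)) ->
    (forall x, is_derive w2 x (w3 x)) -> (forall x, is_derive w3 x (w4 x)) ->
    continuity w4 -> period1 w -> (forall x, w (- x) = w x) ->
    (forall k, (k < q0)%nat -> cosc w k = 0) ->
    (forall q, (q0 <= q)%nat -> sumR q (fun k => ws q k * w (xs q k)) = 0) ->
    forall y, w y = 0.
Proof.
intros La Lb Ba Bb K0; assert (A0 := lip_nonneg _ _ La).
destruct (cos_moment_expansion al b A K La Lb Ba Bb K0) as [K1 [K10 HK1]].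
set (K2 := K1 * (13 + 216 * A)).
assert (K20 : 0 <= K2) by (apply Rmult_le_pos; lra).
destruct (Rpower_neg_small (1 / 6) (3 / 20 / (K2 + 1))) as [n [Hn1 Hn]];
  [lra|apply Rdiv_lt_0_compat; lra|].
exists (S (S n)); split; [lia|].
intros q0 xs ws Hq0 Hnear w w1 w2 w3 w4 H1 H2 H3 H4 Cw Hp He Hlow Hker y.
assert (Cw2 : continuity w2) by exact (derive_continuity _ _ H3).
assert (H0 : cosc w 0 = 0) by (apply Hlow; lia).
set (a := fun j => 2 * cosc w j).
set (c := fun q j => cos_moment q (xs q) (ws q) j).
(* A row is a finite sum over vertices, so it commutes with the pointwise limit of the cosine
   series. *)
assert (Hlim : forall q, (q0 <= q)%nat -> is_lim_seq (fun N => sumR N (fun j => a j * c q j)) 0).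
{ intros q Hq; rewrite <- (Hker q Hq).
  apply is_lim_seq_ext with
    (fun N => sumR q (fun k => ws q k * sumR N (fun j => a j * cos (2 * PI * INR j * xs q k)))).
  - intro N; rewrite (sumR_ext q _ (fun k => sumR N (fun j => a j * (ws q k * cos (2 * PI * INR j * xs q k))))).
    + rewrite sumR_swap; apply sumR_ext; intros j _; now rewrite sumR_scal.
    + intros k _; rewrite <- sumR_scal; apply sumR_ext; intros; ring.
  - apply (is_lim_seq_sumR q (fun k N => ws q k * sumR N (fun j => a j * cos (2 * PI * INR j * xs q k)))).
    intro k; apply (is_lim_seq_mult' (fun _ => ws q k)); [apply is_lim_seq_const|].
    apply (cosine_series_limit w w1 w2); auto. }
destruct (cosc_decay w w1 w2 w3 w4 H1 H2 H3 H4 Cw Hp) as [B [B0 HB]].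
assert (Ha : forall m j, Rabs (a j) <= (9 / 10) ^ m * (2 * B) * wgt j).
{ intro m; induction m as [|m IH]; intro j.
  - rewrite pow_O, Rmult_1_l; unfold a; rewrite Rabs_mult, (Rabs_pos_eq 2), Rmult_assoc by lra.
    apply Rmult_le_compat_l; [lra|].
    destruct j as [|j]; [rewrite H0, Rabs_R0; simpl; lra|apply HB; lia].
  - assert (Mp : 0 <= (9 / 10) ^ m * (2 * B)) by (apply Rmult_le_pos; [apply pow_le|]; lra).
    destruct (le_lt_dec q0 j) as [Hj|Hj].
    + rewrite <- tech_pow_Rmult, !(Rmult_assoc (9 / 10)).
      apply (kernel_contraction al A K1 _ q0 (second_order al b) a c); auto; try lia.
      * fold K2; apply Rle_trans with (K2 * (3 / 20 / (K2 + 1))).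
        -- apply Rmult_le_compat_l; [exact K20|apply Hn; lia].
        -- apply Rle_trans with ((K2 + 1) * (3 / 20 / (K2 + 1))); [|right; field; lra].
           apply Rmult_le_compat_r; [left; apply Rdiv_lt_0_compat; lra|lra].
      * intros q i Hq Hi; apply HK1; auto; lia.
    + unfold a; rewrite (Hlow j Hj), Rmult_0_r, Rabs_R0.
      apply Rmult_le_pos; [apply Rmult_le_pos; [apply pow_le|]; lra|apply wgt_nonneg]. }
assert (Za : forall j, a j = 0).
{ intro j; apply Rabs_eq_0, (geometric_zero _ (2 * B * wgt j)).
  - apply Rabs_pos.
  - apply Rmult_le_pos; [lra|apply wgt_nonneg].
  - intro m; rewrite <- Rmult_assoc; apply Ha. }
assert (L := cosine_series_limit w w1 w2 y H1 H2 Cw2 Hp He H0).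
apply (is_lim_seq_ext _ (fun _ => 0)) in L.
- apply is_lim_seq_unique in L; rewrite Lim_seq_const in L; now injection L.
- intro N; rewrite (sumR_ext _ _ (fun _ => 0)), sumR_const; [ring|].
  intros j _; change (a j * cos (2 * PI * INR j * y) = 0); rewrite Za; ring.
Qed.

(** * Uniform asymptotic bounds *)

(** The index type is left open: it is first a pair of base point and increment, later a triple of
    [q], an orbit and a vertex. One constant serves the whole of [D], which is the uniformity over
    orbits that the operator requires. *)
Definition bigO {I : Type} (D : I -> Prop) (h : I -> R) (n : nat) (f : I -> R) : Prop :=
  exists K, 0 <= K /\ forall i, D i -> Rabs (f i) <= K * h i ^ n.

Definition small {I : Type} (D : I -> Prop) (h : I -> R) : Prop :=
  forall i, D i -> 0 < h i <= 1.

Lemma bigO_ext {I : Type} (D : I -> Prop) (h : I -> R) (n : nat) (f g : I -> R) :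
  bigO D h n f -> (forall i, D i -> g i = f i) -> bigO D h n g.
Proof.
intros [K [K0 HK]] H; exists K; split; [exact K0|].
intros i Hi; rewrite H by exact Hi; auto.
Qed.

Lemma bigO_restrict {I : Type} (D D' : I -> Prop) (h : I -> R) (n : nat) (f : I -> R) :
  bigO D h n f -> (forall i, D' i -> D i) -> bigO D' h n f.
Proof. intros [K [K0 HK]] H; exists K; split; auto. Qed.

Lemma bigO_le {I : Type} (D : I -> Prop) (h : I -> R) (n m : nat) (f : I -> R) :
  small D h -> bigO D h m f -> (n <= m)%nat -> bigO D h n f.
Proof.
intros Hs [K [K0 HK]] Hnm; exists K; split; [exact K0|].
intros i Hi; eapply Rle_trans; [now apply HK|].
apply Rmult_le_compat_l; [exact K0|].
replace m with (n + (m - n))%nat by lia; rewrite pow_add, <- (Rmult_1_r (h i ^ n)) at 1.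
destruct (Hs i Hi) as [H1 H2]; rewrite Rmult_1_r.
rewrite <- (Rmult_1_r (h i ^ n)) at 2; apply Rmult_le_compat_l; [apply pow_le; lra|].
rewrite <- (pow1 (m - n)); apply pow_incr; lra.
Qed.

Lemma bigO_add {I : Type} (D : I -> Prop) (h : I -> R) (n : nat) (f g : I -> R) :
  bigO D h n f -> bigO D h n g -> bigO D h n (fun i => f i + g i).
Proof.
intros [K [K0 HK]] [L [L0 HL]]; exists (K + L); split; [lra|].
intros i Hi; eapply Rle_trans; [apply Rabs_triang|].
rewrite Rmult_plus_distr_r; apply Rplus_le_compat; auto.
Qed.

Lemma bigO_opp {I : Type} (D : I -> Prop) (h : I -> R) (n : nat) (f : I -> R) :
  bigO D h n f -> bigO D h n (fun i => - f i).
Proof.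
intros [K [K0 HK]]; exists K; split; [exact K0|].
intros i Hi; rewrite Rabs_Ropp; auto.
Qed.

Lemma bigO_sub {I : Type} (D : I -> Prop) (h : I -> R) (n : nat) (f g : I -> R) :
  bigO D h n f -> bigO D h n g -> bigO D h n (fun i => f i - g i).
Proof. intros Hf Hg; now apply (bigO_add D h n f (fun i => - g i)), bigO_opp. Qed.

Lemma bigO_mul {I : Type} (D : I -> Prop) (h : I -> R) (n m : nat) (f g : I -> R) :
  bigO D h n f -> bigO D h m g -> bigO D h (n + m) (fun i => f i * g i).
Proof.
intros [K [K0 HK]] [L [L0 HL]]; exists (K * L); split; [now apply Rmult_le_pos|].
intros i Hi; rewrite Rabs_mult, pow_add.
replace (K * L * (h i ^ n * h i ^ m)) with ((K * h i ^ n) * (L * h i ^ m)) by ring.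
apply Rmult_le_compat; try apply Rabs_pos; auto.
Qed.

Lemma bigO_const {I : Type} (D : I -> Prop) (h : I -> R) (c : R) :
  bigO D h 0 (fun _ => c).
Proof. exists (Rabs c); split; [apply Rabs_pos|intros; simpl; lra]. Qed.

Lemma bigO_pow {I : Type} (D : I -> Prop) (h : I -> R) (n k : nat) (f : I -> R) :
  bigO D h n f -> bigO D h (k * n) (fun i => f i ^ k).
Proof.
intro Hf; induction k as [|k IH]; simpl; [apply bigO_const|].
now apply (bigO_mul D h n (k * n) f (fun i => f i ^ k)).
Qed.

Lemma bigO_self {I : Type} (D : I -> Prop) (h : I -> R) : small D h -> bigO D h 1 h.
Proof.
intro Hs; exists 1; split; [lra|intros i Hi; destruct (Hs i Hi)].
rewrite Rabs_pos_eq, pow_1 by lra; lra.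
Qed.

Lemma bigO_mul_0 {I : Type} (D : I -> Prop) (h : I -> R) (n : nat) (f g : I -> R) :
  bigO D h 0 f -> bigO D h n g -> bigO D h n (fun i => f i * g i).
Proof. intros; change n with (0 + n)%nat; now apply bigO_mul. Qed.

Lemma bigO_inv {I : Type} (D : I -> Prop) (h : I -> R) (f : I -> R) (c : R) :
  0 < c -> (forall i, D i -> c <= f i) -> bigO D h 0 (fun i => / f i).
Proof.
intros Hc H; exists (/ c); split; [left; now apply Rinv_0_lt_compat|].
intros i Hi; specialize (H i Hi); simpl; rewrite Rmult_1_r, Rabs_inv, Rabs_pos_eq by lra.
now apply Rinv_le_contravar.
Qed.

(** * Taylor expansions *)

Lemma Ck_ext (k : nat) (f g : R -> R) : (forall x, f x = g x) -> Ck k f -> Ck k g.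
Proof.
intros E; destruct k as [|k]; simpl.
- intros H x; now apply continuity_pt_ext with f.
- intros [f' [H1 H2]]; exists f'; split; [|exact H2].
  intro x; apply is_derive_Reals; apply (is_derive_ext f); [exact E|].
  now apply is_derive_Reals.
Qed.

Lemma Ck_derive (k : nat) (f f' : R -> R) :
  Ck (S k) f -> (forall x, is_derive f x (f' x)) -> Ck k f'.
Proof.
intros [h [H1 H2]] H; apply (Ck_ext k h); [|exact H2].
intro x; rewrite <- (is_derive_unique _ _ _ (H x)); symmetry.
apply is_derive_unique, is_derive_Reals, H1.
Qed.

Lemma Ck_weaken (k : nat) : forall f, Ck (S k) f -> Ck k f.
Proof.
induction k as [|k IH]; intros f [f' [H1 H2]].
- apply (derive_continuity f f'); intro x; apply is_derive_Reals, H1.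
- exists f'; split; [exact H1|now apply IH].
Qed.

Lemma Ck_continuity (k : nat) (f : R -> R) : Ck k f -> continuity f.
Proof. induction k as [|k IH]; [auto|]; intro H; now apply IH, Ck_weaken. Qed.

Lemma Ck_antiderive (k : nat) (f f' : R -> R) :
  (forall x, is_derive f x (f' x)) -> Ck k f' -> Ck (S k) f.
Proof. intros H Hk; exists f'; split; [|exact Hk]; intro x; now apply is_derive_Reals. Qed.

Lemma Ck_plus (k : nat) : forall f g, Ck k f -> Ck k g -> Ck k (fun x => f x + g x).
Proof.
induction k as [|k IH]; intros f g Hf Hg; [now apply (continuity_plus f g)|].
destruct Hf as [f' [H1 H2]], Hg as [g' [G1 G2]].
exists (fun x => f' x + g' x); split; [|now apply IH].
intro x; now apply (derivable_pt_lim_plus f g).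
Qed.

Lemma Ck_mult (k : nat) : forall f g, Ck k f -> Ck k g -> Ck k (fun x => f x * g x).
Proof.
induction k as [|k IH]; intros f g Hf Hg; [now apply (continuity_mult f g)|].
assert (Wf := Ck_weaken k f Hf); assert (Wg := Ck_weaken k g Hg).
destruct Hf as [f' [H1 H2]], Hg as [g' [G1 G2]].
exists (fun x => f' x * g x + f x * g' x); split; [|apply Ck_plus; now apply IH].
intro x; now apply (derivable_pt_lim_mult f g).
Qed.

Lemma Ck_const (k : nat) (c : R) : Ck k (fun _ => c).
Proof.
revert c; induction k as [|k IH]; intro c; [apply continuity_const; now intros ? ?|].
exists (fun _ => 0); split; [|apply IH]; intro x; apply derivable_pt_lim_const.
Qed.

Lemma Ck_minus (k : nat) (f g : R -> R) : Ck k f -> Ck k g -> Ck k (fun x => f x - g x).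
Proof.
intros Hf Hg; apply (Ck_ext k (fun x => f x + (-1) * g x)); [intro; ring|].
apply Ck_plus; [exact Hf|]; apply Ck_mult; [apply Ck_const|exact Hg].
Qed.

Lemma is_derive_Rpower (f : R -> R) (p x l : R) : is_derive f x l -> 0 < f x ->
  is_derive (fun t => Rpower (f t) p) x (p * Rpower (f x) (p - 1) * l).
Proof.
intros Hf H0; apply is_derive_Reals.
apply (derivable_pt_lim_comp f (fun y => Rpower y p)).
- now apply is_derive_Reals.
- now apply derivable_pt_lim_power.
Qed.

Lemma Ck_Rpower (k : nat) : forall f p, (forall x, 0 < f x) -> Ck k f ->
  Ck k (fun x => Rpower (f x) p).
Proof.
induction k as [|k IH]; intros f p Hp Hf.
- intro x; apply (continuity_pt_comp f (fun y => Rpower y p)); [apply Hf|].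
  apply derivable_continuous_pt; eexists; now apply derivable_pt_lim_power.
- assert (Wf := Ck_weaken k f Hf); destruct Hf as [f' [H1 H2]].
  apply (Ck_antiderive k _ (fun x => p * Rpower (f x) (p - 1) * f' x)).
  + intro x; apply is_derive_Rpower; [now apply is_derive_Reals|apply Hp].
  + apply Ck_mult; [|exact H2]; apply Ck_mult; [apply Ck_const|now apply IH].
Qed.

Definition derivs (n : nat) (F : nat -> R -> R) : Prop :=
  forall i x, (i < n)%nat -> is_derive (F i) x (F (S i) x).

(** Collects the nested existential witnesses of [Ck] into one sequence, whose values beyond [k]
    carry no meaning. *)
Lemma Ck_derivs (k : nat) : forall f, Ck k f ->
  exists F, F 0%nat = f /\ derivs k F /\ forall i, (i <= k)%nat -> continuity (F i).
Proof.
induction k as [|k IH]; intros f Hf.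
- exists (fun _ => f); split; [reflexivity|split; [intros i x Hi; lia|now intros]].
- assert (Cf := Ck_continuity _ _ Hf).
  destruct Hf as [f' [H1 H2]]; destruct (IH f' H2) as [F [F0 [FD FC]]].
  exists (fun i => match i with O => f | S j => F j end); split; [reflexivity|split].
  + intros [|i] x Hi; [rewrite F0; now apply is_derive_Reals|apply FD; lia].
  + intros [|i] Hi; [exact Cf|apply FC; lia].
Qed.

Definition taylor (n : nat) (F : nat -> R -> R) (s t : R) : R :=
  sumR (S n) (fun i => F i s * (t ^ i / INR (fact i))).

Lemma is_derive_sumR (n : nat) (f : nat -> R -> R) (f' : nat -> R) (x : R) :
  (forall i, (i < n)%nat -> is_derive (f i) x (f' i)) ->
  is_derive (fun t => sumR n (fun i => f i t)) x (sumR n f').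
Proof.
induction n as [|n IH]; intro H.
- apply is_derive_Reals; apply (derivable_pt_lim_const 0).
- rewrite sumR_S; apply is_derive_ext with (fun t => sumR n (fun i => f i t) + f n t).
  + intro t; now rewrite sumR_S.
  + apply (is_derive_add (fun t => sumR n (fun i => f i t))); auto.
Qed.

Lemma is_derive_taylor (n : nat) (F : nat -> R -> R) (s t : R) :
  is_derive (taylor (S n) F s) t (taylor n (fun i => F (S i)) s t).
Proof.
apply is_derive_ext with (fun t => F 0%nat s
   + sumR (S n) (fun i => F (S i) s * (t ^ S i / INR (fact (S i))))).
{ intro u; symmetry; unfold taylor; rewrite (sumR_head (S n)); f_equal.
  simpl; field. }
eapply is_derive_eq.
- apply (is_derive_add (fun _ => F 0%nat s)).
  + derive_const.
  + apply (is_derive_sumR (S n) (fun i t => F (S i) s * (t ^ S i / INR (fact (S i))))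
      (fun i => F (S i) s * (t ^ i / INR (fact i)))).
    intros i _; assert (INR (fact i) <> 0) by apply INR_fact_neq_0.
    assert (INR (fact (S i)) = INR (S i) * INR (fact i)) as -> by (rewrite <- mult_INR; reflexivity).
    assert (INR (S i) <> 0) by (apply not_0_INR; lia).
    eapply is_derive_eq.
    * apply (is_derive_mul (fun _ => F (S i) s)).
      -- derive_const.
      -- apply (is_derive_mul (fun u => u ^ S i) (fun _ => / (INR (S i) * INR (fact i)))).
         ++ apply is_derive_Reals, (derivable_pt_lim_pow t (S i)).
         ++ derive_const.
    * simpl pred; field; split; auto.
- unfold taylor; ring.
Qed.

Lemma taylor_0 (n : nat) (F : nat -> R -> R) (s : R) : taylor n F s 0 = F 0%nat s.
Proof.
unfold taylor; rewrite sumR_head, (sumR_ext _ _ (fun _ => 0)), sumR_const.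
- simpl; field.
- intros i _; rewrite pow_i by lia; unfold Rdiv; ring.
Qed.

(** Induction on the order: the derivative of the remainder in [t] is the remainder of the shifted
    sequence. The interval [[-1,2]] contains [s + t] for increments of either sign. *)
Lemma taylor_bound (M : R) (n : nat) : 0 <= M -> forall F, derivs (S n) F ->
  (forall x, -1 <= x <= 2 -> Rabs (F (S n) x) <= M) ->
  forall s t, 0 <= s <= 1 -> Rabs t <= 1 ->
  Rabs (F 0%nat (s + t) - taylor n F s t) <= M * Rabs t ^ S n.
Proof.
intro M0; induction n as [|n IH]; intros F HF HM s t Hs Ht.
- unfold taylor; rewrite sumR_S; change (sumR 0 ?g) with 0; simpl.
  rewrite Rmult_1_r.
  replace (F 0%nat (s + t) - (0 + F 0%nat s * (1 / 1))) with (F 0%nat (s + t) - F 0%nat s) by field.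
  replace t with (s + t - s) at 2 by ring.
  apply Rabs_le_between in Ht.
  apply (MVT_bound _ (F 1%nat)).
  + intros x _; apply HF; lia.
  + intros x Hx; apply HM; revert Hx; unfold Rmin, Rmax; destruct (Rle_dec s (s + t)); lra.
- set (G := fun u => F 0%nat (s + u) - taylor (S n) F s u).
  assert (G0 : G 0 = 0) by (unfold G; rewrite taylor_0, Rplus_0_r; ring).
  change (Rabs (G t) <= M * Rabs t ^ S (S n)).
  replace (G t) with (G t - G 0) by (rewrite G0; ring).
  replace (M * Rabs t ^ S (S n)) with (M * Rabs t ^ S n * Rabs (t - 0)) by (rewrite Rminus_0_r; simpl; ring).
  apply (MVT_bound G (fun u => F 1%nat (s + u) - taylor n (fun i => F (S i)) s u)).
  + intros u _; apply is_derive_sub; [|apply is_derive_taylor].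
    eapply is_derive_eq; [apply (is_derive_comp (F 0%nat) (fun u => s + u))|].
    * apply HF; lia.
    * auto_derive; auto.
    * unfold scal; simpl; unfold mult; simpl; ring.
  + intros u Hu.
    assert (Hut : Rabs u <= Rabs t).
    { revert Hu; unfold Rmin, Rmax; destruct (Rle_dec 0 t); unfold Rabs;
      destruct (Rcase_abs u), (Rcase_abs t); lra. }
    eapply Rle_trans.
    * apply (IH (fun i => F (S i))); auto; [intros i x Hi; apply HF; lia|lra].
    * apply Rmult_le_compat_l; [exact M0|apply pow_incr; split; [apply Rabs_pos|exact Hut]].
Qed.

(** * Local geometry of the boundary *)

(** Restricted to [[0,1]], where every C^1 function qualifies by compactness; the coefficients
    produced by Taylor expansion are then covered without proving them periodic. *)
Definition lip01 (f : R -> R) : Prop :=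
  exists L, 0 <= L /\ forall s t, 0 <= s <= 1 -> 0 <= t <= 1 ->
    Rabs (f s - f t) <= L * Rabs (s - t).

Lemma lip01_bounded (f : R -> R) : lip01 f ->
  exists B, 0 <= B /\ forall s, 0 <= s <= 1 -> Rabs (f s) <= B.
Proof.
intros [L [L0 HL]]; exists (Rabs (f 0) + L); split; [pose proof (Rabs_pos (f 0)); lra|].
intros s Hs; specialize (HL s 0 Hs ltac:(lra)).
rewrite Rminus_0_r, (Rabs_pos_eq s) in HL by lra.
replace (f s) with (f 0 + (f s - f 0)) by ring.
eapply Rle_trans; [apply Rabs_triang|]; nra.
Qed.

Lemma lip01_derive (f f' : R -> R) :
  (forall x, is_derive f x (f' x)) -> continuity f' -> lip01 f.
Proof.
intros H Hc; destruct (continuity_bounded f' 0 1 Hc) as [M [M0 HM]].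
exists M; split; [exact M0|intros s t Hs Ht].
apply (MVT_bound f f'); [auto|intros x Hx; apply HM].
revert Hx; unfold Rmin, Rmax; destruct (Rle_dec t s); lra.
Qed.

Lemma lip01_const (c : R) : lip01 (fun _ => c).
Proof.
exists 0; split; [lra|intros; rewrite Rminus_diag, Rabs_R0; lra].
Qed.

Lemma lip01_add (f g : R -> R) : lip01 f -> lip01 g -> lip01 (fun s => f s + g s).
Proof.
intros [L [L0 HL]] [M [M0 HM]]; exists (L + M); split; [lra|intros s t Hs Ht].
replace (f s + g s - (f t + g t)) with ((f s - f t) + (g s - g t)) by ring.
eapply Rle_trans; [apply Rabs_triang|].
rewrite Rmult_plus_distr_r; apply Rplus_le_compat; auto.
Qed.

Lemma lip01_mul (f g : R -> R) : lip01 f -> lip01 g -> lip01 (fun s => f s * g s).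
Proof.
intros Hf Hg; destruct (lip01_bounded f Hf) as [A [A0 HA]], (lip01_bounded g Hg) as [B [B0 HB]].
destruct Hf as [L [L0 HL]], Hg as [M [M0 HM]].
exists (L * B + A * M); split; [apply Rplus_le_le_0_compat; now apply Rmult_le_pos|].
intros s t Hs Ht.
replace (f s * g s - f t * g t) with ((f s - f t) * g s + f t * (g s - g t)) by ring.
eapply Rle_trans; [apply Rabs_triang|]; rewrite !Rabs_mult.
replace ((L * B + A * M) * Rabs (s - t))
  with (L * Rabs (s - t) * B + A * (M * Rabs (s - t))) by ring.
apply Rplus_le_compat; apply Rmult_le_compat; try apply Rabs_pos; auto.
Qed.

Lemma lip01_scal (c : R) (f : R -> R) : lip01 f -> lip01 (fun s => c * f s).
Proof. intro H; apply lip01_mul; [apply lip01_const|exact H]. Qed.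

Lemma lip01_sub (f g : R -> R) : lip01 f -> lip01 g -> lip01 (fun s => f s - g s).
Proof.
intros [L [L0 HL]] [M [M0 HM]]; exists (L + M); split; [lra|intros s t Hs Ht].
replace (f s - g s - (f t - g t)) with ((f s - f t) + - (g s - g t)) by ring.
eapply Rle_trans; [apply Rabs_triang|]; rewrite Rabs_Ropp.
rewrite Rmult_plus_distr_r; apply Rplus_le_compat; auto.
Qed.

Lemma lip01_inv (f : R -> R) (c : R) : 0 < c -> (forall s, 0 <= s <= 1 -> c <= f s) ->
  lip01 f -> lip01 (fun s => / f s).
Proof.
intros Hc Hf [L [L0 HL]].
assert (Ic : 0 < / c) by now apply Rinv_0_lt_compat.
exists (/ c * (L * / c)); split; [apply Rmult_le_pos; [lra|apply Rmult_le_pos; lra]|].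
intros s t Hs Ht; assert (F1 := Hf s Hs); assert (F2 := Hf t Ht).
replace (/ f s - / f t) with (/ f s * ((f t - f s) * / f t)) by (field; lra).
rewrite !Rabs_mult, !Rabs_inv, (Rabs_pos_eq (f s)), (Rabs_pos_eq (f t)), Rabs_minus_sym by lra.
replace (/ c * (L * / c) * Rabs (s - t)) with (/ c * ((L * Rabs (s - t)) * / c)) by ring.
apply Rmult_le_compat.
- inv_nonneg.
- apply Rmult_le_pos; [apply Rabs_pos|inv_nonneg].
- apply Rinv_le_contravar; lra.
- apply Rmult_le_compat; [apply Rabs_pos|inv_nonneg|now apply HL|].
  apply Rinv_le_contravar; lra.
Qed.

Lemma taylor_4 (F : nat -> R -> R) (s t : R) : taylor 4 F s t
  = F 0%nat s + F 1%nat s * t + F 2%nat s / 2 * t ^ 2 + F 3%nat s / 6 * t ^ 3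
    + F 4%nat s / 24 * t ^ 4.
Proof. unfold taylor, sumR; simpl; field. Qed.

Lemma taylor_5 (F : nat -> R -> R) (s t : R) : taylor 5 F s t
  = F 0%nat s + F 1%nat s * t + F 2%nat s / 2 * t ^ 2 + F 3%nat s / 6 * t ^ 3
    + F 4%nat s / 24 * t ^ 4 + F 5%nat s / 120 * t ^ 5.
Proof. unfold taylor, sumR; simpl; field. Qed.

(* Pairs of a base point in [0,1] and a signed increment. *)
Definition near_pair (r : R) (p : R * R) : Prop := 0 <= fst p <= 1 /\ 0 < Rabs (snd p) <= r.
Definition incr (p : R * R) : R := Rabs (snd p).

Lemma near_pair_small (r : R) : r <= 1 -> small (near_pair r) incr.
Proof. intros Hr [s t] [H1 H2]; unfold incr; simpl in *; lra. Qed.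

Lemma bigO_base (r : R) (f : R -> R) : lip01 f -> bigO (near_pair r) incr 0 (fun p => f (fst p)).
Proof.
intro H; destruct (lip01_bounded f H) as [B [B0 HB]]; exists B; split; [exact B0|].
intros [s t] [H1 _]; simpl in *; rewrite Rmult_1_r; auto.
Qed.

Lemma bigO_incr (r : R) (n : nat) : bigO (near_pair r) incr n (fun p => snd p ^ n).
Proof.
exists 1; split; [lra|]; intros [s t] _; unfold incr; simpl.
rewrite <- RPow_abs; lra.
Qed.

Lemma bigO_taylor (n : nat) (F : nat -> R -> R) : derivs (S n) F -> continuity (F (S n)) ->
  bigO (near_pair 1) incr (S n) (fun p => F 0%nat (fst p + snd p) - taylor n F (fst p) (snd p)).
Proof.
intros HD HC; destruct (continuity_bounded _ (-1) 2 HC) as [M [M0 HM]].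
exists M; split; [exact M0|]; intros [s t] [H1 H2]; unfold incr; simpl fst in *; simpl snd in *.
now apply taylor_bound.
Qed.

Definition curv (d1 d2 e1 e2 : R -> R) (s : R) : R := d1 s * e2 s - d2 s * e1 s.

(** Together with the next definition: coordinates of the chord in the moving frame at [s], along
    the tangent and along the inner normal. *)
Definition tangent_part (g1 g2 d1 d2 : R -> R) (s s' : R) : R :=
  d1 s * (g1 s' - g1 s) + d2 s * (g2 s' - g2 s).
Definition normal_part (g1 g2 d1 d2 : R -> R) (s s' : R) : R :=
  d1 s * (g2 s' - g2 s) - d2 s * (g1 s' - g1 s).

(* [Y / X] is the tangent of the angle between the chord and the boundary and [D] the
   Lazutkin increment; the choice of the Lazutkin coordinate is what makes
   [m Y - D X] of order four. *)
Lemma curve_local_expansion (g1 g2 d1 d2 e1 e2 xt : R -> R) (C : R) :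
  sym_domain 8 g1 g2 d1 d2 e1 e2 ->
  let k := curv d1 d2 e1 e2 in
  (forall s, is_derive xt s (C * Rpower (k s) (2 / 3))) ->
  let m := fun s => 2 * C * Rpower (k s) (- (1 / 3)) in
  let D1 := fun s => C * Rpower (k s) (2 / 3) in
  let X := fun p => tangent_part g1 g2 d1 d2 (fst p) (fst p + snd p) in
  let Y := fun p => normal_part g1 g2 d1 d2 (fst p) (fst p + snd p) in
  let D := fun p => xt (fst p + snd p) - xt (fst p) in
  lip01 k /\ lip01 m /\ lip01 D1 /\ exists D2 z4 z5, lip01 D2 /\ lip01 z4 /\ lip01 z5 /\
  bigO (near_pair 1) incr 4 (fun p => X p - (snd p - k (fst p) ^ 2 / 6 * snd p ^ 3)) /\
  bigO (near_pair 1) incr 3 (fun p => Y p - k (fst p) / 2 * snd p ^ 2) /\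
  bigO (near_pair 1) incr 3 (fun p => D p - (D1 (fst p) * snd p + D2 (fst p) * snd p ^ 2)) /\
  bigO (near_pair 1) incr 6
    (fun p => m (fst p) * Y p - D p * X p
              - (z4 (fst p) * snd p ^ 4 + z5 (fst p) * snd p ^ 5)).
Proof.
intros (Cg1 & Cg2 & Hd1 & Hd2 & He1 & He2 & _ & _ & Hu & _ & Hk & _).
intros k Hxt m D1 X Y D.
assert (Hd1' : forall s, is_derive g1 s (d1 s)) by (intro; now apply is_derive_Reals).
assert (Hd2' : forall s, is_derive g2 s (d2 s)) by (intro; now apply is_derive_Reals).
assert (He1' : forall s, is_derive d1 s (e1 s)) by (intro; now apply is_derive_Reals).
assert (He2' : forall s, is_derive d2 s (e2 s)) by (intro; now apply is_derive_Reals).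
assert (Cd1 : Ck 8 d1) by exact (Ck_derive 8 g1 d1 Cg1 Hd1').
assert (Cd2 : Ck 8 d2) by exact (Ck_derive 8 g2 d2 Cg2 Hd2').
assert (Ce1 : Ck 7 e1) by exact (Ck_derive 7 d1 e1 Cd1 He1').
assert (Ce2 : Ck 7 e2) by exact (Ck_derive 7 d2 e2 Cd2 He2').
assert (Cdk : Ck 7 k).
{ apply Ck_minus; apply Ck_mult; auto; now apply Ck_weaken. }
assert (CD1 : Ck 7 D1) by (apply Ck_mult; [apply Ck_const|now apply Ck_Rpower]).
assert (Cm : Ck 7 m) by (apply Ck_mult; [apply Ck_const|now apply Ck_Rpower]).
assert (L1 : forall f, Ck 7 f -> lip01 f).
{ intros f Hf; assert (Hf' := Hf); destruct Hf as [f' [F1 F2]]; apply (lip01_derive f f').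
  - intro x; apply is_derive_Reals, F1.
  - now apply Ck_continuity with 6%nat. }
destruct (Ck_derivs 9 g1 Cg1) as [A [A0 [AD AC]]].
destruct (Ck_derivs 9 g2 Cg2) as [B [B0 [BD BC]]].
destruct (Ck_derivs 8 xt) as [G [G0 [GD GC]]]; [now apply (Ck_antiderive 7 xt D1)|].
assert (A1 : forall s, A 1%nat s = d1 s).
{ intro s; rewrite <- (is_derive_unique _ _ _ (Hd1' s)); symmetry.
  rewrite <- A0; apply is_derive_unique, AD; lia. }
assert (B1 : forall s, B 1%nat s = d2 s).
{ intro s; rewrite <- (is_derive_unique _ _ _ (Hd2' s)); symmetry.
  rewrite <- B0; apply is_derive_unique, BD; lia. }
assert (A2 : forall s, A 2%nat s = e1 s).
{ intro s; rewrite <- (is_derive_unique _ _ _ (He1' s)); symmetry.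
  rewrite <- (Derive_ext _ _ _ A1); apply is_derive_unique, AD; lia. }
assert (B2 : forall s, B 2%nat s = e2 s).
{ intro s; rewrite <- (is_derive_unique _ _ _ (He2' s)); symmetry.
  rewrite <- (Derive_ext _ _ _ B1); apply is_derive_unique, BD; lia. }
assert (A3 : forall s, is_derive e1 s (A 3%nat s)).
{ intro s; apply (is_derive_ext (A 2%nat)); [exact A2|apply AD; lia]. }
assert (B3 : forall s, is_derive e2 s (B 3%nat s)).
{ intro s; apply (is_derive_ext (B 2%nat)); [exact B2|apply BD; lia]. }
assert (G1 : forall s, G 1%nat s = D1 s).
{ intro s; unfold D1; rewrite <- (is_derive_unique _ _ _ (Hxt s)); symmetry.
  rewrite <- G0; apply is_derive_unique, GD; lia. }
set (k' := fun s => d1 s * B 3%nat s - d2 s * A 3%nat s).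
assert (Dk : forall s, is_derive k s (k' s)).
{ intro s; eapply is_derive_eq.
  - apply (is_derive_sub (fun s => d1 s * e2 s) (fun s => d2 s * e1 s)); apply is_derive_mul; eauto.
  - unfold k'; ring. }
assert (G2 : forall s, G 2%nat s = 2 / 3 * C * Rpower (k s) (- (1 / 3)) * k' s).
{ intro s; transitivity (Derive D1 s).
  - symmetry; rewrite <- (Derive_ext _ _ _ G1); apply is_derive_unique, GD; lia.
  - apply is_derive_unique; eapply is_derive_eq.
    + apply (is_derive_mul (fun _ => C)).
      * derive_const.
      * apply is_derive_Rpower; [apply Dk|apply Hk].
    + replace (2 / 3 - 1) with (- (1 / 3)) by field; ring. }
assert (Eu : forall s, d1 s * e1 s + d2 s * e2 s = 0).
{ intro s.
  assert (Z : is_derive (fun s => d1 s * d1 s + d2 s * d2 s) s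
      ((e1 s * d1 s + d1 s * e1 s) + (e2 s * d2 s + d2 s * e2 s))).
  { apply is_derive_add; apply is_derive_mul; auto. }
  apply is_derive_unique in Z.
  rewrite (Derive_ext _ (fun _ => 1)) in Z by (intro t; rewrite <- (Hu t); ring).
  rewrite Derive_const in Z; lra. }
(* Differentiating [|gamma'|^2 = 1] twice gives [gamma' . gamma''' = - k^2], hence the cubic
   coefficient of [X]. *)
assert (E3 : forall s, d1 s * A 3%nat s + d2 s * B 3%nat s = - k s ^ 2).
{ intro s.
  assert (Z : is_derive (fun s => d1 s * e1 s + d2 s * e2 s) s
      ((e1 s * e1 s + d1 s * A 3%nat s) + (e2 s * e2 s + d2 s * B 3%nat s))).
  { apply is_derive_add; apply is_derive_mul; auto. }
  apply is_derive_unique in Z.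
  rewrite (Derive_ext _ (fun _ => 0)) in Z by exact Eu.
  rewrite Derive_const in Z.
  assert (k s ^ 2 = e1 s * e1 s + e2 s * e2 s); [|lra].
  unfold k, curv; pose proof (Eu s) as Z1; pose proof (Hu s) as Z2.
  transitivity ((d1 s ^ 2 + d2 s ^ 2) * (e1 s * e1 s + e2 s * e2 s)
                - (d1 s * e1 s + d2 s * e2 s) ^ 2); [ring|rewrite Z1, Z2; ring]. }
assert (LA : forall i, (i <= 6)%nat -> lip01 (A i)).
{ intros i Hi; apply (lip01_derive _ (A (S i))); [intro; apply AD; lia|apply AC; lia]. }
assert (LB : forall i, (i <= 6)%nat -> lip01 (B i)).
{ intros i Hi; apply (lip01_derive _ (B (S i))); [intro; apply BD; lia|apply BC; lia]. }
assert (LG : forall i, (i <= 6)%nat -> lip01 (G i)).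
{ intros i Hi; apply (lip01_derive _ (G (S i))); [intro; apply GD; lia|apply GC; lia]. }
assert (Ld1 : lip01 d1) by (apply L1, Ck_weaken, Cd1).
assert (Ld2 : lip01 d2) by (apply L1, Ck_weaken, Cd2).
assert (Lk := L1 k Cdk); assert (LD1 := L1 D1 CD1); assert (Lm := L1 m Cm).
assert (Lc : forall (a : R) f, lip01 f -> lip01 (fun s => f s / a)).
{ intros a f H; apply lip01_mul; [exact H|apply lip01_const]. }
set (X3 := fun s => - (k s ^ 2) / 6).
set (X4 := fun s => (d1 s * A 4%nat s + d2 s * B 4%nat s) / 24).
set (Y4 := fun s => (d1 s * B 4%nat s - d2 s * A 4%nat s) / 24).
set (Y5 := fun s => (d1 s * B 5%nat s - d2 s * A 5%nat s) / 120).
set (D2 := fun s => G 2%nat s / 2).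
set (D3 := fun s => G 3%nat s / 6).
set (D4 := fun s => G 4%nat s / 24).
assert (LX3 : lip01 X3).
{ apply lip01_mul; [|apply lip01_const].
  destruct (lip01_sub _ _ (lip01_const 0) (lip01_mul _ _ Lk Lk)) as [L [L0 HL]].
  exists L; split; [exact L0|]; intros s t Hs Ht.
  replace (- k s ^ 2 - - k t ^ 2) with (0 - k s * k s - (0 - k t * k t)) by ring; auto. }
assert (LX4 : lip01 X4).
{ apply lip01_mul; [|apply lip01_const].
  apply lip01_add; apply lip01_mul; auto; (apply LA || apply LB); lia. }
assert (LY4 : lip01 Y4).
{ apply lip01_mul; [|apply lip01_const].
  apply lip01_sub; apply lip01_mul; auto; (apply LA || apply LB); lia. }
assert (LY5 : lip01 Y5).
{ apply lip01_mul; [|apply lip01_const].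
  apply lip01_sub; apply lip01_mul; auto; (apply LA || apply LB); lia. }
assert (LD2 : lip01 D2) by (apply Lc, LG; lia).
assert (LD3 : lip01 D3) by (apply Lc, LG; lia).
assert (LD4 : lip01 D4) by (apply Lc, LG; lia).
assert (Lk' : lip01 k').
{ apply lip01_sub; apply lip01_mul; auto; (apply LA || apply LB); lia. }
(* Coefficients of [t^4] and [t^5] in [m Y - D X], read off from the product of the expansions. *)
set (z4 := fun s => m s * Y4 s - D3 s - D1 s * X3 s).
set (z5 := fun s => m s * Y5 s - D4 s - D1 s * X4 s - D2 s * X3 s).
set (Dom := near_pair 1); assert (Sm : small Dom incr) by (apply near_pair_small; lra).
assert (O : forall (f : R -> R) n, lip01 f -> bigO Dom incr n (fun p => f (fst p) * snd p ^ n)).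
{ intros f n Hf; apply bigO_mul_0; [now apply bigO_base|apply bigO_incr]. }
assert (TA4 := bigO_taylor 4 A ltac:(intros i x Hi; apply AD; lia) ltac:(apply AC; lia)).
assert (TB4 := bigO_taylor 4 B ltac:(intros i x Hi; apply BD; lia) ltac:(apply BC; lia)).
assert (TA5 := bigO_taylor 5 A ltac:(intros i x Hi; apply AD; lia) ltac:(apply AC; lia)).
assert (TB5 := bigO_taylor 5 B ltac:(intros i x Hi; apply BD; lia) ltac:(apply BC; lia)).
assert (TG := bigO_taylor 4 G ltac:(intros i x Hi; apply GD; lia) ltac:(apply GC; lia)).
fold Dom in TA4, TB4, TA5, TB5, TG.
assert (HX : bigO Dom incr 5
  (fun p => X p - (snd p + X3 (fst p) * snd p ^ 3 + X4 (fst p) * snd p ^ 4))).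
{ eapply bigO_ext; [apply bigO_add; (apply bigO_mul_0; [apply bigO_base|])|].
  - exact Ld1.
  - exact TA4.
  - exact Ld2.
  - exact TB4.
  - intros [s t] _; simpl fst; simpl snd; cbv beta; rewrite !taylor_4, A0, B0, A1, B1, A2, B2.
    unfold X, tangent_part; simpl fst; simpl snd.
    pose proof (Hu s) as Z1; pose proof (Eu s) as Z2; pose proof (E3 s) as Z3.
    unfold X3, X4; replace (- k s ^ 2) with (d1 s * A 3%nat s + d2 s * B 3%nat s).
    replace t with ((d1 s ^ 2 + d2 s ^ 2) * t) at 3 by (rewrite Z1; ring).
    assert (Z4 : (d1 s * e1 s + d2 s * e2 s) / 2 * t ^ 2 = 0) by (rewrite Z2; field).
    apply Rminus_diag_uniq; rewrite <- Z4; field. }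
assert (HY : bigO Dom incr 6
  (fun p => Y p - (k (fst p) / 2 * snd p ^ 2 + k' (fst p) / 6 * snd p ^ 3
                   + Y4 (fst p) * snd p ^ 4 + Y5 (fst p) * snd p ^ 5))).
{ eapply bigO_ext; [apply bigO_sub; (apply bigO_mul_0; [apply bigO_base|])|].
  - exact Ld1.
  - exact TB5.
  - exact Ld2.
  - exact TA5.
  - intros [s t] _; simpl fst; simpl snd; cbv beta; rewrite !taylor_5, A0, B0, A1, B1, A2, B2.
    unfold Y, normal_part; simpl fst; simpl snd; unfold Y4, Y5, k', k, curv; field. }
assert (HD : bigO Dom incr 5
  (fun p => D p - (D1 (fst p) * snd p + D2 (fst p) * snd p ^ 2 + D3 (fst p) * snd p ^ 3
                   + D4 (fst p) * snd p ^ 4))).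
{ eapply bigO_ext; [exact TG|].
  intros [s t] _; simpl fst; simpl snd; cbv beta; rewrite taylor_4, G0, G1.
  unfold D, D2, D3, D4; simpl fst; simpl snd; field. }
clear TA4 TB4 TA5 TB5 TG.
repeat (split; [assumption|]).
exists D2, z4, z5; split; [exact LD2|].
split; [exact (lip01_sub _ _ (lip01_sub _ _ (lip01_mul _ _ Lm LY4) LD3) (lip01_mul _ _ LD1 LX3))|].
split; [exact (lip01_sub _ _ (lip01_sub _ _ (lip01_sub _ _ (lip01_mul _ _ Lm LY5) LD4)
  (lip01_mul _ _ LD1 LX4)) (lip01_mul _ _ LD2 LX3))|].
split.
{ eapply bigO_ext; [apply bigO_add; [eapply (bigO_le _ _ 4 5); [exact Sm|exact HX|lia]|exact (O X4 4%nat LX4)]|].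
  intros [s t] _; unfold X3; simpl fst; simpl snd; field. }
split.
{ eapply bigO_ext; [apply bigO_add; [apply bigO_add; [apply bigO_add|]|]|].
  - eapply (bigO_le _ _ 3 6); [exact Sm|exact HY|lia].
  - exact (O (fun s => k' s / 6) 3%nat (lip01_mul _ _ Lk' (lip01_const _))).
  - eapply (bigO_le _ _ 3 4); [exact Sm|exact (O Y4 4%nat LY4)|lia].
  - eapply (bigO_le _ _ 3 5); [exact Sm|exact (O Y5 5%nat LY5)|lia].
  - intros [s t] _; simpl fst; simpl snd; field. }
split.
{ eapply bigO_ext; [apply bigO_add; [apply bigO_add|]|].
  - eapply (bigO_le _ _ 3 5); [exact Sm|exact HD|lia].
  - exact (O D3 3%nat LD3).
  - eapply (bigO_le _ _ 3 4); [exact Sm|exact (O D4 4%nat LD4)|lia].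
  - intros [s t] _; simpl fst; simpl snd; field. }
assert (OX : bigO Dom incr 1 X).
{ eapply bigO_ext; [apply bigO_add; [apply bigO_add; [apply bigO_add|]|]|].
  - eapply (bigO_le _ _ 1 5); [exact Sm|exact HX|lia].
  - eapply (bigO_le _ _ 1 4); [exact Sm|exact (O X4 4%nat LX4)|lia].
  - eapply (bigO_le _ _ 1 3); [exact Sm|exact (O X3 3%nat LX3)|lia].
  - exact (bigO_incr 1 1).
  - intros [s t] _; simpl fst; simpl snd; ring. }
set (Dp := fun p => D1 (fst p) * snd p ^ 1 + D2 (fst p) * snd p ^ 2 + D3 (fst p) * snd p ^ 3
                   + D4 (fst p) * snd p ^ 4).
assert (ODp : bigO Dom incr 1 Dp).
{ apply bigO_add; [apply bigO_add; [apply bigO_add|]|].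
  - exact (O D1 1%nat LD1).
  - eapply (bigO_le _ _ 1 2); [exact Sm|exact (O D2 2%nat LD2)|lia].
  - eapply (bigO_le _ _ 1 3); [exact Sm|exact (O D3 3%nat LD3)|lia].
  - eapply (bigO_le _ _ 1 4); [exact Sm|exact (O D4 4%nat LD4)|lia]. }
eapply bigO_ext;
  [apply bigO_sub; [apply bigO_sub; [apply bigO_sub|]|apply bigO_add; [apply bigO_add|]]|].
- exact (bigO_mul_0 _ _ _ _ _ (bigO_base 1 m Lm) HY).
- exact (bigO_mul _ _ 5 1 _ _ HD OX).
- exact (bigO_mul _ _ 1 5 _ _ ODp HX).
- exact (O (fun s => D2 s * X4 s + D3 s * X3 s) 6%nat
    (lip01_add _ _ (lip01_mul _ _ LD2 LX4) (lip01_mul _ _ LD3 LX3))).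
- eapply (bigO_le _ _ 6 7); [exact Sm| |lia].
  exact (O (fun s => D3 s * X4 s + D4 s * X3 s) 7%nat
    (lip01_add _ _ (lip01_mul _ _ LD3 LX4) (lip01_mul _ _ LD4 LX3))).
- eapply (bigO_le _ _ 6 8); [exact Sm| |lia].
  exact (O (fun s => D4 s * X4 s) 8%nat (lip01_mul _ _ LD4 LX4)).
- intros [s t] _; simpl fst; simpl snd; unfold Dp; simpl fst; simpl snd.
  (* Orders two and three cancel. Once [m = 2 D1 / k], the second cancellation says
     [D1' / D1 = (2/3) k' / k], so [D1] has to be proportional to [k^(2/3)]: this singles out the
     Lazutkin coordinate. *)
  assert (Q1 : m s * k s / 2 = D1 s).
  { unfold m, D1; replace (2 / 3) with (- (1 / 3) + 1) by field.
    rewrite Rpower_plus, Rpower_1 by apply Hk; field. }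
  assert (Q2 : m s * k' s / 6 = D2 s) by (unfold D2; rewrite G2; unfold m; field).
  apply Rminus_diag_uniq.
  transitivity ((m s * k s / 2 - D1 s) * t ^ 2 + (m s * k' s / 6 - D2 s) * t ^ 3).
  + unfold z4, z5; field.
  + rewrite Q1, Q2; ring.
Qed.

Lemma positive_lower_bound (f : R -> R) : continuity f -> (forall x, 0 < f x) ->
  exists c, 0 < c /\ forall s, 0 <= s <= 1 -> c <= f s.
Proof.
intros Cf Hf; destruct (continuity_ab_min f 0 1) as [a [H1 H2]]; [lra|intros; apply Cf|].
exists (f a); split; auto.
Qed.

Lemma near_pair_mono (r r' : R) (p : R * R) : r <= r' -> near_pair r p -> near_pair r' p.
Proof. intros H [H1 H2]; split; [exact H1|lra]. Qed.

(** Dividing by [X], which is comparable to the increment [t], costs one order. Before that,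
    [z4 t^4 + z5 t^5] is rewritten as [(z4 t^3 + z5 t^4) X], an error of order 6 because [X - t] is
    of order 3. The bound [t^2 / 2 <= X t] also says that [X] has the sign of [t]. *)
Lemma angle_ratio_expansion (X Y D : R * R -> R) (k m z4 z5 : R -> R) (k0 : R) :
  0 < k0 -> (forall s, 0 <= s <= 1 -> k0 <= k s) -> lip01 k -> lip01 m -> lip01 z4 -> lip01 z5 ->
  bigO (near_pair 1) incr 4 (fun p => X p - (snd p - k (fst p) ^ 2 / 6 * snd p ^ 3)) ->
  bigO (near_pair 1) incr 3 (fun p => Y p - k (fst p) / 2 * snd p ^ 2) ->
  bigO (near_pair 1) incr 6
    (fun p => m (fst p) * Y p - D p * X p
              - (z4 (fst p) * snd p ^ 4 + z5 (fst p) * snd p ^ 5)) ->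
  exists r c, 0 < r <= 1 /\ 0 < c /\
  (forall p, near_pair r p -> 0 < Y p /\ snd p ^ 2 / 2 <= X p * snd p /\
      X p ^ 2 + Y p ^ 2 <= snd p ^ 2 - c * snd p ^ 4) /\
  bigO (near_pair r) incr 3 (fun p => X p - snd p) /\
  bigO (near_pair r) incr 5 (fun p => m (fst p) * Y p / X p - D p
              - (z4 (fst p) * snd p ^ 3 + z5 (fst p) * snd p ^ 4)).
Proof.
intros k00 Hk0 Lk Lm L4 L5 HX HY HZ.
assert (Sm : small (near_pair 1) incr) by (apply near_pair_small; lra).
destruct (lip01_bounded k Lk) as [kM [kM0 HkM]].
set (Xr := fun p => X p - (snd p - k (fst p) ^ 2 / 6 * snd p ^ 3)) in *.
set (Yr := fun p => Y p - k (fst p) / 2 * snd p ^ 2) in *.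
assert (HX3 : bigO (near_pair 1) incr 3 (fun p => X p - snd p)).
{ eapply bigO_ext; [apply bigO_sub|].
  - eapply (bigO_le _ _ 3 4); [exact Sm|exact HX|lia].
  - exact (bigO_mul_0 _ _ 3 _ _
      (bigO_base 1 _ (lip01_mul _ _ (lip01_mul _ _ Lk Lk) (lip01_const (/ 6)))) (bigO_incr 1 3)).
  - intros p _; unfold Xr; cbv beta; field. }
assert (HL : bigO (near_pair 1) incr 5
  (fun p => X p ^ 2 + Y p ^ 2 - (snd p ^ 2 - k (fst p) ^ 2 / 12 * snd p ^ 4))).
{ assert (Ok2 : bigO (near_pair 1) incr 0 (fun p => k (fst p) * k (fst p)))
    by exact (bigO_base 1 _ (lip01_mul _ _ Lk Lk)).
  assert (OX : bigO (near_pair 1) incr 1 (fun p => X p + (snd p - k (fst p) ^ 2 / 6 * snd p ^ 3))).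
  { eapply bigO_ext; [apply bigO_add; [|apply bigO_sub]|].
    - eapply (bigO_le _ _ 1 3); [exact Sm|exact HX3|lia].
    - exact (bigO_mul_0 _ _ 1 _ _ (bigO_const _ _ 2) (bigO_incr 1 1)).
    - eapply (bigO_le _ _ 1 3); [exact Sm| |lia].
      exact (bigO_mul_0 _ _ 3 _ _ (bigO_mul_0 _ _ 0 _ _ (bigO_const _ _ (/ 6)) Ok2) (bigO_incr 1 3)).
    - intros p _; cbv beta; field. }
  assert (OY : bigO (near_pair 1) incr 2 (fun p => Y p + k (fst p) / 2 * snd p ^ 2)).
  { eapply bigO_ext; [apply bigO_add|].
    - eapply (bigO_le _ _ 2 3); [exact Sm|exact HY|lia].
    - exact (bigO_mul_0 _ _ 2 _ _ (bigO_base 1 k Lk) (bigO_incr 1 2)).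
    - intros p _; unfold Yr; cbv beta; field. }
  eapply bigO_ext; [apply bigO_add; [apply bigO_add|]|].
  - exact (bigO_mul _ _ 4 1 _ _ HX OX).
  - exact (bigO_mul _ _ 3 2 _ _ HY OY).
  - eapply (bigO_le _ _ 5 6); [exact Sm| |lia].
    exact (bigO_mul_0 _ _ 6 _ _ (bigO_mul_0 _ _ 0 _ _ (bigO_const _ _ (/ 36))
      (bigO_mul_0 _ _ 0 _ _ Ok2 Ok2)) (bigO_incr 1 6)).
  - intros p _; unfold Xr, Yr; cbv beta; field. }
destruct HX3 as [K3 [K30 HK3]].
destruct HY as [KY [KY0 HKY]].
destruct HL as [KL [KL0 HKL]].
(* In the squared chord length, [-k^2/3] from [X^2] and [k^2/4] from [Y^2] leave [-k^2/12]; half of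
   its least size is kept and the other half absorbs the error of order 5. *)
set (c := k0 ^ 2 / 24).
assert (c0 : 0 < c) by (unfold c; nra).
(* Three errors have to be dominated: that of [X] by [t/2], that of [Y] by half of [k0 t^2 / 2],
   that of the squared chord by [c t^4]. *)
set (r := Rmin (Rmin 1 (/ (2 * (K3 + 1)))) (Rmin (k0 / (4 * (KY + 1))) (c / (KL + 1)))).
assert (P1 : 0 < / (2 * (K3 + 1))) by (inv_pos).
assert (P2 : 0 < k0 / (4 * (KY + 1))) by (apply Rdiv_lt_0_compat; lra).
assert (P3 : 0 < c / (KL + 1)) by (apply Rdiv_lt_0_compat; lra).
assert (r1 : r <= 1) by (unfold r; eapply Rle_trans; [apply Rmin_l|apply Rmin_l]).
assert (r2 : r <= / (2 * (K3 + 1))) by (unfold r; eapply Rle_trans; [apply Rmin_l|apply Rmin_r]).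
assert (r3 : r <= k0 / (4 * (KY + 1))) by (unfold r; eapply Rle_trans; [apply Rmin_r|apply Rmin_l]).
assert (r4 : r <= c / (KL + 1)) by (unfold r; eapply Rle_trans; [apply Rmin_r|apply Rmin_r]).
assert (r0 : 0 < r) by (unfold r; repeat apply Rmin_glb_lt; lra).
assert (B : forall p, near_pair r p ->
   K3 * Rabs (snd p) <= 1 / 2 /\ KY * Rabs (snd p) <= k0 / 4 /\ KL * Rabs (snd p) <= c).
{ intros p [_ Hp].
  assert (A : forall K b, 0 <= K -> 0 <= b -> r <= b / (K + 1) -> K * Rabs (snd p) <= b).
  { intros K b HK Hb Hr; apply Rle_trans with (K * (b / (K + 1))).
    - apply Rmult_le_compat_l; lra.
    - replace b with ((K + 1) * (b / (K + 1))) at 2 by (field; lra).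
      apply Rmult_le_compat_r; [|lra]; apply Rmult_le_pos; [lra|inv_nonneg]. }
  repeat split; apply A; try lra.
  - replace (1 / 2 / (K3 + 1)) with (/ (2 * (K3 + 1))) by (field; lra); lra.
  - replace (k0 / 4 / (KY + 1)) with (k0 / (4 * (KY + 1))) by (field; lra); lra. }
assert (Xs : forall p, near_pair r p -> snd p ^ 2 / 2 <= X p * snd p).
{ intros p Hp; assert (H1 := HK3 p (near_pair_mono r 1 p r1 Hp)).
  destruct (B p Hp) as [B1 _]; destruct Hp as [_ Hp]; unfold incr in H1.
  set (a := Rabs (snd p)) in *.
  assert (a2 : snd p ^ 2 = a * a) by (unfold a; rewrite <- Rabs_mult, Rabs_pos_eq; nra).
  assert (H2 : Rabs ((X p - snd p) * snd p) <= a * a / 2).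
  { rewrite Rabs_mult; fold a.
    apply Rle_trans with (K3 * a ^ 3 * a); [apply Rmult_le_compat_r; lra|].
    replace (K3 * a ^ 3 * a) with ((K3 * a) * (a * a) * a) by ring.
    assert (0 <= a * a) by nra.
    apply Rle_trans with (1 / 2 * (a * a) * 1); [|lra].
    apply Rmult_le_compat; [|lra| |lra].
    - apply Rmult_le_pos; [apply Rmult_le_pos; lra|lra].
    - apply Rmult_le_compat_r; lra. }
  apply Rabs_le_between in H2; nra. }
exists r, c; split; [lra|split; [exact c0|split; [|split]]].
- intros p Hp; destruct (B p Hp) as [_ [B2 B3]].
  assert (Hp1 := near_pair_mono r 1 p r1 Hp).
  assert (H1 := HKY p Hp1); assert (H2 := HKL p Hp1).
  assert (Xp := Xs p Hp); destruct Hp as [Hs Hp]; unfold incr in H1, H2.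
  set (a := Rabs (snd p)) in *.
  assert (a2 : snd p ^ 2 = a ^ 2) by (unfold a; rewrite RPow_abs, Rabs_pos_eq; nra).
  assert (a4 : snd p ^ 4 = a ^ 4)
    by (replace (snd p ^ 4) with ((snd p ^ 2) ^ 2) by ring; rewrite a2; ring).
  assert (ap2 : 0 < a ^ 2) by (apply pow_lt; lra); assert (ap4 : 0 < a ^ 4) by (apply pow_lt; lra).
  assert (Hk := Hk0 (fst p) Hs).
  split; [|split; [exact Xp|]].
  + unfold Yr in H1; rewrite a2 in H1.
    replace (KY * a ^ 3) with (KY * a * a ^ 2) in H1 by ring.
    assert (KY * a * a ^ 2 <= k0 / 4 * a ^ 2) by (apply Rmult_le_compat_r; lra).
    assert (k0 / 2 * a ^ 2 <= k (fst p) / 2 * a ^ 2) by (apply Rmult_le_compat_r; lra).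
    apply Rabs_le_between in H1; nra.
  + rewrite a2, a4 in *.
    replace (KL * a ^ 5) with (KL * a * a ^ 4) in H2 by ring.
    assert (KL * a * a ^ 4 <= c * a ^ 4) by (apply Rmult_le_compat_r; lra).
    assert (2 * c <= k (fst p) ^ 2 / 12).
    { unfold c; assert (k0 ^ 2 <= k (fst p) ^ 2) by (apply pow_incr; lra); lra. }
    assert (2 * c * a ^ 4 <= k (fst p) ^ 2 / 12 * a ^ 4) by (apply Rmult_le_compat_r; lra).
    apply Rabs_le_between in H2; lra.
- exists K3; split; [exact K30|]; intros p Hp; apply HK3; now apply (near_pair_mono r).
- assert (HN : bigO (near_pair r) incr 6 (fun p => m (fst p) * Y p - D p * X p
     - (z4 (fst p) * snd p ^ 4 + z5 (fst p) * snd p ^ 5)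
     - (z4 (fst p) * snd p ^ 3 + z5 (fst p) * snd p ^ 4) * (X p - snd p))).
  { apply (bigO_restrict (near_pair 1)); [|intros p; now apply near_pair_mono].
    apply bigO_sub; [exact HZ|].
    apply (bigO_mul _ _ 3 3); [apply bigO_add|exists K3; split; auto].
    - exact (bigO_mul_0 _ _ 3 _ _ (bigO_base 1 z4 L4) (bigO_incr 1 3)).
    - eapply (bigO_le _ _ 3 4); [exact Sm| |lia].
      exact (bigO_mul_0 _ _ 4 _ _ (bigO_base 1 z5 L5) (bigO_incr 1 4)). }
  destruct HN as [KN [KN0 HKN]].
  exists (2 * KN); split; [lra|]; intros p Hp.
  assert (H1 := HKN p Hp); assert (Xp := Xs p Hp); destruct Hp as [Hs Hp]; unfold incr in *.
  set (a := Rabs (snd p)) in *.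
  assert (a2 : snd p ^ 2 = a * a) by (unfold a; rewrite <- Rabs_mult, Rabs_pos_eq; nra).
  assert (Xa : a / 2 <= Rabs (X p)).
  { assert (Rabs (X p) * a = Rabs (X p * snd p)) by (unfold a; rewrite Rabs_mult; reflexivity).
    assert (X p * snd p <= Rabs (X p * snd p)) by apply Rle_abs; nra. }
  assert (Xn : X p <> 0) by (intro E; rewrite E, Rabs_R0 in Xa; lra).
  match type of H1 with Rabs ?n <= _ => replace (m (fst p) * Y p / X p - D p - _) with (n / X p)
    by (field; exact Xn); set (v := n) in * end.
  unfold Rdiv; rewrite Rabs_mult, Rabs_inv.
  apply Rmult_le_reg_r with (Rabs (X p)); [lra|].
  rewrite Rmult_assoc, Rinv_l, Rmult_1_r by lra.
  apply Rle_trans with (1 := H1).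
  replace (KN * a ^ 6) with (2 * KN * a ^ 5 * (a / 2)) by field.
  apply Rmult_le_compat_l; [|exact Xa].
  apply Rmult_le_pos; [lra|apply pow_le; lra].
Qed.

(** * Maximal symmetric polygons *)

Lemma dist2_triangle (a1 a2 b1 b2 c1 c2 : R) :
  dist2 a1 a2 c1 c2 <= dist2 a1 a2 b1 b2 + dist2 b1 b2 c1 c2.
Proof.
pose proof (triangle a1 a2 c1 c2 b1 b2) as H; unfold dist_euc, Rsqr in H; unfold dist2.
replace ((c1 - a1) ^ 2 + (c2 - a2) ^ 2) with ((a1 - c1) * (a1 - c1) + (a2 - c2) * (a2 - c2)) by ring.
replace ((b1 - a1) ^ 2 + (b2 - a2) ^ 2) with ((a1 - b1) * (a1 - b1) + (a2 - b2) * (a2 - b2)) by ring.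
replace ((c1 - b1) ^ 2 + (c2 - b2) ^ 2) with ((b1 - c1) * (b1 - c1) + (b2 - c2) * (b2 - c2)) by ring.
exact H.
Qed.

Definition chord (g1 g2 : R -> R) (a b : R) : R := dist2 (g1 a) (g2 a) (g1 b) (g2 b).

Lemma chord_frame (g1 g2 d1 d2 : R -> R) (a b : R) : d1 a ^ 2 + d2 a ^ 2 = 1 ->
  chord g1 g2 a b = sqrt (tangent_part g1 g2 d1 d2 a b ^ 2 + normal_part g1 g2 d1 d2 a b ^ 2).
Proof.
intro H; unfold chord, dist2, tangent_part, normal_part; f_equal.
transitivity ((d1 a ^ 2 + d2 a ^ 2) * ((g1 b - g1 a) ^ 2 + (g2 b - g2 a) ^ 2)); [rewrite H|]; ring.
Qed.

(** The projection of the curve on the direction of the chord moves no faster than the curve, by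
    Cauchy-Schwarz. *)
Lemma chord_le_arc (g1 g2 d1 d2 : R -> R) (a b : R) :
  (forall s, is_derive g1 s (d1 s)) -> (forall s, is_derive g2 s (d2 s)) ->
  (forall s, d1 s ^ 2 + d2 s ^ 2 = 1) -> a <= b -> chord g1 g2 a b <= b - a.
Proof.
intros H1 H2 Hu Hab; unfold chord, dist2.
set (v1 := g1 b - g1 a); set (v2 := g2 b - g2 a); set (L := sqrt (v1 ^ 2 + v2 ^ 2)).
assert (LL : L * L = v1 ^ 2 + v2 ^ 2) by (apply sqrt_sqrt; nra).
assert (L0 : 0 <= L) by apply sqrt_pos.
assert (M := MVT_bound (fun s => v1 * g1 s + v2 * g2 s) (fun s => v1 * d1 s + v2 * d2 s) a b L).
assert (M1 : Rabs (v1 * g1 b + v2 * g2 b - (v1 * g1 a + v2 * g2 a)) <= L * Rabs (b - a)).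
{ apply M.
  - intros x _; eapply is_derive_eq.
    + apply (is_derive_add (fun s => v1 * g1 s) (fun s => v2 * g2 s)); 
        (apply (is_derive_mul (fun _ => _)); [derive_const|auto]).
    + ring.
  - intros x _; rewrite <- (Rabs_pos_eq L L0); apply Rsqr_le_abs_0; unfold Rsqr; rewrite LL.
    specialize (Hu x); assert (0 <= (v1 * d2 x - v2 * d1 x) ^ 2) by apply pow2_ge_0.
    replace (v1 ^ 2 + v2 ^ 2) with ((d1 x ^ 2 + d2 x ^ 2) * (v1 ^ 2 + v2 ^ 2)) by (rewrite Hu; ring).
    nra. }
rewrite (Rabs_pos_eq (b - a)) in M1 by lra.
replace (v1 * g1 b + v2 * g2 b - (v1 * g1 a + v2 * g2 a)) with (L * L) in M1
  by (rewrite LL; unfold v1, v2; ring).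
rewrite Rabs_pos_eq in M1 by nra.
destruct (Req_dec L 0) as [E|E]; [lra|apply Rmult_le_reg_l with L; lra].
Qed.

(* Vertices of a [q]-gon continued by the parameter [1] of the closing vertex. *)
Definition closed (q : nat) (s : nat -> R) (k : nat) : R := if lt_dec k q then s k else 1.

Lemma closed_lt (q k : nat) (s : nat -> R) : (k < q)%nat -> closed q s k = s k.
Proof. intro H; unfold closed; destruct (lt_dec k q); [reflexivity|lia]. Qed.

Lemma closed_q (q : nat) (s : nat -> R) : closed q s q = 1.
Proof. unfold closed; destruct (lt_dec q q); [lia|reflexivity]. Qed.

Lemma period1_closed (f : R -> R) (q k : nat) (s : nat -> R) : period1 f ->
  sym_polygon q s -> (k < q)%nat -> f (s (S k mod q)%nat) = f (closed q s (S k)).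
Proof.
intros Hp [H0 _] Hk; destruct (Nat.eq_dec (S k) q) as [E|E].
- rewrite E, Nat.Div0.mod_same, H0, closed_q, <- (Hp 0); f_equal; ring.
- rewrite Nat.mod_small, closed_lt by lia; reflexivity.
Qed.

Lemma closed_step (q k : nat) (s : nat -> R) : (2 <= q)%nat -> sym_polygon q s -> (k < q)%nat ->
  closed q s k < closed q s (S k).
Proof.
intros Hq (H0 & H1 & H2 & _) Hk; rewrite closed_lt by exact Hk.
destruct (Nat.eq_dec (S k) q) as [E|E].
- rewrite E, closed_q; replace k with (pred q) by lia; exact H2.
- rewrite closed_lt by lia; apply H1; lia.
Qed.

Lemma closed_0 (q : nat) (s : nat -> R) : (2 <= q)%nat -> sym_polygon q s -> closed q s 0 = 0.
Proof. intros Hq (H0 & _); rewrite closed_lt by lia; exact H0. Qed.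

Lemma closed_sym (q k : nat) (s : nat -> R) : (2 <= q)%nat -> sym_polygon q s -> (k <= q)%nat ->
  closed q s (q - k) = 1 - closed q s k.
Proof.
intros Hq Hs Hk; assert (H0 := closed_0 q s Hq Hs); destruct Hs as (_ & _ & _ & H3 & _).
destruct (Nat.eq_dec k 0) as [->|K0]; [rewrite Nat.sub_0_r, closed_q, H0; ring|].
destruct (Nat.eq_dec k q) as [->|K1]; [rewrite Nat.sub_diag, closed_q, H0; ring|].
rewrite !closed_lt by lia; apply H3; lia.
Qed.

Lemma closed_mono (q : nat) (s : nat -> R) (i j : nat) : (2 <= q)%nat -> sym_polygon q s ->
  (i <= j <= q)%nat -> closed q s i <= closed q s j.
Proof.
intros Hq Hs [H1 H2]; induction H1 as [|j H1 IH]; [lra|].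
assert (closed q s j < closed q s (S j)) by (apply closed_step; auto; lia).
specialize (IH ltac:(lia)); lra.
Qed.

Lemma closed_range (q k : nat) (s : nat -> R) : (2 <= q)%nat -> sym_polygon q s -> (k <= q)%nat ->
  0 <= closed q s k <= 1.
Proof.
intros Hq Hs Hk.
assert (H0 := closed_mono q s 0 k Hq Hs ltac:(lia)).
assert (H1 := closed_mono q s k q Hq Hs ltac:(lia)).
rewrite closed_0 in H0 by assumption; rewrite closed_q in H1; lra.
Qed.

Lemma perimeter_closed (g1 g2 : R -> R) (q : nat) (s : nat -> R) :
  period1 g1 -> period1 g2 -> sym_polygon q s ->
  perimeter g1 g2 q s = sumR q (fun k => chord g1 g2 (closed q s k) (closed q s (S k))).
Proof.
intros P1 P2 Hs; apply sumR_ext; intros k Hk; unfold chord.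
rewrite (period1_closed g1 q k s P1 Hs Hk), (period1_closed g2 q k s P2 Hs Hk), (closed_lt q k s Hk); reflexivity.
Qed.

Lemma regular_sym_polygon (q : nat) : (2 <= q)%nat -> sym_polygon q (fun k => INR k / INR q).
Proof.
intro Hq; assert (Q : 1 <= INR q) by (apply INR_pos; lia).
assert (IQ : 0 < / INR q) by (inv_pos).
split; [simpl; unfold Rdiv; ring|split; [|split; [|split]]].
- intros k Hk; rewrite S_INR; unfold Rdiv; nra.
- apply Rmult_lt_reg_r with (INR q); [lra|].
  unfold Rdiv; rewrite Rmult_assoc, Rinv_l, Rmult_1_l, Rmult_1_r by lra; apply lt_INR; lia.
- intros k Hk; rewrite minus_INR by lia; field; lra.
- intros [m Hm]; subst q; rewrite Nat.div2_double, mult_INR; simpl (INR 2).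
  rewrite mult_INR in Q; simpl (INR 2) in Q; field; lra.
Qed.

Lemma sum_gaps (q : nat) (s : nat -> R) : (2 <= q)%nat -> sym_polygon q s ->
  sumR q (fun k => closed q s (S k) - closed q s k) = 1.
Proof.
intros Hq Hs; rewrite sumR_telescope, closed_q, (closed_0 q s Hq Hs); ring.
Qed.

(* A gap bounded below loses a definite amount of perimeter, while the polygon with equal
   gaps loses only [O(q^-2)]. *)
Lemma gaps_small (g1 g2 d1 d2 : R -> R) (r c K : R) :
  (forall s, is_derive g1 s (d1 s)) -> (forall s, is_derive g2 s (d2 s)) ->
  (forall s, d1 s ^ 2 + d2 s ^ 2 = 1) -> period1 g1 -> period1 g2 ->
  0 < r <= 1 -> 0 < c -> 0 <= K ->
  (forall s t, 0 <= s <= 1 -> 0 < t <= r -> chord g1 g2 s (s + t) <= t - c * t ^ 3) ->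
  (forall s t, 0 <= s <= 1 -> 0 < t <= r -> t - K * t ^ 3 <= chord g1 g2 s (s + t)) ->
  forall eta, 0 < eta -> exists q1, (2 <= q1)%nat /\ forall q s, (q1 <= q)%nat ->
    max_sym_orbit g1 g2 q s ->
    forall k, (k < q)%nat -> closed q s (S k) - closed q s k <= eta.
Proof.
intros H1 H2 Hu P1 P2 Hr Hc HK Hup Hlow eta Heta.
set (e := Rmin eta r).
assert (He : 0 < e) by (apply Rmin_glb_lt; lra).
assert (He1 : e <= eta) by apply Rmin_l; assert (He2 : e <= r) by apply Rmin_r.
assert (Pe : 0 < c * e ^ 3) by (apply Rmult_lt_0_compat; [lra|apply pow_lt; lra]).
(* Two demands on [q]: the equal gaps [1/q] lie within the local radius [r], and their total loss
   [K/q^2] stays below the loss [c e^3] of one long gap. *)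
destruct (nfloor_ex (/ r)) as [n1 [_ N1]]; [inv_nonneg|].
destruct (nfloor_ex (K / (c * e ^ 3))) as [n2 [_ N2]].
{ apply Rmult_le_pos; [lra|left; now apply Rinv_0_lt_compat]. }
exists (S (S (n1 + n2))); split; [lia|intros q s Hq [Hs Hmax] k Hk].
assert (Hq2 : (2 <= q)%nat) by lia.
assert (Q1 : 1 <= INR q) by (apply INR_pos; lia).
assert (Qa : INR n1 + 1 <= INR q) by (rewrite <- S_INR; apply le_INR; lia).
assert (Qb : INR n2 + 1 <= INR q) by (rewrite <- S_INR; apply le_INR; lia).
destruct (Rle_dec (closed q s (S k) - closed q s k) eta) as [H|H]; [exact H|exfalso].
assert (Lo : 1 - K / INR q ^ 2 <= perimeter g1 g2 q s).
{ eapply Rle_trans; [|apply (Hmax _ (regular_sym_polygon q Hq2))].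
  rewrite perimeter_closed by (auto; now apply regular_sym_polygon).
  replace (1 - K / INR q ^ 2) with (sumR q (fun _ => / INR q - K * (/ INR q) ^ 3)).
  2:{ rewrite sumR_const; field; lra. }
  apply sumR_le; intros i Hi.
  assert (R1 := closed_range q i _ Hq2 (regular_sym_polygon q Hq2) ltac:(lia)).
  replace (closed q (fun k => INR k / INR q) (S i))
    with (closed q (fun k => INR k / INR q) i + / INR q).
  - apply Hlow; [exact R1|split; [inv_pos|]].
    rewrite <- (Rinv_inv r); apply Rinv_le_contravar; [inv_pos|lra].
  - rewrite (closed_lt q i) by exact Hi; destruct (Nat.eq_dec (S i) q) as [E|E].
    + rewrite E, closed_q, <- E, S_INR; pose proof (pos_INR i); field; lra.
    + rewrite closed_lt, S_INR by lia; field; lra. }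
assert (Up : perimeter g1 g2 q s <= 1 - c * e ^ 3).
{ rewrite (perimeter_closed g1 g2 q s P1 P2 Hs), <- (sum_gaps q s Hq2 Hs).
  rewrite <- (sumR_single q k (c * e ^ 3) Hk), <- sumR_minus.
  apply sumR_le; intros i Hi.
  assert (Ci := closed_step q i s Hq2 Hs Hi).
  destruct (Nat.eq_dec i k) as [->|E].
  - set (a := closed q s k) in *; set (b := closed q s (S k)) in *.
    assert (Ra : 0 <= a <= 1) by (apply closed_range; auto; lia).
    (* Only the first stretch [e] of the long gap is charged, since the cubic loss is known within
       the radius [r]; the rest is bounded by arc length. *)
    assert (T := dist2_triangle (g1 a) (g2 a) (g1 (a + e)) (g2 (a + e)) (g1 b) (g2 b)).
    fold (chord g1 g2 a b) (chord g1 g2 a (a + e)) (chord g1 g2 (a + e) b) in T.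
    assert (U := Hup a e Ra ltac:(lra)).
    assert (V := chord_le_arc g1 g2 d1 d2 (a + e) b H1 H2 Hu ltac:(lra)); lra.
  - rewrite Rminus_0_r; apply (chord_le_arc g1 g2 d1 d2); auto; lra. }
assert (Fin : K / INR q ^ 2 < c * e ^ 3); [|lra].
apply Rmult_lt_reg_r with (INR q ^ 2); [apply pow_lt; lra|].
unfold Rdiv; rewrite Rmult_assoc, Rinv_l, Rmult_1_r by (apply pow_nonzero; lra).
apply Rle_lt_trans with (c * e ^ 3 * (K / (c * e ^ 3))); [right; field; lra|].
apply Rmult_lt_compat_l; [exact Pe|]; nra.
Qed.

Lemma is_derive_dist2 (g1 g2 d1 d2 : R -> R) (a b eta th : R) :
  (forall s, is_derive g1 s (d1 s)) -> (forall s, is_derive g2 s (d2 s)) ->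
  chord g1 g2 a b <> 0 ->
  is_derive (fun e => chord g1 g2 (a + e * eta) (b + e * th)) 0
    (((g1 b - g1 a) * d1 b + (g2 b - g2 a) * d2 b) / chord g1 g2 a b * th
     - ((g1 b - g1 a) * d1 a + (g2 b - g2 a) * d2 a) / chord g1 g2 a b * eta).
Proof.
intros H1 H2 Hn.
assert (Hl : forall g d p v, (forall s, is_derive g s (d s)) ->
  is_derive (fun e => g (p + e * v)) 0 (d p * v)).
{ intros g d p v Hg; eapply is_derive_eq; [apply (is_derive_comp g (fun e => p + e * v))|].
  - apply Hg.
  - auto_derive; auto.
  - unfold scal; simpl; unfold mult; simpl; rewrite Rmult_0_l, Rplus_0_r; ring. }
set (w1 := fun e => g1 (b + e * th) - g1 (a + e * eta)).
set (w2 := fun e => g2 (b + e * th) - g2 (a + e * eta)).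
assert (D1 : is_derive w1 0 (d1 b * th - d1 a * eta)) by (apply is_derive_sub; now apply Hl).
assert (D2 : is_derive w2 0 (d2 b * th - d2 a * eta)) by (apply is_derive_sub; now apply Hl).
assert (D3 : is_derive (fun e => w1 e * w1 e + w2 e * w2 e) 0
   (((d1 b * th - d1 a * eta) * w1 0 + w1 0 * (d1 b * th - d1 a * eta))
   + ((d2 b * th - d2 a * eta) * w2 0 + w2 0 * (d2 b * th - d2 a * eta)))).
{ apply is_derive_add; now apply is_derive_mul. }
assert (E1 : w1 0 = g1 b - g1 a) by (unfold w1; rewrite !Rmult_0_l, !Rplus_0_r; ring).
assert (E2 : w2 0 = g2 b - g2 a) by (unfold w2; rewrite !Rmult_0_l, !Rplus_0_r; ring).
assert (EL : chord g1 g2 a b = sqrt (w1 0 * w1 0 + w2 0 * w2 0)).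
{ unfold chord, dist2; f_equal; rewrite E1, E2; ring. }
assert (P : 0 < w1 0 * w1 0 + w2 0 * w2 0).
{ destruct (Rle_lt_dec (w1 0 * w1 0 + w2 0 * w2 0) 0) as [H|H]; [|exact H].
  exfalso; apply Hn; rewrite EL; now apply sqrt_neg_0. }
apply is_derive_ext with (fun e => sqrt (w1 e * w1 e + w2 e * w2 e)).
{ intro e; unfold chord, dist2, w1, w2; f_equal; ring. }
eapply is_derive_eq.
- apply (is_derive_comp sqrt (fun e => w1 e * w1 e + w2 e * w2 e)); [|exact D3].
  apply is_derive_Reals; apply derivable_pt_lim_sqrt; exact P.
- unfold scal; simpl; unfold mult; simpl; rewrite <- EL, E1, E2; field; exact Hn.
Qed.

Lemma finite_min_pos (n : nat) (f : nat -> R) : (forall k, (k < n)%nat -> 0 < f k) ->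
  exists c, 0 < c /\ forall k, (k < n)%nat -> c <= f k.
Proof.
induction n as [|n IH]; intro H; [exists 1; split; [lra|intros; lia]|].
destruct IH as [c [c0 Hc]]; [intros; apply H; lia|].
exists (Rmin c (f n)); split; [apply Rmin_glb_lt; auto|].
intros k Hk; destruct (Nat.eq_dec k n) as [->|E]; [apply Rmin_r|].
eapply Rle_trans; [apply Rmin_l|apply Hc; lia].
Qed.

(** The sign from differentiating [- s] makes the tangent the negative of its mirror image: the
    reflection reverses the orientation. *)
Lemma reflect_derivative (g1 g2 d1 d2 : R -> R) (a1 a2 u1 u2 : R) :
  (forall s, is_derive g1 s (d1 s)) -> (forall s, is_derive g2 s (d2 s)) ->
  (forall s, (g1 (- s), g2 (- s)) = reflect a1 a2 u1 u2 (g1 s, g2 s)) ->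
  forall s, d1 (- s) = d1 s - 2 * (d1 s * u1 + d2 s * u2) * u1 /\
            d2 (- s) = d2 s - 2 * (d1 s * u1 + d2 s * u2) * u2.
Proof.
intros H1 H2 HR s.
assert (Hl : forall g d, (forall s, is_derive g s (d s)) -> is_derive (fun e => g (- e)) s (- d (- s))).
{ intros g d Hg; eapply is_derive_eq; [apply (is_derive_comp g (fun e => - e))|].
  - apply Hg.
  - auto_derive; auto.
  - unfold scal; simpl; unfold mult; simpl; ring. }
assert (R1 : forall t, g1 (- t) = a1 + 2 * ((g1 t - a1) * u1 + (g2 t - a2) * u2) * u1 - (g1 t - a1)).
{ intro t; specialize (HR t); unfold reflect in HR; simpl in HR; now injection HR. }
assert (R2 : forall t, g2 (- t) = a2 + 2 * ((g1 t - a1) * u1 + (g2 t - a2) * u2) * u2 - (g2 t - a2)).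
{ intro t; specialize (HR t); unfold reflect in HR; simpl in HR; now injection HR. }
assert (Lin : forall a b c, is_derive (fun t => a + b * g1 t + c * g2 t) s (b * d1 s + c * d2 s)).
{ intros a b c; eapply is_derive_eq.
  - apply (is_derive_add (fun t => a + b * g1 t) (fun t => c * g2 t)).
    + apply (is_derive_add (fun _ => a) (fun t => b * g1 t)).
      * derive_const.
      * apply (is_derive_mul (fun _ => b)); [derive_const|auto].
    + apply (is_derive_mul (fun _ => c)); [derive_const|auto].
  - ring. }
split.
- assert (E := is_derive_unique _ _ _ (Hl g1 d1 H1)).
  rewrite (Derive_ext _ (fun t => (2 * a1 - 2 * (a1 * u1 + a2 * u2) * u1)
     + (2 * u1 * u1 - 1) * g1 t + (2 * u2 * u1) * g2 t)) in E by (intro t; rewrite R1; ring).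
  rewrite (is_derive_unique _ _ _ (Lin _ _ _)) in E; lra.
- assert (E := is_derive_unique _ _ _ (Hl g2 d2 H2)).
  rewrite (Derive_ext _ (fun t => (2 * a2 - 2 * (a1 * u1 + a2 * u2) * u2)
     + (2 * u1 * u2) * g1 t + (2 * u2 * u2 - 1) * g2 t)) in E by (intro t; rewrite R2; ring).
  rewrite (is_derive_unique _ _ _ (Lin _ _ _)) in E; lra.
Qed.

Lemma maximum_derive_0 (P : R -> R) (l r : R) : 0 < r -> is_derive P 0 l ->
  (forall e, - r < e < r -> P e <= P 0) -> l = 0.
Proof.
intros Hr HP Hm; apply is_derive_Reals in HP.
rewrite <- (deriv_maximum P (- r) r 0 (exist (fun l => derivable_pt_abs P 0 l) l HP)); [reflexivity|lra|lra|].
intros x Hx1 Hx2; apply Hm; lra.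
Qed.

(** Cosine of the angle between the chord and the positive tangent, at its starting point here and
    at its end point in the next definition. *)
Definition cos_out (g1 g2 d1 d2 : R -> R) (a b : R) : R :=
  ((g1 b - g1 a) * d1 a + (g2 b - g2 a) * d2 a) / chord g1 g2 a b.
Definition cos_in (g1 g2 d1 d2 : R -> R) (a b : R) : R :=
  ((g1 b - g1 a) * d1 b + (g2 b - g2 a) * d2 b) / chord g1 g2 a b.

Lemma cos_reflect (r : nat) (g1 g2 d1 d2 e1 e2 : R -> R) (a b : R) :
  sym_domain r g1 g2 d1 d2 e1 e2 ->
  cos_in g1 g2 d1 d2 (1 - b) (1 - a) = cos_out g1 g2 d1 d2 a b /\
  cos_out g1 g2 d1 d2 (1 - b) (1 - a) = cos_in g1 g2 d1 d2 a b.
Proof.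
intros (_ & _ & Hd1 & Hd2 & _ & _ & P1 & P2 & _ & _ & _ & a1 & a2 & u1 & u2 & U & HR).
assert (H1 : forall s, is_derive g1 s (d1 s)) by (intro; now apply is_derive_Reals).
assert (H2 : forall s, is_derive g2 s (d2 s)) by (intro; now apply is_derive_Reals).
assert (Q1 := period1_derive _ _ H1 P1); assert (Q2 := period1_derive _ _ H2 P2).
assert (HD := reflect_derivative g1 g2 d1 d2 a1 a2 u1 u2 H1 H2 HR).
assert (S : forall f s, period1 f -> f (1 - s) = f (- s)).
{ intros f s Hf; rewrite <- (Hf (- s)); f_equal; ring. }
assert (G : forall s, g1 (1 - s) = a1 + 2 * ((g1 s - a1) * u1 + (g2 s - a2) * u2) * u1 - (g1 s - a1)
               /\ g2 (1 - s) = a2 + 2 * ((g1 s - a1) * u1 + (g2 s - a2) * u2) * u2 - (g2 s - a2)).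
{ intro s; rewrite !S by assumption; specialize (HR s); unfold reflect in HR; simpl in HR.
  injection HR; auto. }
assert (D : forall s, d1 (1 - s) = d1 s - 2 * (d1 s * u1 + d2 s * u2) * u1 /\
            d2 (1 - s) = d2 s - 2 * (d1 s * u1 + d2 s * u2) * u2).
{ intro s; rewrite !S by assumption; apply HD. }
destruct (G a) as [Ga1 Ga2], (G b) as [Gb1 Gb2], (D a) as [Da1 Da2], (D b) as [Db1 Db2].
assert (L : chord g1 g2 (1 - b) (1 - a) = chord g1 g2 a b).
{ unfold chord, dist2; f_equal; rewrite Ga1, Ga2, Gb1, Gb2.
  set (w1 := g1 b - g1 a); set (w2 := g2 b - g2 a).
  transitivity (w1 ^ 2 + w2 ^ 2 + 4 * (w1 * u1 + w2 * u2) ^ 2 * (u1 ^ 2 + u2 ^ 2 - 1)).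
  - unfold w1, w2; ring.
  - rewrite U; ring. }
unfold cos_in, cos_out; rewrite L, Ga1, Ga2, Gb1, Gb2, Da1, Da2, Db1, Db2.
set (w1 := g1 b - g1 a); set (w2 := g2 b - g2 a).
split; (apply (f_equal (fun x => x / chord g1 g2 a b))).
- transitivity (w1 * d1 a + w2 * d2 a
    + 4 * (w1 * u1 + w2 * u2) * (d1 a * u1 + d2 a * u2) * (u1 ^ 2 + u2 ^ 2 - 1)).
  + unfold w1, w2; ring.
  + rewrite U; ring.
- transitivity (w1 * d1 b + w2 * d2 b
    + 4 * (w1 * u1 + w2 * u2) * (d1 b * u1 + d2 b * u2) * (u1 ^ 2 + u2 ^ 2 - 1)).
  + unfold w1, w2; ring.
  + rewrite U; ring.
Qed.

(** The variation that respects the symmetry: one vertex advances while its mirror image recedes.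
    For a vertex that is its own mirror image the two terms cancel, so the axis point prescribed for
    even [q] stays in place. *)
Definition pair_shift (q k0 i : nat) : R :=
  (if Nat.eq_dec i k0 then 1 else 0) - (if Nat.eq_dec i (q - k0) then 1 else 0).

Lemma pair_shift_bound (q k0 i : nat) : Rabs (pair_shift q k0 i) <= 1.
Proof.
unfold pair_shift; destruct (Nat.eq_dec i k0), (Nat.eq_dec i (q - k0)); apply Rabs_le; lra.
Qed.

Lemma shifted_sym_polygon (q k0 : nat) (s : nat -> R) : (2 <= q)%nat -> (1 <= k0 < q)%nat ->
  sym_polygon q s -> exists r, 0 < r /\ forall e, - r < e < r ->
    sym_polygon q (fun i => s i + e * pair_shift q k0 i).
Proof.
intros Hq Hk Hs.
destruct (finite_min_pos q (fun k => closed q s (S k) - closed q s k)) as [c [c0 Hc]].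
{ intros k Hkq; assert (closed q s k < closed q s (S k)) by (now apply closed_step); lra. }
exists (c / 4); split; [lra|intros e He].
assert (Hb : forall i, - (c / 4) <= e * pair_shift q k0 i <= c / 4).
{ intro i; apply Rabs_le_between; rewrite Rabs_mult.
  assert (Rabs e <= c / 4) by (apply Rabs_le; lra).
  pose proof (pair_shift_bound q k0 i); pose proof (Rabs_pos e); nra. }
destruct Hs as (H0 & H1 & H2 & H3 & H4).
split; [|split; [|split; [|split]]].
- unfold pair_shift; destruct (Nat.eq_dec 0 k0); [lia|].
  destruct (Nat.eq_dec 0 (q - k0)); [lia|]; rewrite H0; ring.
- intros k Hkq; specialize (Hc k ltac:(lia)); rewrite !closed_lt in Hc by lia.
  pose proof (Hb k); pose proof (Hb (S k)); lra.
- specialize (Hc (pred q) ltac:(lia)); replace (S (pred q)) with q in Hc by lia.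
  rewrite closed_q, closed_lt in Hc by lia; pose proof (Hb (pred q)); lra.
- intros k Hkq; rewrite H3 by exact Hkq; unfold pair_shift.
  destruct (Nat.eq_dec (q - k) k0), (Nat.eq_dec (q - k) (q - k0)), (Nat.eq_dec k k0),
    (Nat.eq_dec k (q - k0)); try lia; ring.
- intro He'; rewrite (H4 He'); destruct He' as [m ->]; rewrite Nat.div2_double; unfold pair_shift.
  destruct (Nat.eq_dec m k0), (Nat.eq_dec m (2 * m - k0)); try lia; ring.
Qed.

Lemma closed_chord_neq_0 (r : nat) (g1 g2 d1 d2 e1 e2 : R -> R) (q k : nat) (s : nat -> R) :
  sym_domain r g1 g2 d1 d2 e1 e2 -> (2 <= q)%nat -> sym_polygon q s -> (k < q)%nat ->
  chord g1 g2 (s k) (s (S k mod q)%nat) <> 0.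
Proof.
intros (_ & _ & _ & _ & _ & _ & _ & _ & _ & Inj & _ & _) Hq Hs Hk E.
assert (R : forall i, (i < q)%nat -> 0 <= s i < 1).
{ intros i Hi; rewrite <- (closed_lt q i s Hi); split; [apply closed_range; auto; lia|].
  apply Rlt_le_trans with (closed q s (S i)); [now apply closed_step|].
  apply closed_range; auto; lia. }
assert (Hm : (S k mod q < q)%nat) by (apply Nat.mod_upper_bound; lia).
unfold chord, dist2 in E; apply sqrt_eq_0 in E; [|apply Rplus_le_le_0_compat; apply pow2_ge_0].
assert (Z : g1 (s (S k mod q)%nat) - g1 (s k) = 0 /\ g2 (s (S k mod q)%nat) - g2 (s k) = 0).
{ apply Rplus_sqr_eq_0; unfold Rsqr; rewrite <- E; ring. }
assert (E3 := Inj _ _ (R _ Hm) (R _ Hk) ltac:(lra) ltac:(lra)).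
destruct (Nat.eq_dec (S k) q) as [F|F].
- rewrite F, Nat.Div0.mod_same in E3.
  assert (closed q s 0 < closed q s k); [|rewrite !closed_lt in H by lia; lra].
  apply Rlt_le_trans with (closed q s 1); [apply closed_step; auto; lia|].
  apply closed_mono; auto; lia.
- rewrite Nat.mod_small in E3 by lia.
  assert (closed q s k < closed q s (S k)) by (now apply closed_step).
  rewrite !closed_lt in H by lia; lra.
Qed.

(* The derivative of the perimeter when two mirror vertices move symmetrically is twice the
   defect of the reflection law, also when they are adjacent or coincide. *)
Lemma reflection_law (r : nat) (g1 g2 d1 d2 e1 e2 : R -> R) (q j : nat) (s : nat -> R) :
  sym_domain r g1 g2 d1 d2 e1 e2 -> (2 <= q)%nat -> max_sym_orbit g1 g2 q s ->
  (S j < q)%nat ->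
  cos_in g1 g2 d1 d2 (closed q s j) (closed q s (S j))
  = cos_out g1 g2 d1 d2 (closed q s (S j)) (closed q s (S (S j))).
Proof.
intros Hdom Hq [Hs Hmax] Hj; set (k0 := S j).
assert (Hdom' := Hdom).
destruct Hdom as (_ & _ & Hd1 & Hd2 & _ & _ & P1 & P2 & _).
assert (H1 : forall s, is_derive g1 s (d1 s)) by (intro; now apply is_derive_Reals).
assert (H2 : forall s, is_derive g2 s (d2 s)) by (intro; now apply is_derive_Reals).
assert (Q1 := period1_derive _ _ H1 P1); assert (Q2 := period1_derive _ _ H2 P2).
set (eta := pair_shift q k0).
set (A := fun k => cos_in g1 g2 d1 d2 (closed q s k) (closed q s (S k))).
set (B := fun k => cos_out g1 g2 d1 d2 (closed q s k) (closed q s (S k))).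
destruct (shifted_sym_polygon q k0 s Hq ltac:(lia) Hs) as [rad [rad0 Hrad]].
assert (Der : is_derive (fun e => perimeter g1 g2 q (fun i => s i + e * eta i)) 0
   (sumR q (fun k => A k * eta (S k mod q)%nat - B k * eta k))).
{ apply (is_derive_sumR q (fun k e => chord g1 g2 (s k + e * eta k)
     (s (S k mod q)%nat + e * eta (S k mod q)%nat))).
  intros k Hk; eapply is_derive_eq.
  - apply is_derive_dist2; [exact H1|exact H2|].
    now apply (closed_chord_neq_0 r g1 g2 d1 d2 e1 e2).
  - unfold A, B, cos_in, cos_out, chord.
    rewrite <- (period1_closed g1 q k s P1 Hs Hk), <- (period1_closed g2 q k s P2 Hs Hk),
      <- (period1_closed d1 q k s Q1 Hs Hk), <- (period1_closed d2 q k s Q2 Hs Hk), closed_lt; auto. }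
apply (maximum_derive_0 _ _ rad rad0) in Der.
2:{ intros e He; eapply Rle_trans; [apply Hmax, Hrad, He|right].
    apply sumR_ext; intros k _; now rewrite !Rmult_0_l, !Rplus_0_r. }
rewrite sumR_minus in Der.
rewrite (sumR_ext q (fun k => A k * eta (S k mod q)%nat)
  (fun k => (if Nat.eq_dec k j then A j else 0)
            - (if Nat.eq_dec k (q - k0 - 1) then A (q - k0 - 1)%nat else 0))) in Der.
2:{ intros k Hk; unfold eta, pair_shift.
    assert (M : (S k mod q = if Nat.eq_dec (S k) q then 0 else S k)%nat).
    { destruct (Nat.eq_dec (S k) q) as [E|E]; [rewrite E; apply Nat.Div0.mod_same|].
      apply Nat.mod_small; lia. }
    rewrite M; destruct (Nat.eq_dec (S k) q) as [E|E].
    - destruct (Nat.eq_dec 0 k0), (Nat.eq_dec 0 (q - k0)), (Nat.eq_dec k j),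
        (Nat.eq_dec k (q - k0 - 1)); try (unfold k0 in *; lia); ring.
    - destruct (Nat.eq_dec (S k) k0), (Nat.eq_dec (S k) (q - k0)), (Nat.eq_dec k j),
        (Nat.eq_dec k (q - k0 - 1)); try (unfold k0 in *; lia);
        repeat match goal with E : k = _ |- _ => rewrite <- E; clear E end; ring. }
rewrite (sumR_ext q (fun k => B k * eta k)
  (fun k => (if Nat.eq_dec k k0 then B k0 else 0)
            - (if Nat.eq_dec k (q - k0) then B (q - k0)%nat else 0))) in Der.
2:{ intros k Hk; unfold eta, pair_shift.
    destruct (Nat.eq_dec k k0) as [E1|E1], (Nat.eq_dec k (q - k0)) as [E2|E2];
      try rewrite <- E2; try rewrite <- E1; ring. }
rewrite !sumR_minus, !sumR_single in Der by (unfold k0; lia).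
assert (C1 : closed q s (q - k0 - 1) = 1 - closed q s (S k0)).
{ rewrite <- closed_sym by (auto; unfold k0; lia); f_equal; lia. }
assert (C2 : closed q s (q - k0) = 1 - closed q s k0) by (apply closed_sym; auto; unfold k0; lia).
assert (C3 : closed q s (S (q - k0)) = 1 - closed q s j).
{ rewrite <- closed_sym by (auto; lia); f_equal; unfold k0; lia. }
assert (S1 : A (q - k0 - 1)%nat = B k0).
{ unfold A, B; replace (S (q - k0 - 1)) with (q - k0)%nat by (unfold k0; lia).
  rewrite C1, C2; now apply (cos_reflect r g1 g2 d1 d2 e1 e2). }
assert (S2 : B (q - k0)%nat = A j).
{ unfold A, B; rewrite C3, C2; now apply (cos_reflect r g1 g2 d1 d2 e1 e2). }
rewrite S1, S2 in Der; change (A j = B k0); lra.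
Qed.

(** Squaring the equality of cosines compares the tangents up to sign, and the signs of the four
    components decide it. [X'] is negative because the incoming chord is seen backwards from the
    vertex. *)
Lemma equal_cosines (X Y X' Y' : R) : 0 < X -> 0 < Y -> X' < 0 -> 0 < Y' ->
  X / sqrt (X ^ 2 + Y ^ 2) = - X' / sqrt (X' ^ 2 + Y' ^ 2) -> Y / X = - (Y' / X').
Proof.
intros HX HY HX' HY' E.
set (L := sqrt (X ^ 2 + Y ^ 2)) in *; set (L' := sqrt (X' ^ 2 + Y' ^ 2)) in *.
assert (L0 : 0 < L) by (apply sqrt_lt_R0; nra).
assert (L0' : 0 < L') by (apply sqrt_lt_R0; nra).
assert (LL : L * L = X ^ 2 + Y ^ 2) by (apply sqrt_sqrt; nra).
assert (LL' : L' * L' = X' ^ 2 + Y' ^ 2) by (apply sqrt_sqrt; nra).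
assert (E1 : X * L' = - X' * L).
{ replace (X * L') with (X / L * (L * L')) by (field; lra); rewrite E; field; lra. }
assert (E2 : (X * Y') ^ 2 = (- X' * Y) ^ 2).
{ assert ((X * L') ^ 2 = (- X' * L) ^ 2) by (now rewrite E1).
  replace ((X * L') ^ 2) with (X ^ 2 * (L' * L')) in H by ring.
  replace ((- X' * L) ^ 2) with (X' ^ 2 * (L * L)) in H by ring.
  rewrite LL, LL' in H; nra. }
assert (E3 : X * Y' = - X' * Y).
{ apply Rsqr_inj; [nra|nra|unfold Rsqr; nra]. }
apply Rmult_eq_reg_r with (X * X'); [|nra].
replace (Y / X * (X * X')) with (Y * X') by (field; lra).
replace (- (Y' / X') * (X * X')) with (- (X * Y')) by (field; lra); lra.
Qed.

(** * Gap sequences *)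

Lemma finite_max (n : nat) (f : nat -> R) : (1 <= n)%nat ->
  exists k, (k < n)%nat /\ forall i, (i < n)%nat -> f i <= f k.
Proof.
induction n as [|[|n] IH]; intro H; [lia|exists 0%nat; split; [lia|]|].
- intros i Hi; replace i with 0%nat by lia; lra.
- destruct IH as [k [Hk Hm]]; [lia|].
  destruct (Rle_dec (f k) (f (S n))) as [L|L].
  + exists (S n); split; [lia|intros i Hi].
    destruct (Nat.eq_dec i (S n)) as [->|E]; [lra|].
    apply Rle_trans with (2 := L), Hm; lia.
  + exists k; split; [lia|intros i Hi].
    destruct (Nat.eq_dec i (S n)) as [->|E]; [lra|apply Hm; lia].
Qed.

Lemma sumR_prefix_le (n m : nat) (f : nat -> R) : (n <= m)%nat ->
  (forall i, (i < m)%nat -> 0 <= f i) -> sumR n f <= sumR m f.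
Proof.
intros H Hf; replace m with (n + (m - n))%nat by lia; rewrite sumR_add.
assert (0 <= sumR (m - n) (fun i => f (n + i)%nat)); [|lra].
apply sumR_nonneg; intros; apply Hf; lia.
Qed.

(** A bootstrap on the largest gap [M]: each cube is at most [M^2] times its gap and the gaps sum to
    1, so two gaps differ by at most [4 C M^2]. As [M] is small, this is at most [M/2], every gap is
    at least [M/2], and [M <= 2/q]; inserted into the difference bound this gives the claim. *)
Lemma gaps_comparable (q : nat) (De : nat -> R) (C M0 : R) : (1 <= q)%nat -> 0 <= C ->
  (forall k, (k < q)%nat -> 0 < De k <= M0) -> sumR q De = 1 -> 8 * C * M0 <= 1 ->
  (forall j, (S j < q)%nat -> Rabs (De (S j) - De j) <= C * (De (S j) ^ 3 + De j ^ 3)) ->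
  forall k, (k < q)%nat -> Rabs (De k - / INR q) <= 16 * C / INR q ^ 2.
Proof.
intros Hq HC Hp Hs HM Hd; assert (Q := INR_pos q Hq).
destruct (finite_max q De Hq) as [km [Hkm Hmax]]; set (M := De km) in *.
assert (M1 := Hp km Hkm); fold M in M1.
assert (B0 : forall k, (k < q)%nat -> Rabs (De k - De 0%nat) <= 2 * C * M ^ 2).
{ intros k Hk; rewrite <- (sumR_telescope k De).
  assert (Cub : forall i, (i < q)%nat -> De i ^ 3 <= M ^ 2 * De i).
  { intros i Hi; specialize (Hp i Hi); specialize (Hmax i Hi).
    replace (De i ^ 3) with (De i ^ 2 * De i) by ring.
    apply Rmult_le_compat_r; [lra|apply pow_incr; lra]. }
  apply Rle_trans with (sumR k (fun j => C * M ^ 2 * (De (S j) + De j))).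
  - apply sumR_abs_le; intros i Hi; eapply Rle_trans; [apply Hd; lia|].
    rewrite Rmult_assoc; apply Rmult_le_compat_l; [exact HC|].
    pose proof (Cub i ltac:(lia)); pose proof (Cub (S i) ltac:(lia)); lra.
  - rewrite sumR_scal, sumR_plus.
    assert (S1 : sumR k De <= 1).
    { rewrite <- Hs; apply sumR_prefix_le; [lia|intros i Hi; specialize (Hp i Hi); lra]. }
    assert (S2 : sumR k (fun i => De (S i)) <= 1).
    { assert (sumR (S k) De <= 1).
      { rewrite <- Hs; apply sumR_prefix_le; [lia|intros i Hi; specialize (Hp i Hi); lra]. }
      rewrite sumR_head in H; specialize (Hp 0%nat ltac:(lia)); lra. }
    replace (2 * C * M ^ 2) with (C * M ^ 2 * 2) by ring.
    apply Rmult_le_compat_l; [apply Rmult_le_pos; [exact HC|apply pow_le; lra]|lra]. }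
assert (B1 : forall k l, (k < q)%nat -> (l < q)%nat -> Rabs (De k - De l) <= 4 * C * M ^ 2).
{ intros k l Hk Hl; pose proof (B0 k Hk) as H1; pose proof (B0 l Hl) as H2.
  apply Rabs_le; apply Rabs_le_between in H1, H2; lra. }
assert (CM : 8 * C * M <= 1) by nra.
assert (M2 : M <= 2 / INR q).
{ apply Rmult_le_reg_r with (INR q); [lra|].
  replace (2 / INR q * INR q) with (2 * 1) by (field; lra); rewrite <- Hs.
  assert (H : sumR q (fun _ => M / 2) <= sumR q De).
  { apply sumR_le; intros l Hl; pose proof (B1 km l Hkm Hl) as H; fold M in H.
    apply Rabs_le_between in H; assert (4 * C * M ^ 2 <= M / 2) by nra; lra. }
  rewrite sumR_const in H; lra. }
assert (M3 : M ^ 2 <= 4 / INR q ^ 2).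
{ replace (4 / INR q ^ 2) with ((2 / INR q) ^ 2) by (field; lra); apply pow_incr; lra. }
intros k Hk.
assert (E : De k - / INR q = sumR q (fun l => De k - De l) * / INR q).
{ rewrite sumR_minus, sumR_const, Hs; field; lra. }
rewrite E, Rabs_mult, (Rabs_pos_eq (/ _)) by (inv_nonneg).
apply Rle_trans with (INR q * (4 * C * M ^ 2) * / INR q).
- apply Rmult_le_compat_r; [inv_nonneg|].
  apply sumR_abs_le_const; intros; now apply B1.
- replace (INR q * (4 * C * M ^ 2) * / INR q) with (4 * C * M ^ 2) by (field; lra).
  replace (16 * C / INR q ^ 2) with (4 * C * (4 / INR q ^ 2)) by (field; lra).
  apply Rmult_le_compat_l; lra.
Qed.

Definition prim (f : R -> R) (y : R) : R := integ f 0 y.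

Lemma lip_prim (f : R -> R) (B : R) : continuity f -> (forall y, Rabs (f y) <= B) ->
  lip B (prim f).
Proof. intros Cf HB; apply (lip_derive _ _ f); [|exact HB]; intro; now apply is_derive_integ. Qed.

(* Summing the second differences [- f / q^4] twice. *)
Lemma second_order_positions (f : R -> R) (L B K1 K2 : R) :
  lip L f -> (forall y, Rabs (f y) <= B) -> 0 <= K1 -> 0 <= K2 ->
  exists K, 0 <= K /\ forall q x, (1 <= q)%nat -> x 0%nat = 0 -> x q = 1 ->
  (forall k, (k < q)%nat -> Rabs (x (S k) - x k - / INR q) <= K1 / INR q ^ 2) ->
  (forall j, (S j < q)%nat ->
     Rabs ((x (S (S j)) - x (S j)) - (x (S j) - x j) + f (x (S j)) / INR q ^ 4) <= K2 / INR q ^ 5) ->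
  (forall k, (k <= q)%nat -> Rabs (x k - INR k / INR q) <= K / INR q) /\
  (forall k, (k < q)%nat ->
     Rabs (x (S k) - x k - (/ INR q + (prim (prim f) 1 - prim f (INR k / INR q)) / INR q ^ 3))
       <= K / INR q ^ 4) /\
  (forall k, (k <= q)%nat ->
     Rabs (x k - (INR k / INR q
       + (INR k / INR q * prim (prim f) 1 - prim (prim f) (INR k / INR q)) / INR q ^ 2))
       <= K / INR q ^ 3).
Proof.
intros HL HB K10 K20.
assert (L0 := lip_nonneg _ _ HL); assert (B0 : 0 <= B) by (eapply Rle_trans; [apply Rabs_pos|apply (HB 0)]).
assert (Cf := lip_continuity _ _ HL); assert (LI := lip_prim f B Cf HB).
set (K3 := K2 + L * (K1 + 1) + L).
assert (K30 : 0 <= K3) by (unfold K3; nra).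
exists (K1 + 2 * (K3 + B)); split; [lra|].
intros q x Hq X0 X1 HD HS; assert (Q := INR_pos q Hq); set (Q_ := INR q) in *.
assert (IQ : 0 < / Q_) by (inv_pos).
assert (P1 : forall k, (k <= q)%nat -> INR k <= Q_) by (intros; now apply le_INR).
assert (D2 : forall c n, 0 <= c -> 0 <= c / Q_ ^ n).
{ intros c n Hc; apply Rmult_le_pos; [exact Hc|inv_nonneg]. }
assert (A1 : forall k, (k <= q)%nat -> Rabs (x k - INR k / Q_) <= K1 / Q_).
{ intros k Hk.
  assert (E : x k - INR k / Q_ = sumR k (fun i => x (S i) - x i - / Q_)).
  { rewrite sumR_minus, sumR_telescope, sumR_const, X0; unfold Rdiv; ring. }
  rewrite E; eapply Rle_trans; [apply sumR_abs_le_const with (c := K1 / Q_ ^ 2)|].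
  - intros i Hi; apply HD; lia.
  - replace (K1 / Q_) with (Q_ * (K1 / Q_ ^ 2)) by (field; lra).
    apply Rmult_le_compat_r; auto. }
(* First summation: the second differences add up to [- prim f / q^3]. By [A1], replacing [x (S j)]
   by [j/q] inside [f] costs only [O(1/q)] per term. *)
assert (A2 : forall k, (k < q)%nat ->
  Rabs (x (S k) - x k - (x 1%nat - x 0%nat) + prim f (INR k / Q_) / Q_ ^ 3) <= K3 / Q_ ^ 4).
{ intros k Hk.
  set (S1 := sumR k (fun j => x (S (S j)) - x (S j) - (x (S j) - x j) + f (x (S j)) / Q_ ^ 4)).
  set (S2 := sumR k (fun j => f (INR j / Q_) - f (x (S j)))).
  set (S3 := sumR k (fun j => f (INR j / Q_)) / Q_ - prim f (INR k / Q_)).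
  assert (E : x (S k) - x k - (x 1%nat - x 0%nat) + prim f (INR k / Q_) / Q_ ^ 3
     = S1 + S2 / Q_ ^ 4 - S3 / Q_ ^ 3).
  { unfold S1, S2, S3; rewrite sumR_plus, (sumR_telescope k (fun j => x (S j) - x j)), sumR_minus.
    rewrite (sumR_ext k (fun j => f (x (S j)) / Q_ ^ 4) (fun j => / Q_ ^ 4 * f (x (S j))))
      by (intros; unfold Rdiv; ring).
    rewrite sumR_scal; field; lra. }
  assert (B1 : Rabs S1 <= K2 / Q_ ^ 4).
  { eapply Rle_trans; [apply sumR_abs_le_const with (c := K2 / Q_ ^ 5)|].
    - intros j Hj; apply HS; lia.
    - replace (K2 / Q_ ^ 4) with (Q_ * (K2 / Q_ ^ 5)) by (field; lra).
      apply Rmult_le_compat_r; [now apply D2|apply P1; lia]. }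
  assert (B2 : Rabs S2 <= L * (K1 + 1)).
  { eapply Rle_trans; [apply sumR_abs_le_const with (c := L * (K1 + 1) / Q_)|].
    - intros j Hj; eapply Rle_trans; [apply HL|].
      replace (L * (K1 + 1) / Q_) with (L * (K1 / Q_ + / Q_)) by (field; lra).
      apply Rmult_le_compat_l; [exact L0|].
      replace (INR j / Q_ - x (S j)) with (- (x (S j) - INR (S j) / Q_) - / Q_)
        by (rewrite S_INR; field; lra).
      pose proof (A1 (S j) ltac:(lia)) as H; apply Rabs_le; apply Rabs_le_between in H; lra.
    - replace (L * (K1 + 1)) with (Q_ * (L * (K1 + 1) / Q_)) at 2 by (field; lra).
      apply Rmult_le_compat_r; [|apply P1; lia].
      apply Rmult_le_pos; [apply Rmult_le_pos; lra|lra]. }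
  assert (B3 : Rabs S3 <= L / Q_).
  { eapply Rle_trans; [apply (riemann_sum_lip L f q k HL Hq)|].
    replace (L / Q_) with (Q_ * (L / Q_ ^ 2)) by (field; lra).
    apply Rmult_le_compat_r; [now apply D2|apply P1; lia]. }
  assert (B2' : Rabs (S2 / Q_ ^ 4) <= L * (K1 + 1) / Q_ ^ 4).
  { unfold Rdiv; rewrite Rabs_mult, (Rabs_pos_eq (/ _)) by (inv_nonneg).
    apply Rmult_le_compat_r; [inv_nonneg|exact B2]. }
  assert (B3' : Rabs (S3 / Q_ ^ 3) <= L / Q_ ^ 4).
  { unfold Rdiv at 1; rewrite Rabs_mult, (Rabs_pos_eq (/ _)) by (inv_nonneg).
    replace (L / Q_ ^ 4) with (L / Q_ * / Q_ ^ 3) by (field; lra).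
    apply Rmult_le_compat_r; [inv_nonneg|exact B3]. }
  rewrite E; replace (K3 / Q_ ^ 4) with (K2 / Q_ ^ 4 + L * (K1 + 1) / Q_ ^ 4 + L / Q_ ^ 4)
    by (unfold K3; field; lra).
  apply Rabs_le; apply Rabs_le_between in B1, B2', B3'; lra. }
set (d0 := x 1%nat - x 0%nat) in *.
assert (A3 : forall k, (k <= q)%nat ->
  Rabs (x k - INR k * d0 + prim (prim f) (INR k / Q_) / Q_ ^ 2) <= (K3 + B) / Q_ ^ 3).
{ intros k Hk.
  set (S1 := sumR k (fun i => x (S i) - x i - d0 + prim f (INR i / Q_) / Q_ ^ 3)).
  set (S3 := sumR k (fun j => prim f (INR j / Q_)) / Q_ - prim (prim f) (INR k / Q_)).
  assert (E : x k - INR k * d0 + prim (prim f) (INR k / Q_) / Q_ ^ 2 = S1 - S3 / Q_ ^ 2).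
  { unfold S1, S3; rewrite sumR_plus, sumR_minus, sumR_telescope, sumR_const, X0.
    rewrite (sumR_ext k (fun j => prim f (INR j / Q_) / Q_ ^ 3)
      (fun j => / Q_ ^ 3 * prim f (INR j / Q_))) by (intros; unfold Rdiv; ring).
    rewrite sumR_scal; field; lra. }
  assert (B1 : Rabs S1 <= K3 / Q_ ^ 3).
  { eapply Rle_trans; [apply sumR_abs_le_const with (c := K3 / Q_ ^ 4)|].
    - intros j Hj; apply A2; lia.
    - replace (K3 / Q_ ^ 3) with (Q_ * (K3 / Q_ ^ 4)) by (field; lra).
      apply Rmult_le_compat_r; [now apply D2|apply P1; lia]. }
  assert (B3 : Rabs S3 <= B / Q_).
  { eapply Rle_trans; [apply (riemann_sum_lip B (prim f) q k LI Hq)|].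
    replace (B / Q_) with (Q_ * (B / Q_ ^ 2)) by (field; lra).
    apply Rmult_le_compat_r; [now apply D2|apply P1; lia]. }
  assert (B3' : Rabs (S3 / Q_ ^ 2) <= B / Q_ ^ 3).
  { unfold Rdiv at 1; rewrite Rabs_mult, (Rabs_pos_eq (/ _)) by (inv_nonneg).
    replace (B / Q_ ^ 3) with (B / Q_ * / Q_ ^ 2) by (field; lra).
    apply Rmult_le_compat_r; [inv_nonneg|exact B3]. }
  rewrite E; replace ((K3 + B) / Q_ ^ 3) with (K3 / Q_ ^ 3 + B / Q_ ^ 3) by (field; lra).
  apply Rabs_le; apply Rabs_le_between in B1, B3'; lra. }
set (J1 := prim (prim f) 1).
(* The first gap [d0] is the free constant of the double summation; the closing condition [x q = 1]
   determines it. *)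
assert (A4 : Rabs (d0 - (/ Q_ + J1 / Q_ ^ 3)) <= (K3 + B) / Q_ ^ 4).
{ pose proof (A3 q ltac:(lia)) as H; fold Q_ in H; rewrite X1 in H.
  replace (Q_ / Q_) with 1 in H by (field; lra); fold J1 in H.
  replace (d0 - (/ Q_ + J1 / Q_ ^ 3)) with (- (1 - Q_ * d0 + J1 / Q_ ^ 2) * / Q_) by (field; lra).
  rewrite Rabs_mult, Rabs_Ropp, (Rabs_pos_eq (/ Q_)) by lra.
  replace ((K3 + B) / Q_ ^ 4) with ((K3 + B) / Q_ ^ 3 * / Q_) by (field; lra).
  apply Rmult_le_compat_r; lra. }
assert (W : forall a n, 0 <= a -> a <= K1 + 2 * (K3 + B) -> a / Q_ ^ n <= (K1 + 2 * (K3 + B)) / Q_ ^ n).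
{ intros a n _ Ha; apply Rmult_le_compat_r; [inv_nonneg|exact Ha]. }
split; [|split].
- intros k Hk; eapply Rle_trans; [now apply A1|].
  apply Rmult_le_compat_r; lra.
- intros k Hk; pose proof (A2 k Hk) as H.
  apply Rle_trans with ((2 * K3 + B) / Q_ ^ 4); [|apply W; lra].
  replace ((2 * K3 + B) / Q_ ^ 4) with (K3 / Q_ ^ 4 + (K3 + B) / Q_ ^ 4) by (field; lra).
  replace ((J1 - prim f (INR k / Q_)) / Q_ ^ 3) with (J1 / Q_ ^ 3 - prim f (INR k / Q_) / Q_ ^ 3)
    by (field; lra).
  apply Rabs_le; apply Rabs_le_between in H, A4; lra.
- intros k Hk; pose proof (A3 k Hk) as H.
  apply Rle_trans with ((2 * (K3 + B)) / Q_ ^ 3); [|apply W; lra].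
  assert (H4 : Rabs (INR k * (d0 - (/ Q_ + J1 / Q_ ^ 3))) <= (K3 + B) / Q_ ^ 3).
  { rewrite Rabs_mult, (Rabs_pos_eq (INR k)) by apply pos_INR.
    replace ((K3 + B) / Q_ ^ 3) with (Q_ * ((K3 + B) / Q_ ^ 4)) by (field; lra).
    apply Rmult_le_compat; try apply Rabs_pos; [apply pos_INR|now apply P1|exact A4]. }
  replace (2 * (K3 + B) / Q_ ^ 3) with ((K3 + B) / Q_ ^ 3 + (K3 + B) / Q_ ^ 3) by (field; lra).
  replace (INR k * (d0 - (/ Q_ + J1 / Q_ ^ 3)))
    with (INR k * d0 - INR k / Q_ - INR k / Q_ * J1 / Q_ ^ 2) in H4 by (field; lra).
  replace ((INR k / Q_ * J1 - prim (prim f) (INR k / Q_)) / Q_ ^ 2)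
    with (INR k / Q_ * J1 / Q_ ^ 2 - prim (prim f) (INR k / Q_) / Q_ ^ 2) by (field; lra).
  apply Rabs_le; apply Rabs_le_between in H, H4; lra.
Qed.

(** * Asymptotics of the orbits *)

Lemma bigO_comp {I : Type} (D : I -> Prop) (h : I -> R) (r : R) (n : nat)
    (f : R * R -> R) (p : I -> R * R) :
  bigO (near_pair r) incr n f -> (forall i, D i -> near_pair r (p i)) ->
  bigO D h 1 (fun i => snd (p i)) -> bigO D h n (fun i => f (p i)).
Proof.
intros [K [K0 HK]] Hp [L [L0 HL]]; exists (K * L ^ n).
split; [apply Rmult_le_pos; [exact K0|now apply pow_le]|intros i Hi].
eapply Rle_trans; [apply HK, Hp, Hi|].
rewrite Rmult_assoc, <- Rpow_mult_distr; apply Rmult_le_compat_l; [exact K0|].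
apply pow_incr; specialize (HL i Hi); rewrite pow_1 in HL; split; [apply Rabs_pos|exact HL].
Qed.

Lemma gap_first_order {I : Type} (D : I -> Prop) (h D1 D2 u E : I -> R) (c : R) :
  small D h -> 0 < c -> (forall i, D i -> c <= D1 i) -> bigO D h 0 D2 -> bigO D h 1 u ->
  bigO D h 2 (fun i => E i - h i) ->
  bigO D h 3 (fun i => E i - (D1 i * u i + D2 i * u i ^ 2)) ->
  bigO D h 2 (fun i => u i - h i / D1 i).
Proof.
intros Sm c0 Hc OD2 Ou OE HE.
eapply bigO_ext; [eapply (bigO_mul_0 D h 2 _ _ (bigO_inv D h D1 c c0 Hc));
  eapply bigO_sub; [eapply bigO_sub|]|].
- exact OE.
- eapply (bigO_le _ _ 2 3); [exact Sm|exact HE|lia].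
- exact (bigO_mul_0 D h 2 _ _ OD2 (bigO_pow D h 1 2 u Ou)).
- intros i Hi; cbv beta; field; specialize (Hc i Hi); lra.
Qed.

(** [E] and [F] are the outgoing and the incoming Lazutkin gap at one vertex, [u] and [v] the arc
    gaps; the incoming increment is [- v], whence the sign of [D2]. As [E - F] is of order 3,
    subtracting the two expansions gives [u - v = - 2 D2 / D1 * y^2] to leading order with
    [y = h / D1], so that [u^3 - v^3] is of order 4, like [u^4 + v^4]. *)
Lemma gap_recursion {I : Type} (D : I -> Prop) (h z4 z5 D1 D2 u v E F : I -> R) (c : R) :
  small D h -> 0 < c -> (forall i, D i -> c <= D1 i) ->
  bigO D h 0 z4 -> bigO D h 0 z5 -> bigO D h 0 D1 -> bigO D h 0 D2 ->
  bigO D h 1 u -> bigO D h 1 v ->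
  bigO D h 2 (fun i => E i - h i) -> bigO D h 2 (fun i => F i - h i) ->
  bigO D h 3 (fun i => E i - (D1 i * u i + D2 i * u i ^ 2)) ->
  bigO D h 3 (fun i => F i - (D1 i * v i - D2 i * v i ^ 2)) ->
  bigO D h 5 (fun i => E i - F i + (z4 i * (u i ^ 3 - v i ^ 3) + z5 i * (u i ^ 4 + v i ^ 4))) ->
  bigO D h 5 (fun i => E i - F i
    + (- 6 * z4 i * D2 i / D1 i ^ 5 + 2 * z5 i / D1 i ^ 4) * h i ^ 4).
Proof.
intros Sm c0 Hc O4 O5 OD1 OD2 Ou Ov OE OF HE HF HEF.
assert (Nz : forall i, D i -> D1 i <> 0) by (intros i Hi; specialize (Hc i Hi); lra).
assert (OI : bigO D h 0 (fun i => / D1 i)) by exact (bigO_inv D h D1 c c0 Hc).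
assert (Oh := bigO_self D h Sm).
set (y := fun i => h i / D1 i).
assert (Oy : bigO D h 1 y).
{ eapply bigO_ext; [exact (bigO_mul_0 D h 1 _ _ OI Oh)|].
  intros i _; cbv beta; unfold y, Rdiv; ring. }
assert (Uy : bigO D h 2 (fun i => u i - y i))
  by exact (gap_first_order D h D1 D2 u E c Sm c0 Hc OD2 Ou OE HE).
assert (Vy : bigO D h 2 (fun i => v i - y i)).
{ apply (gap_first_order D h D1 (fun i => - D2 i) v F c Sm c0 Hc (bigO_opp _ _ _ _ OD2) Ov OF).
  eapply bigO_ext; [exact HF|]; intros i _; cbv beta; ring. }
assert (EF3 : bigO D h 3 (fun i => E i - F i)).
{ eapply bigO_ext; [eapply bigO_sub; [|eapply bigO_add]|].
  - eapply (bigO_le _ _ 3 5); [exact Sm|exact HEF|lia].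
  - eapply (bigO_mul_0 D h 3 z4); [exact O4|].
    exact (bigO_sub D h 3 _ _ (bigO_pow D h 1 3 u Ou) (bigO_pow D h 1 3 v Ov)).
  - eapply (bigO_le _ _ 3 4); [exact Sm| |lia].
    eapply (bigO_mul_0 D h 4 z5); [exact O5|].
    exact (bigO_add D h 4 _ _ (bigO_pow D h 1 4 u Ou) (bigO_pow D h 1 4 v Ov)).
  - intros i _; cbv beta; ring. }
assert (Sq : forall w, bigO D h 1 w -> bigO D h 2 (fun i => w i - y i) ->
  bigO D h 3 (fun i => w i ^ 2 - y i ^ 2)).
{ intros w Ow Hw; eapply bigO_ext;
    [exact (bigO_mul D h 2 1 _ _ Hw (bigO_add D h 1 _ _ Ow Oy))|].
  intros i _; cbv beta; ring. }
assert (UV : bigO D h 3 (fun i => u i - v i + 2 * D2 i / D1 i * y i ^ 2)).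
{ eapply bigO_ext; [eapply (bigO_mul_0 D h 3 _ _ OI);
    eapply bigO_sub; [eapply bigO_sub; [eapply bigO_add|]|]|].
  - exact EF3.
  - exact HF.
  - exact HE.
  - exact (bigO_mul_0 D h 3 _ _ OD2 (bigO_add D h 3 _ _ (Sq u Ou Uy) (Sq v Ov Vy))).
  - intros i Hi; cbv beta; field; now apply Nz. }
assert (UV2 : bigO D h 2 (fun i => u i - v i)).
{ eapply bigO_ext; [exact (bigO_sub D h 2 _ _ Uy Vy)|intros; cbv beta; ring]. }
assert (C3 : bigO D h 5 (fun i => u i ^ 3 - v i ^ 3 + 6 * D2 i / D1 i * y i ^ 4)).
{ eapply bigO_ext; [eapply bigO_add; [eapply (bigO_mul D h 2 3 _ _ UV2)|]|].
  - eapply bigO_add; [eapply bigO_add|].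
    + exact (Sq u Ou Uy).
    + exact (bigO_add D h 3 _ _ (bigO_mul D h 2 1 _ _ Uy Ov) (bigO_mul D h 1 2 _ _ Oy Vy)).
    + exact (Sq v Ov Vy).
  - exact (bigO_mul D h 3 2 _ _ UV
      (bigO_mul_0 D h 2 _ _ (bigO_const D h 3) (bigO_pow D h 1 2 y Oy))).
  - intros i Hi; cbv beta; field; now apply Nz. }
assert (P4 : forall w, bigO D h 1 w -> bigO D h 2 (fun i => w i - y i) ->
  bigO D h 5 (fun i => w i ^ 4 - y i ^ 4)).
{ intros w Ow Hw; eapply bigO_ext; [exact (bigO_mul D h 3 2 _ _ (Sq w Ow Hw)
    (bigO_add D h 2 _ _ (bigO_pow D h 1 2 w Ow) (bigO_pow D h 1 2 y Oy)))|].
  intros i _; cbv beta; ring. }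
eapply bigO_ext; [eapply bigO_sub; [eapply bigO_sub|]|].
- exact HEF.
- exact (bigO_mul_0 D h 5 _ _ O4 C3).
- exact (bigO_mul_0 D h 5 _ _ O5 (bigO_add D h 5 _ _ (P4 u Ou Uy) (P4 v Ov Vy))).
- intros i Hi; cbv beta; unfold y; field; now apply Nz.
Qed.

Lemma inv_sqrt_taylor (T : R) : 0 <= T ->
  Rabs (/ sqrt (1 + T) - (1 - T / 2)) <= T ^ 2.
Proof.
intro HT; set (r := sqrt (1 + T)).
assert (rr : r * r = 1 + T) by (apply sqrt_sqrt; lra).
assert (r1 : 1 <= r) by (unfold r; rewrite <- sqrt_1 at 1; apply sqrt_le_1; lra).
assert (E : / r - (1 - T / 2) = (r - 1) ^ 2 * (r + 2) / (2 * r)).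
{ replace T with (r * r - 1) by lra; field; lra. }
rewrite E, Rabs_pos_eq.
- replace (T ^ 2) with ((r - 1) ^ 2 * (r + 1) ^ 2) by (replace T with (r * r - 1) by lra; ring).
  unfold Rdiv; rewrite Rmult_assoc; apply Rmult_le_compat_l; [apply pow2_ge_0|].
  apply Rmult_le_reg_r with (2 * r); [lra|]; rewrite Rmult_assoc, Rinv_l by lra; nra.
- apply Rmult_le_pos; [apply Rmult_le_pos; [apply pow2_ge_0|lra]|inv_nonneg].
Qed.

(** With [N = m Y / X], the scaled tangent of the angle, the sine is [tan / sqrt(1 + tan^2)]; this
    contributes [- N^3 / (2 m^2)] to [m sin], while [N] differs from the gap [E] by [z4 u^3] to
    leading order. Both corrections are of order 3. *)
Lemma weight_expansion {I : Type} (D : I -> Prop) (h z4 z5 D1 m X Y E u : I -> R) (c : R) :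
  small D h -> 0 < c -> (forall i, D i -> c <= D1 i) -> (forall i, D i -> c <= m i) ->
  bigO D h 0 z4 -> bigO D h 0 z5 -> bigO D h 0 m ->
  (forall i, D i -> 0 < X i) -> bigO D h 1 u ->
  bigO D h 2 (fun i => u i - h i / D1 i) -> bigO D h 2 (fun i => E i - h i) ->
  bigO D h 5 (fun i => m i * Y i / X i - E i - (z4 i * u i ^ 3 + z5 i * u i ^ 4)) ->
  bigO D h 4 (fun i => m i * (Y i / sqrt (X i ^ 2 + Y i ^ 2))
     - (E i + (z4 i / D1 i ^ 3 - / (2 * m i ^ 2)) * h i ^ 3)).
Proof.
intros Sm c0 Hc Hm O4 O5 Om HX Ou Uy OE HN.
assert (Nz : forall i, D i -> D1 i <> 0) by (intros i Hi; specialize (Hc i Hi); lra).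
assert (Nm : forall i, D i -> m i <> 0) by (intros i Hi; specialize (Hm i Hi); lra).
assert (OI : bigO D h 0 (fun i => / D1 i)) by exact (bigO_inv D h D1 c c0 Hc).
assert (OIm : bigO D h 0 (fun i => / m i)) by exact (bigO_inv D h m c c0 Hm).
assert (Oh := bigO_self D h Sm).
set (y := fun i => h i / D1 i).
assert (Oy : bigO D h 1 y).
{ eapply bigO_ext; [exact (bigO_mul_0 D h 1 _ _ OI Oh)|].
  intros i _; cbv beta; unfold y, Rdiv; ring. }
set (N := fun i => m i * Y i / X i).
assert (Cu : forall w z, bigO D h 1 w -> bigO D h 1 z -> bigO D h 2 (fun i => w i - z i) ->
  bigO D h 4 (fun i => w i ^ 3 - z i ^ 3)).
{ intros w z Ow Oz Hw; eapply bigO_ext; [eapply (bigO_mul D h 2 2 _ _ Hw)|].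
  - exact (bigO_add D h 2 _ _ (bigO_add D h 2 _ _ (bigO_pow D h 1 2 w Ow) (bigO_mul D h 1 1 _ _ Ow Oz))
      (bigO_pow D h 1 2 z Oz)).
  - intros i _; cbv beta; ring. }
assert (O45 : bigO D h 3 (fun i => z4 i * u i ^ 3 + z5 i * u i ^ 4)).
{ eapply bigO_add; [exact (bigO_mul_0 D h 3 _ _ O4 (bigO_pow D h 1 3 u Ou))|].
  eapply (bigO_le _ _ 3 4); [exact Sm| |lia].
  exact (bigO_mul_0 D h 4 _ _ O5 (bigO_pow D h 1 4 u Ou)). }
assert (Nh : bigO D h 2 (fun i => N i - h i)).
{ eapply bigO_ext; [eapply bigO_add; [eapply bigO_add|]|].
  - eapply (bigO_le _ _ 2 5); [exact Sm|exact HN|lia].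
  - exact OE.
  - eapply (bigO_le _ _ 2 3); [exact Sm|exact O45|lia].
  - intros i _; cbv beta; unfold N; ring. }
assert (ON : bigO D h 1 N).
{ eapply bigO_ext; [eapply bigO_add; [eapply (bigO_le _ _ 1 2); [exact Sm|exact Nh|lia]|exact Oh]|].
  intros i _; cbv beta; ring. }
set (T := fun i => (N i / m i) ^ 2).
assert (OT : bigO D h 2 T).
{ eapply (bigO_pow D h 1 2).
  eapply bigO_ext; [exact (bigO_mul_0 D h 1 _ _ OIm ON)|].
  intros i _; cbv beta; unfold Rdiv; ring. }
assert (OS : bigO D h 4 (fun i => / sqrt (1 + T i) - (1 - T i / 2))).
{ destruct (bigO_pow D h 2 2 T OT) as [K [K0 HK]]; exists K; split; [exact K0|intros i Hi].
  assert (0 <= T i) by apply pow2_ge_0.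
  eapply Rle_trans; [now apply inv_sqrt_taylor|].
  eapply Rle_trans; [apply Rle_abs|now apply HK]. }
assert (ES : forall i, D i -> m i * (Y i / sqrt (X i ^ 2 + Y i ^ 2)) = N i * / sqrt (1 + T i)).
{ intros i Hi; assert (Xp := HX i Hi); assert (mp := Nm i Hi).
  assert (ET : X i ^ 2 + Y i ^ 2 = X i ^ 2 * (1 + T i)) by (unfold T, N; field; lra).
  assert (0 <= T i) by apply pow2_ge_0.
  rewrite ET, sqrt_mult, sqrt_pow2 by (try apply pow2_ge_0; lra).
  assert (0 < sqrt (1 + T i)) by (apply sqrt_lt_R0; lra).
  unfold N; field; lra. }
eapply bigO_ext; [eapply bigO_add; [eapply bigO_add; [eapply bigO_add|]|eapply bigO_sub]|].
- eapply (bigO_le _ _ 4 5); [exact Sm|exact HN|lia].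
- exact (bigO_mul_0 D h 4 _ _ O5 (bigO_pow D h 1 4 u Ou)).
- eapply (bigO_le _ _ 4 5); [exact Sm|exact (bigO_mul D h 1 4 _ _ ON OS)|lia].
- exact (bigO_mul_0 D h 4 _ _ O4 (Cu u y Ou Oy Uy)).
- refine (bigO_mul_0 D h 4 _ _ _ (Cu N h ON Oh Nh)).
  exact (bigO_mul_0 D h 0 _ _ (bigO_const D h (1 / 2)) (bigO_mul_0 D h 0 _ _ OIm OIm)).
- intros i Hi; cbv beta; rewrite (ES i Hi).
  set (S := / sqrt (1 + T i)); unfold T, y; fold (N i); field; auto.
Qed.

Lemma sym_domain_curv (g1 g2 d1 d2 e1 e2 : R -> R) :
  sym_domain 8 g1 g2 d1 d2 e1 e2 ->
  Ck 7 (curv d1 d2 e1 e2) /\ forall s, 0 < curv d1 d2 e1 e2 s.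
Proof.
intros (Cg1 & Cg2 & Hd1 & Hd2 & He1 & He2 & _ & _ & _ & _ & Hk & _).
assert (Cd1 : Ck 8 d1) by (apply (Ck_derive 8 g1); auto; intro; now apply is_derive_Reals).
assert (Cd2 : Ck 8 d2) by (apply (Ck_derive 8 g2); auto; intro; now apply is_derive_Reals).
assert (Ce1 : Ck 7 e1) by (apply (Ck_derive 7 d1); auto; intro; now apply is_derive_Reals).
assert (Ce2 : Ck 7 e2) by (apply (Ck_derive 7 d2); auto; intro; now apply is_derive_Reals).
split; [|exact Hk]; apply Ck_minus; apply Ck_mult; auto; now apply Ck_weaken.
Qed.

Lemma Rpower_inv_neg (k p : R) : 0 < k -> Rpower (/ k) p = Rpower k (- p).
Proof. intro Hk; unfold Rpower; f_equal; rewrite ln_Rinv by exact Hk; ring. Qed.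

(** The given coordinate is prescribed only on [[0,1]], but local expansions at a base point near 0
    or 1 leave this interval; the integral with variable end point continues it to the whole
    line. *)
Lemma lazutkin_extension (g1 g2 d1 d2 e1 e2 : R -> R) (C : R) (x : R -> R) :
  sym_domain 8 g1 g2 d1 d2 e1 e2 -> lazutkin d1 d2 e1 e2 C x ->
  0 < C /\ exists xt : R -> R,
  (forall s, is_derive xt s (C * Rpower (curv d1 d2 e1 e2 s) (2 / 3))) /\
  xt 0 = 0 /\ xt 1 = 1 /\ forall s, 0 <= s <= 1 -> x s = xt s.
Proof.
intros Hd [[I [HI EC]] Hx]; destruct (sym_domain_curv _ _ _ _ _ _ Hd) as [Ckk Kp].
set (f := fun s => Rpower (curv d1 d2 e1 e2 s) (2 / 3)).
assert (Cf : continuity f) by (apply (Ck_continuity 7), Ck_Rpower; assumption).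
assert (Ef : forall s, Rpower (rho d1 d2 e1 e2 s) (- (2 / 3)) = f s).
{ intro s; unfold rho, f; fold (curv d1 d2 e1 e2 s).
  rewrite Rpower_inv_neg, Ropp_involutive by apply Kp; reflexivity. }
assert (Ei : forall b, integ (fun s => Rpower (rho d1 d2 e1 e2 s) (- (2 / 3))) 0 b = integ f 0 b).
{ intro b; apply integ_ext; auto. }
assert (I1 : I = integ f 0 1) by (rewrite <- Ei; symmetry; now apply is_RInt_integ).
assert (Ip : 0 < I).
{ destruct (MVT_gen (integ f 0) 0 1 f) as [c [_ E]].
  - intros y _; now apply is_derive_integ.
  - intros y _; apply derivable_continuous_pt; exists (f y).
    apply is_derive_Reals; now apply is_derive_integ.
  - rewrite integ_nil, <- I1 in E; assert (0 < f c) by apply exp_pos; lra. }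
split; [rewrite EC; now apply Rinv_0_lt_compat|].
exists (fun s => C * integ f 0 s); split; [|split; [|split]].
- intro s; eapply is_derive_eq.
  + apply (is_derive_mul (fun _ => C)); [derive_const|].
    now apply is_derive_integ.
  + unfold f; ring.
- rewrite integ_nil; ring.
- rewrite <- I1, EC; field; lra.
- intros s Hs; destruct (Hx s Hs) as [J [HJ ->]]; f_equal.
  rewrite <- Ei; symmetry; now apply is_RInt_integ.
Qed.

(** Freezes a function outside [[0,1]], turning Lipschitz and sup bounds there into bounds on the
    whole line, as [lip] demands. *)
Definition clamp (y : R) : R := Rmax 0 (Rmin 1 y).

Lemma clamp_range (y : R) : 0 <= clamp y <= 1.
Proof.
unfold clamp; split; [apply Rmax_l|apply Rmax_lub; [lra|apply Rmin_l]].
Qed.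

Lemma clamp_id (y : R) : 0 <= y <= 1 -> clamp y = y.
Proof. intro H; unfold clamp; rewrite Rmin_right, Rmax_right; lra. Qed.

Lemma lip_clamp : lip 1 clamp.
Proof.
intros s t; unfold clamp, Rmin, Rmax.
destruct (Rle_dec 1 s), (Rle_dec 1 t);
repeat match goal with |- context [Rle_dec ?a ?b] => destruct (Rle_dec a b) end;
unfold Rabs; repeat match goal with |- context [Rcase_abs ?a] => destruct (Rcase_abs a) end; lra.
Qed.

(** The recursion for the gaps has coefficients in arc length, while its unknowns are Lazutkin
    coordinates; composing with the inverse [sg] closes it. The argument is clamped, so [sg] is
    Lipschitz on the whole line. *)
Lemma increasing_inverse (xt xt' : R -> R) (c : R) :
  (forall s, is_derive xt s (xt' s)) -> 0 < c -> (forall s, 0 <= s <= 1 -> c <= xt' s) ->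
  xt 0 = 0 -> xt 1 = 1 ->
  (forall a b, 0 <= a <= b -> b <= 1 -> c * (b - a) <= xt b - xt a) /\
  exists sg L, lip L sg /\ (forall y, 0 <= sg y <= 1) /\
    forall s, 0 <= s <= 1 -> sg (xt s) = s.
Proof.
intros Hd c0 Hc X0 X1; assert (Cx := derive_continuity _ _ Hd).
assert (Inc : forall a b, 0 <= a <= b -> b <= 1 -> c * (b - a) <= xt b - xt a).
{ intros a b Hab Hb; destruct (MVT_gen xt a b xt') as [z [Hz E]].
  - intros; apply Hd.
  - intros; apply Cx.
  - rewrite Rmin_left, Rmax_right in Hz by lra; rewrite E.
    apply Rmult_le_compat_r; [lra|apply Hc; lra]. }
assert (Inv : forall a b, 0 <= a <= 1 -> 0 <= b <= 1 -> c * Rabs (a - b) <= Rabs (xt a - xt b)).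
{ intros a b Ha Hb; destruct (Rle_dec a b) as [H|H].
  - rewrite (Rabs_minus_sym a), (Rabs_minus_sym (xt a)), (Rabs_pos_eq (b - a)) by lra.
    eapply Rle_trans; [now apply Inc|apply Rle_abs].
  - rewrite (Rabs_pos_eq (a - b)) by lra; eapply Rle_trans; [apply Inc; lra|apply Rle_abs]. }
split; [exact Inc|].
assert (Ex : forall y, {s | 0 <= s <= 1 /\ xt s = clamp y}).
{ intro y; destruct (IVT_gen xt 0 1 (clamp y) Cx) as [s [Hs E]].
  - rewrite X0, X1, Rmin_left, Rmax_right by lra; apply clamp_range.
  - exists s; rewrite Rmin_left, Rmax_right in Hs by lra; auto. }
set (sg := fun y => proj1_sig (Ex y)).
assert (Hsg : forall y, 0 <= sg y <= 1 /\ xt (sg y) = clamp y) by (intro y; apply (proj2_sig (Ex y))).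
exists sg, (/ c); split; [|split].
- intros y z; destruct (Hsg y) as [R1 E1], (Hsg z) as [R2 E2].
  apply Rmult_le_reg_l with c; [exact c0|].
  rewrite <- Rmult_assoc, Rinv_r, Rmult_1_l by lra.
  eapply Rle_trans; [now apply Inv|]; rewrite E1, E2.
  eapply Rle_trans; [apply lip_clamp|lra].
- intro y; apply Hsg.
- intros s Hs; destruct (Hsg (xt s)) as [R1 E1].
  rewrite clamp_id in E1.
  + pose proof (Inv (sg (xt s)) s R1 Hs) as H; rewrite E1, Rminus_diag, Rabs_R0 in H.
    pose proof (Rabs_pos (sg (xt s) - s)).
    assert (Z : Rabs (sg (xt s) - s) = 0) by nra.
    apply Rabs_eq_0 in Z; lra.
  + pose proof (Inc 0 s ltac:(lra) ltac:(lra)) as H1; pose proof (Inc s 1 ltac:(lra) ltac:(lra)) as H2.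
    rewrite X0 in H1; rewrite X1 in H2; split; nra.
Qed.

Lemma lip01_comp (f sg : R -> R) (Ls : R) : lip01 f -> lip Ls sg -> (forall y, 0 <= sg y <= 1) ->
  exists L, lip L (fun y => f (sg y)) /\ forall y, Rabs (f (sg y)) <= L.
Proof.
intros Hf Hs Hr; destruct (lip01_bounded f Hf) as [B [B0 HB]]; destruct Hf as [L [L0 HL]].
assert (Ls0 := lip_nonneg _ _ Hs).
exists (L * Ls + B); split.
- intros s t; eapply Rle_trans; [apply HL; apply Hr|].
  apply Rle_trans with (L * (Ls * Rabs (s - t))).
  + apply Rmult_le_compat_l; [exact L0|apply Hs].
  + rewrite <- Rmult_assoc; apply Rmult_le_compat_r; [apply Rabs_pos|lra].
- intro y; eapply Rle_trans; [apply HB, Hr|]; assert (0 <= L * Ls) by (now apply Rmult_le_pos); lra.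
Qed.

Lemma lip_le (L M : R) (f : R -> R) : lip L f -> L <= M -> lip M f.
Proof.
intros H HM s t; eapply Rle_trans; [apply H|apply Rmult_le_compat_r; [apply Rabs_pos|exact HM]].
Qed.

Lemma bigO_pull {I J : Type} (D : I -> Prop) (D' : J -> Prop) (h : I -> R) (h' : J -> R)
    (n : nat) (f : I -> R) (p : J -> I) :
  bigO D h n f -> (forall j, D' j -> D (p j) /\ h' j = h (p j)) ->
  bigO D' h' n (fun j => f (p j)).
Proof.
intros [K [K0 HK]] H; exists K; split; [exact K0|].
intros j Hj; destruct (H j Hj) as [H1 ->]; auto.
Qed.

Lemma sin_refl_frame (g1 g2 d1 d2 : R -> R) (q k : nat) (s : nat -> R) :
  period1 g1 -> period1 g2 -> (forall t, d1 t ^ 2 + d2 t ^ 2 = 1) ->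
  sym_polygon q s -> (k < q)%nat ->
  let X := tangent_part g1 g2 d1 d2 (s k) (closed q s (S k)) in
  let Y := normal_part g1 g2 d1 d2 (s k) (closed q s (S k)) in
  0 < Y -> sin_refl g1 g2 d1 d2 q s k = Y / sqrt (X ^ 2 + Y ^ 2).
Proof.
intros P1 P2 Hu Hs Hk X Y HY; unfold sin_refl.
rewrite (period1_closed g1 q k s P1 Hs Hk), (period1_closed g2 q k s P2 Hs Hk).
set (b := closed q s (S k)) in *.
assert (EL : (g1 b - g1 (s k)) ^ 2 + (g2 b - g2 (s k)) ^ 2 = X ^ 2 + Y ^ 2).
{ unfold X, Y, tangent_part, normal_part; fold b.
  transitivity ((d1 (s k) ^ 2 + d2 (s k) ^ 2) * ((g1 b - g1 (s k)) ^ 2 + (g2 b - g2 (s k)) ^ 2)); [rewrite Hu|]; ring. }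
rewrite EL; change (d1 (s k) * (g1 b - g1 (s k)) + d2 (s k) * (g2 b - g2 (s k))) with X.
set (L := sqrt (X ^ 2 + Y ^ 2)).
assert (X20 : 0 <= X ^ 2) by apply pow2_ge_0.
assert (L0 : 0 < L) by (apply sqrt_lt_R0; nra).
assert (LL : L * L = X ^ 2 + Y ^ 2) by (apply sqrt_sqrt; nra).
assert (E : 1 - Rsqr (X / L) = (Y / L) ^ 2).
{ unfold Rsqr; replace (1 - X / L * (X / L)) with ((L * L - X ^ 2) * / (L * L)) by (field; lra).
  rewrite LL at 1; field; lra. }
assert (XL : Rsqr (X / L) <= 1) by (pose proof (pow2_ge_0 (Y / L)); lra).
rewrite sin_acos, E.
- apply sqrt_pow2; left; now apply Rdiv_lt_0_compat.
- rewrite <- Rsqr_1 in XL; apply Rsqr_le_abs_0 in XL; rewrite Rabs_R1 in XL.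
  now apply Rabs_le_between.
Qed.

Lemma chord_bounds (X Y t c K : R) : 0 < t -> 0 < c ->
  X ^ 2 + Y ^ 2 <= t ^ 2 - c * t ^ 4 -> Rabs (X - t) <= K * t ^ 3 ->
  sqrt (X ^ 2 + Y ^ 2) <= t - c / 2 * t ^ 3 /\ t - K * t ^ 3 <= sqrt (X ^ 2 + Y ^ 2).
Proof.
intros Ht Hc H1 H2; assert (X2 := pow2_ge_0 X); assert (Y2 := pow2_ge_0 Y).
assert (t2 : 0 < t ^ 2) by (apply pow_lt; lra).
split.
- assert (Hct : c * t ^ 2 <= 1).
  { apply Rmult_le_reg_r with (t ^ 2); [exact t2|].
    replace (c * t ^ 2 * t ^ 2) with (c * t ^ 4) by ring; lra. }
  assert (0 <= t - c / 2 * t ^ 3).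
  { replace (t - c / 2 * t ^ 3) with (t * (1 - c * t ^ 2 / 2)) by field.
    apply Rmult_le_pos; lra. }
  rewrite <- (sqrt_pow2 (t - c / 2 * t ^ 3)) by assumption.
  apply sqrt_le_1; [lra|apply pow2_ge_0|].
  replace ((t - c / 2 * t ^ 3) ^ 2) with (t ^ 2 - c * t ^ 4 + (c / 2 * t ^ 3) ^ 2) by field.
  pose proof (pow2_ge_0 (c / 2 * t ^ 3)); lra.
- apply Rle_trans with X; [apply Rabs_le_between in H2; lra|].
  apply Rle_trans with (Rabs X); [apply Rle_abs|].
  rewrite <- (sqrt_Rsqr_abs X); apply sqrt_le_1; unfold Rsqr; lra.
Qed.

Lemma angle_law (g1 g2 d1 d2 : R -> R) (a s b : R) : d1 s ^ 2 + d2 s ^ 2 = 1 ->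
  let X := tangent_part g1 g2 d1 d2 s b in let Y := normal_part g1 g2 d1 d2 s b in
  let X' := tangent_part g1 g2 d1 d2 s a in let Y' := normal_part g1 g2 d1 d2 s a in
  0 < X -> 0 < Y -> X' < 0 -> 0 < Y' ->
  cos_in g1 g2 d1 d2 a s = cos_out g1 g2 d1 d2 s b -> Y / X = - (Y' / X').
Proof.
intros Hu X Y X' Y' HX HY HX' HY' E; apply equal_cosines; auto.
assert (Cs : chord g1 g2 a s = chord g1 g2 s a) by (unfold chord, dist2; f_equal; ring).
unfold cos_in, cos_out in E; rewrite Cs, !(chord_frame g1 g2 d1 d2) in E by exact Hu.
fold X Y X' Y' in E.
replace ((g1 b - g1 s) * d1 s + (g2 b - g2 s) * d2 s) with X in E by (unfold X, tangent_part; ring).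
replace ((g1 s - g1 a) * d1 s + (g2 s - g2 a) * d2 s) with (- X') in E by (unfold X', tangent_part; ring).
now symmetry.
Qed.

(** At an inner vertex the reflection law equates the scaled tangents [m Y / X] of the two adjacent
    edges up to sign, with one and the same factor [m], so consecutive Lazutkin gaps differ only by
    the [z4] and [z5] terms and an error of order 5. A first, crude use of this recursion makes all
    gaps comparable to [1/q]; only then can it be expanded in powers of [1/q] and summed. *)
Lemma orbit_expansion (g1 g2 d1 d2 e1 e2 : R -> R) (C : R) (x : R -> R) :
  sym_domain 8 g1 g2 d1 d2 e1 e2 -> lazutkin d1 d2 e1 e2 C x ->
  exists (al b : R -> R) A K q1, lip A al /\ lip A b /\
    (forall t, Rabs (al t) <= A) /\ (forall t, Rabs (b t) <= A) /\ 0 <= K /\ (2 <= q1)%nat /\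
    forall q s, (q1 <= q)%nat -> max_sym_orbit g1 g2 q s ->
    near_equidistributed al b K q (fun k => x (s k))
      (fun k => 2 * C * Rpower (rho d1 d2 e1 e2 (s k)) (1 / 3) * sin_refl g1 g2 d1 d2 q s k).
Proof.
intros Hdom Hlaz.

(* Local expansions and constants of the domain *)
destruct (lazutkin_extension _ _ _ _ _ _ C x Hdom Hlaz) as [C0 [xt [Dxt [X0 [X1 Ext]]]]].
destruct (sym_domain_curv _ _ _ _ _ _ Hdom) as [Ckk Kp].
destruct (curve_local_expansion g1 g2 d1 d2 e1 e2 xt C Hdom Dxt)
  as (Lk & Lm & LD1 & D2 & z4 & z5 & LD2 & L4 & L5 & EX & EY & ED & EZ).
set (k := curv d1 d2 e1 e2) in *.
set (m := fun s => 2 * C * Rpower (k s) (- (1 / 3))) in *.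
set (D1 := fun s => C * Rpower (k s) (2 / 3)) in *.
set (X := fun p : R * R => tangent_part g1 g2 d1 d2 (fst p) (fst p + snd p)) in *.
set (Y := fun p : R * R => normal_part g1 g2 d1 d2 (fst p) (fst p + snd p)) in *.
set (D := fun p : R * R => xt (fst p + snd p) - xt (fst p)) in *.
assert (Hdom' := Hdom).
destruct Hdom' as (_ & _ & Hd1 & Hd2 & _ & _ & P1 & P2 & Hu & _).
assert (G1 : forall s, is_derive g1 s (d1 s)) by (intro; now apply is_derive_Reals).
assert (G2 : forall s, is_derive g2 s (d2 s)) by (intro; now apply is_derive_Reals).
assert (CRp : forall p, continuity (fun s => Rpower (k s) p))
  by (intro p; apply (Ck_continuity 7), Ck_Rpower; assumption).
destruct (positive_lower_bound k (Ck_continuity _ _ Ckk) Kp) as [k0 [k00 Hk0]].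
destruct (positive_lower_bound D1) as [c1 [c10 Hc1]].
{ apply (continuity_scal (fun s => Rpower (k s) (2 / 3))), CRp. }
{ intro; apply Rmult_lt_0_compat; [lra|apply exp_pos]. }
destruct (positive_lower_bound m) as [cm [cm0 Hcm]].
{ apply (continuity_scal (fun s => Rpower (k s) (- (1 / 3)))), CRp. }
{ intro; apply Rmult_lt_0_compat; [lra|apply exp_pos]. }
destruct (angle_ratio_expansion X Y D k m z4 z5 k0 k00 Hk0 Lk Lm L4 L5 EX EY EZ)
  as (r & c & Hr & c0 & Hloc & EX3 & EN).
clear EX EY EZ.
assert (EX3' := EX3); destruct EX3' as [KX [KX0 HKX]].
destruct (increasing_inverse xt D1 c1 Dxt c10 Hc1 X0 X1) as [Inc [sg [Ls [Lsg [Rsg Hsg]]]]].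
assert (Hch : forall s t, 0 <= s <= 1 -> 0 < t <= r ->
  chord g1 g2 s (s + t) <= t - c / 2 * t ^ 3 /\ t - KX * t ^ 3 <= chord g1 g2 s (s + t)).
{ intros s t Hs Ht; rewrite (chord_frame g1 g2 d1 d2) by apply Hu.
  assert (Np : near_pair r (s, t)) by (split; simpl; [exact Hs|rewrite Rabs_pos_eq; lra]).
  apply chord_bounds; [lra|exact c0|apply (Hloc _ Np)|].
  pose proof (HKX _ Np) as H; unfold incr in H; simpl snd in H; rewrite (Rabs_pos_eq t) in H by lra.
  exact H. }
destruct (lip01_bounded z4 L4) as [B4 [B40 HB4]].
destruct (lip01_bounded z5 L5) as [B5 [B50 HB5]].
destruct (lip01_bounded D1 LD1) as [BD [BD0 HBD]].
assert (EN' := EN); destruct EN' as [KN [KN0 HKN]].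
(* Cubes of arc gaps are bounded by cubes of Lazutkin gaps, which are at least [c1] times the arc
   gaps; hence the factor [c1^3]. *)
set (CH := (B4 + B5 + KN) / c1 ^ 3).
assert (CH0 : 0 <= CH).
{ apply Rmult_le_pos; [lra|inv_nonneg]. }
(* Short enough for the local expansions and for the condition [8 C M0 <= 1] of [gaps_comparable], a
   Lazutkin gap being at most [BD * eta]. *)
set (eta := Rmin r (/ (8 * CH * BD + 1))).
assert (CB : 0 <= 8 * CH * BD) by (apply Rmult_le_pos; lra).
assert (eta0 : 0 < eta) by (apply Rmin_glb_lt; [lra|inv_pos]).
assert (eta1 : eta <= r) by apply Rmin_l.
assert (eta2 : 8 * CH * (BD * eta) <= 1).
{ apply Rle_trans with ((8 * CH * BD + 1) * / (8 * CH * BD + 1)); [|right; field; lra].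
  rewrite <- Rmult_assoc; apply Rmult_le_compat; [lra|lra|lra|apply Rmin_r]. }
destruct (gaps_small g1 g2 d1 d2 r (c / 2) KX G1 G2 Hu P1 P2 Hr ltac:(lra) KX0
  ltac:(intros; now apply Hch) ltac:(intros; now apply Hch) eta eta0) as [q1 [Hq1 Hgaps]].

(* Edges of an orbit as base points with signed increments *)
set (S_ := fun (q : nat) (s : nat -> R) k => closed q s k).
set (gap := fun q s k => S_ q s (S k) - S_ q s k).
set (De := fun q s k => xt (S_ q s (S k)) - xt (S_ q s k)).
(* Edge [k] seen from its two ends: [po] looks forward from vertex [k], [pi] backward from vertex
   [k + 1]. The law at vertex [j + 1] thus pairs [po] at [S j] with [pi] at [j]. *)
set (po := fun q s k => (S_ q s k, gap q s k)).
set (pi := fun q s k => (S_ q s (S k), - gap q s k)).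
assert (Fgap : forall q s k, (q1 <= q)%nat -> max_sym_orbit g1 g2 q s -> (k < q)%nat ->
  0 < gap q s k <= eta /\ c1 * gap q s k <= De q s k <= BD * eta /\
  near_pair r (po q s k) /\ near_pair r (pi q s k) /\
  D (po q s k) = De q s k /\ D (pi q s k) = - De q s k).
{ intros q s j Hq Hm Hj; assert (Hs := proj1 Hm); assert (Hq2 : (2 <= q)%nat) by lia.
  assert (A1 := Hgaps q s Hq Hm j Hj); assert (A2 := closed_step q j s Hq2 Hs Hj).
  assert (A3 := closed_range q j s Hq2 Hs ltac:(lia)).
  assert (A4 := closed_range q (S j) s Hq2 Hs ltac:(lia)).
  assert (A5 : 0 < gap q s j <= eta) by (unfold gap, S_; lra).
  split; [exact A5|]; split; [split|split; [|split; [|split]]].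
  - unfold gap, De, S_; apply Inc; lra.
  - apply Rle_trans with (BD * gap q s j); [|apply Rmult_le_compat_l; lra].
    pose proof (MVT_bound xt D1 (S_ q s j) (S_ q s (S j)) BD) as H.
    apply Rle_trans with (1 := Rle_abs _).
    rewrite <- (Rabs_pos_eq (gap q s j)) by lra; apply H.
    + intros; apply Dxt.
    + unfold S_; intros y Hy; rewrite Rmin_left, Rmax_right in Hy by lra; apply HBD; lra.
  - split; [exact A3|]; unfold po; simpl snd; rewrite Rabs_pos_eq; lra.
  - split; [exact A4|]; unfold pi; simpl snd; rewrite Rabs_Ropp, Rabs_pos_eq; lra.
  - unfold D, po, De, gap; simpl; f_equal; f_equal; ring.
  - unfold D, pi, De, gap; simpl; replace (S_ q s (S j) + - (S_ q s (S j) - S_ q s j)) with (S_ q s j) by ring.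
    ring. }
assert (Xpos : forall p, near_pair r p -> 0 < snd p -> 0 < X p).
{ intros p Hp Ht; destruct (Hloc p Hp) as [_ [H _]].
  assert (0 < snd p ^ 2) by (apply pow_lt; lra).
  destruct (Rle_lt_dec (X p) 0); [nra|assumption]. }
assert (Xneg : forall p, near_pair r p -> snd p < 0 -> X p < 0).
{ intros p Hp Ht; destruct (Hloc p Hp) as [_ [H _]].
  assert (0 < snd p ^ 2) by (rewrite <- Rsqr_pow2; apply Rsqr_pos_lt; lra).
  destruct (Rle_lt_dec 0 (X p)); [nra|assumption]. }

(* The reflection law as a recursion for the gaps *)
assert (Law : forall q s j, (q1 <= q)%nat -> max_sym_orbit g1 g2 q s -> (S j < q)%nat ->
  Y (po q s (S j)) / X (po q s (S j)) = - (Y (pi q s j) / X (pi q s j))).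
{ intros q s j Hq Hm Hj.
  destruct (Fgap q s (S j) Hq Hm Hj) as ([U1 _] & _ & No & _).
  destruct (Fgap q s j Hq Hm ltac:(lia)) as ([V1 _] & _ & _ & Ni & _).
  assert (E1 : S_ q s (S j) + gap q s (S j) = S_ q s (S (S j))) by (unfold gap; ring).
  assert (E2 : S_ q s (S j) + - gap q s j = S_ q s j) by (unfold gap; ring).
  assert (HXo := Xpos _ No ltac:(simpl; lra)); assert (HXi := Xneg _ Ni ltac:(simpl; lra)).
  assert (HYo := proj1 (Hloc _ No)); assert (HYi := proj1 (Hloc _ Ni)).
  revert HXo HXi HYo HYi; unfold X, Y, po, pi; simpl fst; simpl snd; rewrite E1, E2.
  intros; apply (angle_law g1 g2 d1 d2); auto.
  apply (reflection_law 8 g1 g2 d1 d2 e1 e2); auto; lia. }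
set (rN := fun p => m (fst p) * Y p / X p - D p - (z4 (fst p) * snd p ^ 3 + z5 (fst p) * snd p ^ 4)) in *.
assert (Rec : forall q s j, (q1 <= q)%nat -> max_sym_orbit g1 g2 q s -> (S j < q)%nat ->
  De q s (S j) - De q s j + (z4 (S_ q s (S j)) * (gap q s (S j) ^ 3 - gap q s j ^ 3)
     + z5 (S_ q s (S j)) * (gap q s (S j) ^ 4 + gap q s j ^ 4))
  = - (rN (po q s (S j)) + rN (pi q s j))).
{ intros q s j Hq Hm Hj; assert (L := Law q s j Hq Hm Hj).
  destruct (Fgap q s (S j) Hq Hm Hj) as (_ & _ & _ & _ & Do & _).
  destruct (Fgap q s j Hq Hm ltac:(lia)) as (_ & _ & _ & _ & _ & Di).
  unfold rN; rewrite Do, Di; unfold Rdiv in *; rewrite !Rmult_assoc, L.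
  unfold po, pi; simpl fst; simpl snd; ring. }
assert (Har : forall q s j, (q1 <= q)%nat -> max_sym_orbit g1 g2 q s -> (S j < q)%nat ->
  Rabs (De q s (S j) - De q s j) <= CH * (De q s (S j) ^ 3 + De q s j ^ 3)).
{ intros q s j Hq Hm Hj; assert (E := Rec q s j Hq Hm Hj).
  destruct (Fgap q s (S j) Hq Hm Hj) as (U & UD & No & _).
  destruct (Fgap q s j Hq Hm ltac:(lia)) as (V & VD & _ & Ni & _).
  assert (B : forall p t, near_pair r p -> Rabs (snd p) = t -> 0 < t <= eta ->
    Rabs (rN p + (z4 (fst p) * snd p ^ 3 + z5 (fst p) * snd p ^ 4)) <= (B4 + B5 + KN) * t ^ 3).
  { intros p t Hp Et Ht; assert (H := HKN p Hp); unfold incr in H; rewrite Et in H.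
    destruct Hp as [Hp _].
    assert (t3 : 0 < t ^ 3) by (apply pow_lt; lra).
    assert (T4 : t ^ 4 <= t ^ 3).
    { replace (t ^ 4) with (t ^ 3 * t) by ring; nra. }
    assert (T5 : t ^ 5 <= t ^ 3).
    { replace (t ^ 5) with (t ^ 4 * t) by ring; assert (0 < t ^ 4) by (apply pow_lt; lra); nra. }
    eapply Rle_trans; [apply Rabs_triang|].
    replace ((B4 + B5 + KN) * t ^ 3) with (KN * t ^ 3 + (B4 * t ^ 3 + B5 * t ^ 3)) by ring.
    apply Rplus_le_compat; [eapply Rle_trans; [exact H|now apply Rmult_le_compat_l]|].
    eapply Rle_trans; [apply Rabs_triang|]; apply Rplus_le_compat; rewrite Rabs_mult, <- RPow_abs, Et.
    - apply Rmult_le_compat; [apply Rabs_pos|lra|now apply HB4|lra].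
    - apply Rmult_le_compat; [apply Rabs_pos|apply pow_le; lra|now apply HB5|exact T4]. }
  assert (Bo := B (po q s (S j)) (gap q s (S j)) No ltac:(simpl; rewrite Rabs_pos_eq; lra) ltac:(lra)).
  assert (Bi := B (pi q s j) (gap q s j) Ni ltac:(simpl; rewrite Rabs_Ropp, Rabs_pos_eq; lra) ltac:(lra)).
  unfold po, pi in Bo, Bi; fold (po q s (S j)) (pi q s j) in Bo, Bi; simpl fst in Bo, Bi; simpl snd in Bo, Bi.
  assert (G3 : forall t d, 0 < t -> c1 * t <= d -> (B4 + B5 + KN) * t ^ 3 <= CH * d ^ 3).
  { intros t d Ht Hd; replace ((B4 + B5 + KN) * t ^ 3) with (CH * (c1 * t) ^ 3) by (unfold CH; field; lra).
    apply Rmult_le_compat_l; [exact CH0|apply pow_incr; split; [nra|exact Hd]]. }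
  pose proof (G3 _ _ (proj1 U) (proj1 UD)) as H1; pose proof (G3 _ _ (proj1 V) (proj1 VD)) as H2.
  apply Rabs_le; apply Rabs_le_between in Bo, Bi.
  lra. }
clear HKN Law.
assert (Hcmp : forall q s j, (q1 <= q)%nat -> max_sym_orbit g1 g2 q s -> (j < q)%nat ->
  Rabs (De q s j - / INR q) <= 16 * CH / INR q ^ 2).
{ intros q s j Hq Hm Hj; apply (gaps_comparable q (De q s) CH (BD * eta)); auto; try lia.
  - intros i Hi; destruct (Fgap q s i Hq Hm Hi) as ([U1 U2] & [U3 U4] & _); split; [nra|exact U4].
  - unfold De; rewrite (sumR_telescope q (fun k => xt (S_ q s k))); unfold S_.
    rewrite closed_q, closed_0, X0, X1 by (try apply Hm; lia); ring. }

(* Expansions uniform over all orbits and vertices *)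
set (I := (nat * (nat -> R) * nat)%type).
set (h := fun i : I => / INR (fst (fst i))).
set (Dg := fun i : I => (q1 <= fst (fst i))%nat /\ max_sym_orbit g1 g2 (fst (fst i)) (snd (fst i))
   /\ (snd i < fst (fst i))%nat).
(* [Dg] runs over the edges, [Dv] over the pairs of consecutive edges, which meet at vertex
   [j + 1 < q]. *)
set (Dv := fun i : I => (q1 <= fst (fst i))%nat /\ max_sym_orbit g1 g2 (fst (fst i)) (snd (fst i))
   /\ (S (snd i) < fst (fst i))%nat).
assert (Sg : small Dg h).
{ intros [[q s] j] [Hq _]; unfold h; simpl in *.
  assert (Q : 1 <= INR q) by (apply INR_pos; lia); split; [inv_pos|].
  rewrite <- Rinv_1; apply Rinv_le_contravar; lra. }
set (nx := fun i : I => (fst i, S (snd i))).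
assert (Nx : forall i, Dv i -> Dg (nx i) /\ h i = h (nx i)).
{ intros [[q s] j] H; split; [exact H|reflexivity]. }
assert (Vg : forall i, Dv i -> Dg i /\ h i = h i).
{ intros [[q s] j] (H1 & H2 & H3); split; [|reflexivity]; split; [exact H1|split; [exact H2|]].
  simpl in *; lia. }
assert (Sv : small Dv h) by (intros i Hi; apply Sg, Vg, Hi).
set (V := fun i : I => S_ (fst (fst i)) (snd (fst i)) (snd i)).
set (U := fun i : I => gap (fst (fst i)) (snd (fst i)) (snd i)).
set (E := fun i : I => De (fst (fst i)) (snd (fst i)) (snd i)).
assert (VR : forall i, Dg i -> 0 <= V i <= 1).
{ intros [[q s] j] (H1 & H2 & H3); apply closed_range; [simpl in *; lia|apply H2|simpl in *; lia]. }
assert (OV : forall f, lip01 f -> bigO Dg h 0 (fun i => f (V i))).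
{ intros f Hf; destruct (lip01_bounded f Hf) as [B [B0 HB]]; exists B; split; [exact B0|].
  intros i Hi; simpl; rewrite Rmult_1_r; now apply HB, VR. }
assert (OE : bigO Dg h 2 (fun i => E i - h i)).
{ exists (16 * CH); split; [lra|intros [[q s] j] (H1 & H2 & H3)]; unfold E, h; simpl fst in *; simpl snd in *.
  assert (Q : 1 <= INR q) by (apply INR_pos; lia).
  replace (16 * CH * (/ INR q) ^ 2) with (16 * CH / INR q ^ 2) by (field; lra); auto. }
assert (OE1 : bigO Dg h 1 E).
{ eapply bigO_ext; [apply bigO_add; [eapply (bigO_le _ _ 1 2); [exact Sg|exact OE|lia]|exact (bigO_self _ _ Sg)]|].
  intros i _; cbv beta; ring. }
assert (OU : bigO Dg h 1 U).
{ destruct OE1 as [K [K0 HK]]; exists (/ c1 * K); assert (0 < / c1) by (now apply Rinv_0_lt_compat).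
  split; [apply Rmult_le_pos; lra|intros i Hi; specialize (HK i Hi)].
  assert (Hi' := Hi); destruct Hi' as (H1 & H2 & H3).
  destruct (Fgap _ _ _ H1 H2 H3) as ([F1 F2] & [F3 F4] & _).
  rewrite Rmult_assoc; unfold U; rewrite Rabs_pos_eq by lra.
  apply Rle_trans with (/ c1 * E i).
  - apply Rmult_le_reg_l with c1; [exact c10|].
    rewrite <- Rmult_assoc, Rinv_r, Rmult_1_l by lra; exact F3.
  - apply Rmult_le_compat_l; [lra|]; eapply Rle_trans; [apply Rle_abs|exact HK]. }
set (pO := fun i : I => po (fst (fst i)) (snd (fst i)) (snd i)).
set (pI := fun i : I => pi (fst (fst i)) (snd (fst i)) (snd i)).
assert (NpO : forall i, Dg i -> near_pair r (pO i)).
{ intros i (H1 & H2 & H3); apply (Fgap _ _ _ H1 H2 H3). }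
assert (NpI : forall i, Dg i -> near_pair r (pI i)).
{ intros i (H1 & H2 & H3); apply (Fgap _ _ _ H1 H2 H3). }
assert (DpO : forall i, Dg i -> D (pO i) = E i).
{ intros i (H1 & H2 & H3); apply (Fgap _ _ _ H1 H2 H3). }
assert (DpI : forall i, Dg i -> D (pI i) = - E i).
{ intros i (H1 & H2 & H3); apply (Fgap _ _ _ H1 H2 H3). }
assert (ED' : bigO (near_pair r) incr 3 (fun p => D p - (D1 (fst p) * snd p + D2 (fst p) * snd p ^ 2))).
{ apply (bigO_restrict _ _ _ _ _ ED); intros p Hp; apply (near_pair_mono r); [lra|exact Hp]. }
assert (HO : bigO Dg h 3 (fun i => E i - (D1 (V i) * U i + D2 (V i) * U i ^ 2))).
{ eapply bigO_ext; [exact (bigO_comp Dg h r 3 _ pO ED' NpO OU)|].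
  intros i Hi; cbv beta; rewrite (DpO i Hi); reflexivity. }
assert (OmU : bigO Dg h 1 (fun i => snd (pI i))) by exact (bigO_opp _ _ _ _ OU).
assert (HI : bigO Dg h 3 (fun i => E i - (D1 (V (nx i)) * U i - D2 (V (nx i)) * U i ^ 2))).
{ eapply bigO_ext; [exact (bigO_opp _ _ _ _ (bigO_comp Dg h r 3 _ pI ED' NpI OmU))|].
  intros i Hi; cbv beta; rewrite (DpI i Hi).
  change (fst (pI i)) with (V (nx i)); change (snd (pI i)) with (- U i); ring. }
assert (RO : bigO Dg h 5 (fun i => rN (pO i))) by exact (bigO_comp Dg h r 5 _ pO EN NpO OU).
assert (RI : bigO Dg h 5 (fun i => rN (pI i))) by exact (bigO_comp Dg h r 5 _ pI EN NpI OmU).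
assert (VN : forall f, lip01 f -> bigO Dv h 0 (fun i => f (V (nx i)))).
{ intros f Hf; exact (bigO_pull Dg Dv h h 0 _ nx (OV f Hf) Nx). }
assert (KV := gap_recursion Dv h (fun i => z4 (V (nx i))) (fun i => z5 (V (nx i)))
  (fun i => D1 (V (nx i))) (fun i => D2 (V (nx i))) (fun i => U (nx i)) U (fun i => E (nx i)) E c1 Sv c10
  ltac:(intros i Hi; apply Hc1, VR, Nx, Hi) (VN z4 L4) (VN z5 L5) (VN D1 LD1) (VN D2 LD2)
  (bigO_pull Dg Dv h h 1 _ nx OU Nx) (bigO_pull Dg Dv h h 1 _ (fun i => i) OU Vg)
  (bigO_pull Dg Dv h h 2 _ nx OE Nx) (bigO_pull Dg Dv h h 2 _ (fun i => i) OE Vg)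
  (bigO_pull Dg Dv h h 3 _ nx HO Nx) (bigO_pull Dg Dv h h 3 _ (fun i => i) HI Vg)).
destruct KV as [K2 [K20 HK2]].
{ eapply bigO_ext; [apply bigO_opp, bigO_add|].
  - exact (bigO_pull Dg Dv h h 5 _ nx RO Nx).
  - exact (bigO_pull Dg Dv h h 5 _ (fun i => i) RI Vg).
  - intros [[q s] j] (H1 & H2 & H3); exact (Rec q s j H1 H2 H3). }

(* Coefficient functions of the limiting law *)
set (i1 := fun s => / D1 s).
assert (Li1 : lip01 i1) by exact (lip01_inv D1 c1 c10 Hc1 LD1).
assert (Lim : lip01 (fun s => / m s)) by exact (lip01_inv m cm cm0 Hcm Lm).
assert (Li2 := lip01_mul _ _ Li1 Li1); assert (Li4 := lip01_mul _ _ Li2 Li2).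
(* The coefficient found in [gap_recursion], written with products of [1 / D1] so that it inherits a
   Lipschitz bound. *)
set (a := fun s => -6 * (z4 s * D2 s) * ((i1 s * i1 s) * (i1 s * i1 s) * i1 s)
   + 2 * z5 s * ((i1 s * i1 s) * (i1 s * i1 s))).
assert (La : lip01 a).
{ apply lip01_add; apply lip01_mul.
  - exact (lip01_scal _ _ (lip01_mul _ _ L4 LD2)).
  - exact (lip01_mul _ _ Li4 Li1).
  - exact (lip01_scal _ _ L5).
  - exact Li4. }
set (be := fun s => z4 s * (i1 s * i1 s * i1 s) - 1 / 2 * (/ m s * / m s)).
assert (Lbe : lip01 be).
{ apply lip01_sub; [exact (lip01_mul _ _ L4 (lip01_mul _ _ Li2 Li1))|].
  exact (lip01_scal _ _ (lip01_mul _ _ Lim Lim)). }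
destruct (lip01_comp a sg Ls La Lsg Rsg) as [Fa [LFa BFa]].
destruct (lip01_comp be sg Ls Lbe Lsg Rsg) as [Fb [LFb BFb]].
set (f := fun y => a (sg y)) in *; set (bt := fun y => be (sg y)) in *.
destruct (second_order_positions f Fa Fa (16 * CH) K2 LFa BFa ltac:(lra) K20) as [K3 [K30 HK3]].
destruct (weight_expansion Dg h (fun i => z4 (V i)) (fun i => z5 (V i)) (fun i => D1 (V i))
  (fun i => m (V i)) (fun i => X (pO i)) (fun i => Y (pO i)) E U (Rmin c1 cm) Sg) as [K4 [K40 HK4]].
{ now apply Rmin_glb_lt. }
{ intros i Hi; eapply Rle_trans; [apply Rmin_l|apply Hc1, VR, Hi]. }
{ intros i Hi; eapply Rle_trans; [apply Rmin_r|apply Hcm, VR, Hi]. }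
{ exact (OV z4 L4). }
{ exact (OV z5 L5). }
{ exact (OV m Lm). }
{ intros i Hi; apply Xpos; [now apply NpO|].
  destruct Hi as (H1 & H2 & H3); apply (Fgap _ _ _ H1 H2 H3). }
{ exact OU. }
{ apply (gap_first_order Dg h _ (fun i => D2 (V i)) U E c1 Sg c10); auto. }
{ exact OE. }
{ eapply bigO_ext; [exact RO|]; intros i Hi; unfold rN; rewrite (DpO i Hi); reflexivity. }
(* [b0] is the derivative of [al0]: the gaps deviate from [1/q] by [b0 / q^3], and [bt] adds the
   passage from the gap to the sine. *)
set (al0 := fun y => y * prim (prim f) 1 - prim (prim f) y).
set (b0 := fun y => prim (prim f) 1 - prim f y).
assert (Cf : continuity f) by exact (lip_continuity _ _ LFa).
assert (CI : continuity (prim f)) by exact (lip_continuity _ _ (lip_prim f Fa Cf BFa)).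
assert (DI : forall y, is_derive (prim f) y (f y)) by (intro; now apply is_derive_integ).
assert (DJ : forall y, is_derive (prim (prim f)) y (prim f y)) by (intro; now apply is_derive_integ).
assert (Lal0 : lip01 al0).
{ apply lip01_sub; [|exact (lip01_derive _ _ DJ CI)].
  apply lip01_mul; [|apply lip01_const].
  exists 1; split; [lra|intros; lra]. }
assert (Lb0 : lip01 b0) by (apply lip01_sub; [apply lip01_const|exact (lip01_derive _ _ DI Cf)]).
destruct (lip01_comp al0 clamp 1 Lal0 lip_clamp clamp_range) as [A1 [LA1 BA1]].
destruct (lip01_comp b0 clamp 1 Lb0 lip_clamp clamp_range) as [A2 [LA2 BA2]].
assert (N1 := lip_nonneg _ _ LA1); assert (N2 := lip_nonneg _ _ LA2); assert (N3 := lip_nonneg _ _ LFb).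
exists (fun y => al0 (clamp y)), (fun y => b0 (clamp y) + bt y), (A1 + A2 + Fb), (K3 + K4 + Fb * K3), q1.
split; [apply (lip_le A1); [exact LA1|lra]|].
split.
{ intros s t; replace (b0 (clamp s) + bt s - (b0 (clamp t) + bt t))
    with ((b0 (clamp s) - b0 (clamp t)) + (bt s - bt t)) by ring.
  eapply Rle_trans; [apply Rabs_triang|].
  specialize (LA2 s t); specialize (LFb s t); cbv beta in LA2.
  pose proof (Rabs_pos (s - t)); nra. }
split; [intro t; eapply Rle_trans; [apply BA1|lra]|].
split; [intro t; eapply Rle_trans; [apply Rabs_triang|]; specialize (BA2 t); specialize (BFb t); unfold bt; lra|].
assert (FK : 0 <= Fb * K3) by (now apply Rmult_le_pos).
split; [lra|split; [exact Hq1|]].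

(* Verification for a single orbit *)
intros q s Hq Hm j Hj.
assert (Hs := proj1 Hm).
assert (Q : 1 <= INR q) by (apply INR_pos; lia).
assert (VRq : forall k, (k <= q)%nat -> 0 <= S_ q s k <= 1) by (intros; apply closed_range; auto; lia).
destruct (HK3 q (fun k => xt (S_ q s k))) as (Pos1 & Pos2 & Pos3).
{ lia. }
{ unfold S_; rewrite closed_0; auto; lia. }
{ unfold S_; rewrite closed_q; exact X1. }
{ intros i Hi; exact (Hcmp q s i Hq Hm Hi). }
{ intros i Hi; assert (H := HK2 (q, s, i) (conj Hq (conj Hm Hi))); cbv beta in H.
  replace (K2 / INR q ^ 5) with (K2 * (/ INR q) ^ 5) by (field; lra).
  eapply Rle_trans; [|exact H]; right; f_equal.
  unfold f; rewrite Hsg by (apply VRq; lia).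
  unfold E, nx, V, h, De, a, i1; simpl fst; simpl snd.
  assert (c1 <= D1 (S_ q s (S i))) by (apply Hc1, VRq; lia).
  field; split; lra. }
assert (Rj : 0 <= INR j / INR q <= 1).
{ split; [apply Rmult_le_pos; [apply pos_INR|inv_nonneg]|].
  apply Rmult_le_reg_r with (INR q); [lra|].
  unfold Rdiv; rewrite Rmult_assoc, Rinv_l, Rmult_1_r, Rmult_1_l by lra; apply le_INR; lia. }
rewrite (clamp_id _ Rj).
assert (Esj : S_ q s j = s j) by (unfold S_; now apply closed_lt).
split.
{ rewrite <- Esj, Ext by (apply VRq; lia); eapply Rle_trans; [exact (Pos3 j ltac:(lia))|].
  apply Rmult_le_compat_r; [inv_nonneg|lra]. }
assert (Hw := HK4 (q, s, j) (conj Hq (conj Hm Hj))); cbv beta in Hw.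
destruct (Fgap q s j Hq Hm Hj) as (_ & _ & No & _).
assert (Ew : 2 * C * Rpower (rho d1 d2 e1 e2 (s j)) (1 / 3) * sin_refl g1 g2 d1 d2 q s j
  = m (V (q, s, j)) * (Y (pO (q, s, j)) / sqrt (X (pO (q, s, j)) ^ 2 + Y (pO (q, s, j)) ^ 2))).
{ assert (HY := proj1 (Hloc _ No)).
  assert (Eg : S_ q s j + gap q s j = closed q s (S j)) by (unfold gap, S_; ring).
  unfold X, Y, pO, po, V in *; simpl fst in *; simpl snd in *; rewrite Eg, Esj in *.
  rewrite (sin_refl_frame g1 g2 d1 d2 q j s P1 P2 Hu Hs Hj HY).
  f_equal; unfold m, rho; fold (curv d1 d2 e1 e2 (s j)); fold k; rewrite Rpower_inv_neg by apply Kp.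
  reflexivity. }
rewrite Ew.
(* The sine correction is naturally evaluated at the vertex; moving it to the grid point [j/q] costs
   one further order, by the position estimate. *)
assert (Hb : Rabs (be (S_ q s j) - bt (INR j / INR q)) <= Fb * (K3 / INR q)).
{ rewrite <- (Hsg (S_ q s j)) by (apply VRq; lia).
  eapply Rle_trans; [apply (LFb (xt (S_ q s j)))|].
  apply Rmult_le_compat_l; [exact N3|exact (Pos1 j ltac:(lia))]. }
assert (Hb3 : Rabs ((be (S_ q s j) - bt (INR j / INR q)) / INR q ^ 3) <= Fb * K3 / INR q ^ 4).
{ unfold Rdiv at 1; rewrite Rabs_mult, (Rabs_pos_eq (/ _)) by (inv_nonneg).
  replace (Fb * K3 / INR q ^ 4) with (Fb * (K3 / INR q) * / INR q ^ 3) by (field; lra).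
  apply Rmult_le_compat_r; [inv_nonneg|exact Hb]. }
assert (Hg := Pos2 j Hj); cbv beta in Hg.
assert (Ebe : z4 (V (q, s, j)) / D1 (V (q, s, j)) ^ 3 - / (2 * m (V (q, s, j)) ^ 2) = be (S_ q s j)).
{ unfold V, be, i1; simpl fst; simpl snd.
  assert (c1 <= D1 (S_ q s j)) by (apply Hc1, VRq; lia).
  assert (cm <= m (S_ q s j)) by (apply Hcm, VRq; lia).
  field; split; lra. }
rewrite Ebe in Hw; unfold E, h in Hw; simpl fst in Hw; simpl snd in Hw.
set (W := m (V (q, s, j)) * _) in *.
replace ((K3 + K4 + Fb * K3) / INR q ^ 4) with (K4 * (/ INR q) ^ 4 + K3 / INR q ^ 4 + Fb * K3 / INR q ^ 4)
  by (field; lra).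
replace (W - (1 + (b0 (INR j / INR q) + bt (INR j / INR q)) / INR q ^ 2) / INR q)
  with ((W - (De q s j + be (S_ q s j) * (/ INR q) ^ 3))
   + (De q s j - (/ INR q + (prim (prim f) 1 - prim f (INR j / INR q)) / INR q ^ 3))
   + (be (S_ q s j) - bt (INR j / INR q)) / INR q ^ 3) by (unfold b0; field; lra).
unfold De at 2; apply Rabs_le; apply Rabs_le_between in Hw, Hg, Hb3; unfold De in *; lra.
Qed.

(** * The operator *)

Lemma ell_tilde_sum (g1 g2 d1 d2 e1 e2 : R -> R) (C : R) (x : R -> R) (q : nat)
    (s : nat -> R) (u : R -> R) :
  ell_tilde g1 g2 d1 d2 e1 e2 C x q s u
  = sumR q (fun k => 2 * C * Rpower (rho d1 d2 e1 e2 (s k)) (1 / 3)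
                     * sin_refl g1 g2 d1 d2 q s k * u (x (s k))).
Proof. apply sumR_ext; intros; ring. Qed.

(** The points stay in a fixed interval [[-B, B]], and the [q] weights are each at most [B / q]. *)
Lemma moment_bounded (al b u : R -> R) (A K : R) : continuity u ->
  (forall t, Rabs (al t) <= A) -> (forall t, Rabs (b t) <= A) -> 0 <= K ->
  exists M, forall q xs ws, (1 <= q)%nat -> near_equidistributed al b K q xs ws ->
    Rabs (sumR q (fun k => ws k * u (xs k))) <= M.
Proof.
intros Cu Ha Hb K0; assert (A0 : 0 <= A) by (eapply Rle_trans; [apply Rabs_pos|apply (Ha 0)]).
set (B := 1 + A + K); destruct (continuity_bounded u (- B) B Cu) as [M [M0 HM]].
exists (B * M); intros q xs ws Hq Hn; assert (Q := INR_pos q Hq).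
assert (Dn : forall c n, 0 <= c -> c / INR q ^ n <= c).
{ intros c n Hc; unfold Rdiv; rewrite <- (Rmult_1_r c) at 2; apply Rmult_le_compat_l; [exact Hc|].
  rewrite <- Rinv_1; apply Rinv_le_contravar; [lra|apply pow_R1_Rle; lra]. }
assert (Dz : forall z n, Rabs z <= A -> Rabs (z / INR q ^ n) <= A).
{ intros z n Hz; unfold Rdiv; rewrite Rabs_mult, (Rabs_pos_eq (/ _))
    by (inv_nonneg).
  apply Rle_trans with (A / INR q ^ n); [|now apply Dn].
  apply Rmult_le_compat_r; [inv_nonneg|exact Hz]. }
apply Rle_trans with (INR q * (B / INR q * M)); [|right; field; lra].
apply sumR_abs_le_const; intros k Hk; destruct (Hn k Hk) as [H1 H2].
set (t := INR k / INR q) in *.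
assert (Ht : 0 <= t <= 1).
{ unfold t; split; [apply Rmult_le_pos; [apply pos_INR|inv_nonneg]|].
  apply Rmult_le_reg_r with (INR q); [lra|].
  unfold Rdiv; rewrite Rmult_assoc, Rinv_l, Rmult_1_r, Rmult_1_l by lra; apply le_INR; lia. }
rewrite Rabs_mult; apply Rmult_le_compat; try apply Rabs_pos.
- assert (H3 : Rabs (1 + b t / INR q ^ 2) <= 1 + A).
  { pose proof (Dz (b t) 2%nat (Hb t)) as H; apply Rabs_le; apply Rabs_le_between in H; lra. }
  replace (ws k) with ((1 + b t / INR q ^ 2) / INR q + (ws k - (1 + b t / INR q ^ 2) / INR q)) by ring.
  eapply Rle_trans; [apply Rabs_triang|].
  replace (B / INR q) with ((1 + A) / INR q + K / INR q) by (unfold B; field; lra).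
  apply Rplus_le_compat.
  + unfold Rdiv at 1; rewrite Rabs_mult, (Rabs_pos_eq (/ _)) by (inv_nonneg).
    apply Rmult_le_compat_r; [inv_nonneg|exact H3].
  + eapply Rle_trans; [exact H2|].
    replace (K / INR q ^ 4) with (K / INR q ^ 3 / INR q) by (field; lra).
    apply Rmult_le_compat_r; [inv_nonneg|now apply Dn].
- apply HM.
  pose proof (Dz (al t) 2%nat (Ha t)) as H3; pose proof (Dn K 3%nat K0) as H4.
  unfold B; apply Rabs_le_between in H1, H3; lra.
Qed.

Theorem theorem6p1 :
  forall (g1 g2 d1 d2 e1 e2 : R -> R),
    sym_domain 8 g1 g2 d1 d2 e1 e2 ->
    forall (C : R) (x : R -> R),
      lazutkin d1 d2 e1 e2 C x ->
      exists q0 : nat, (2 <= q0)%nat /\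
        forall orb : nat -> nat -> R,
          (forall q, (q0 <= q)%nat -> max_sym_orbit g1 g2 q (orb q)) ->
          (* the operator takes values in l^infinity *)
          (forall u, Cr_sym 8 q0 u ->
             exists M, forall q, (q0 <= q)%nat ->
               Rabs (ell_tilde g1 g2 d1 d2 e1 e2 C x q (orb q) u) <= M) /\
          (* and is injective *)
          (forall u v, Cr_sym 8 q0 u -> Cr_sym 8 q0 v ->
             (forall q, (q0 <= q)%nat ->
                ell_tilde g1 g2 d1 d2 e1 e2 C x q (orb q) u
                = ell_tilde g1 g2 d1 d2 e1 e2 C x q (orb q) v) ->
             forall y, u y = v y).
Proof.
intros g1 g2 d1 d2 e1 e2 Hdom C x Hlaz.
destruct (orbit_expansion g1 g2 d1 d2 e1 e2 C x Hdom Hlaz)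
  as (al & b & A & K & q1 & La & Lb & Ba & Bb & K0 & Hq1 & Hnear).
destruct (operator_kernel_trivial al b A K La Lb Ba Bb K0) as [qm [Hqm Hker]].
(* Both thresholds come from the domain alone: [q1] from the orbit asymptotics, [qm] from the
   contraction. Hence [q0] does not depend on the choice of the orbits. *)
exists (Nat.max q1 qm); split; [lia|]; intros orb Horb.
set (xs := fun q k => x (orb q k)).
set (ws := fun q k => 2 * C * Rpower (rho d1 d2 e1 e2 (orb q k)) (1 / 3)
                      * sin_refl g1 g2 d1 d2 q (orb q) k).
assert (Hn : forall q, (Nat.max q1 qm <= q)%nat -> near_equidistributed al b K q (xs q) (ws q)).
{ intros q Hq; apply Hnear; [lia|now apply Horb]. }
split.
- intros u (Cu & _).
  destruct (moment_bounded al b u A K (Ck_continuity 8 u Cu) Ba Bb K0) as [M HM].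
  exists M; intros q Hq; rewrite ell_tilde_sum; apply (HM q (xs q) (ws q)); [lia|now apply Hn].
(* By linearity it suffices that the kernel is trivial, applied to [u - v]; [F] lists its successive
   derivatives. *)
- intros u v (Cu & Pu & Eu & Zu) (Cv & Pv & Ev & Zv) Heq y.
  destruct (Ck_derivs 8 (fun t => u t - v t) (Ck_minus 8 u v Cu Cv)) as [F [F0 [FD FC]]].
  apply Rminus_diag_uniq; change (u y - v y) with ((fun t => u t - v t) y); rewrite <- F0.
  apply (Hker (Nat.max q1 qm) xs ws ltac:(lia) Hn (F 0%nat) (F 1%nat) (F 2%nat) (F 3%nat) (F 4%nat));
    try (intro t; apply FD; lia).
  + apply FC; lia.
  + rewrite F0; intro t; now rewrite Pu, Pv.
  + rewrite F0; intro t; now rewrite Eu, Ev.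
  + intros k Hk; rewrite F0; unfold cosc.
    rewrite (integ_ext _ (fun t => u t * cos (2 * PI * INR k * t) - v t * cos (2 * PI * INR k * t)))
      by (intros; ring).
    rewrite integ_sub by (apply continuity_times;
      [now apply (Ck_continuity 8)|apply continuity_cos_lin]).
    rewrite (is_RInt_integ _ _ _ _ (Zu k Hk)), (is_RInt_integ _ _ _ _ (Zv k Hk)); ring.
  + intros q Hq; rewrite F0, (sumR_ext _ _ (fun k => ws q k * u (xs q k) - ws q k * v (xs q k)))
      by (intros; ring).
    rewrite sumR_minus; specialize (Heq q Hq); rewrite !ell_tilde_sum in Heq.
    exact (Rminus_diag_eq _ _ Heq).
Qed.
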